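(* Consider CFG separation: given finite sets $\mathit{P}$ and $\mathit{N}$ of finite words over a finite alphabet $\Sigma$, a finite set of nonterminals $\mathit{NT}$ with axiom $S\in\mathit{NT}$, and a regular tree (meta-)grammar $\mathcal{G}$ over syntax trees encoding context-free grammars over $\mathit{NT}$ and $\Sigma$ such that every grammar in $L(\mathcal{G})$ is productive, synthesize a context-free grammar $G\in L(\mathcal{G})$ with $\mathit{P}\subseteq L(G)$ and $\mathit{N}\cap L(G)=\emptyset$, or declare none exists. This problem is decidable in time $\mathcal{O}(2^{\mathrm{poly}(k)}\cdot|\mathcal{G}|)$, where $k=mn^2\cdot|\mathit{NT}|$, $n=\max_{w\in\mathit{P}\cup\mathit{N}}|w|$ and $m=|\mathit{P}|+|\mathit{N}|$.
   Context: Context-free grammars over nonterminals $\mathit{NT}$, terminals $\Sigma$, axiom $S$ are encoded as syntax trees: a binary root symbol $\mathit{top}(S)$; productions are listed along the right spine using binary symbols $\mathit{lhs}(A)$ (one per $A\in\mathit{NT}$) ending with a nullary symbol $\mathit{end}$, with the production's right-hand side in the left child; right-hand sides are built with a binary concatenation symbol $\cdot$ from nullary symbols $\mathit{rhs}(A)$ for occurrences of nonterminal $A$ and $\mathit{term}(a)$ for terminals $a\in\Sigma$ (the root's left child holds a right-hand side of an $S$-production). A grammar is productive if each production $A\to\alpha$ has $\alpha\in(\Sigma\cup\mathit{NT})^*\Sigma(\Sigma\cup\mathit{NT})^*$, i.e. contains at least one terminal. $L(G)$ is the language generated from $S$. $L(\mathcal{G})$ is the tree language of the meta-grammar and $|\mathcal{G}|$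 its size. *)

(* Defs.v *)
From Stdlib Require Import List Relation_Operators.
From mathcomp Require Import all_boot.

Set Implicit Arguments.
Unset Strict Implicit.
Unset Printing Implicit Defensive.

(** [q] and [s] are the numbers of nonterminals and terminals; the axiom of a
    grammar is a separate parameter. *)

Definition symb (q s : nat) : Type := ('I_q + 'I_s)%type.

Definition is_terminal q s (x : symb q s) : bool :=
  if x is inr _ then true else false.

Definition cfg (q s : nat) : Type := seq ('I_q * seq (symb q s)).

Inductive cfg_step q s (G : cfg q s) : seq (symb q s) -> seq (symb q s) -> Prop :=
  CfgStep (A : 'I_q) (alpha u v : seq (symb q s)) :
    (A, alpha) \in G -> cfg_step G (u ++ inl A :: v) (u ++ alpha ++ v).

Definition cfg_lang q s (S : 'I_q) (G : cfg q s) (w : seq 'I_s) : Prop :=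
  clos_refl_trans _ (cfg_step G) [:: inl S] [seq inr a | a <- w].

Definition productive q s (G : cfg q s) : bool :=
  all (fun r => has (@is_terminal q s) r.2) G.

(** The ranked alphabet has only nullary and binary symbols.  [Top] is the
    root symbol top(S); since the axiom S is fixed there is only one. *)

Inductive nsym (q s : nat) : Type :=
  | End
  | Rhs of 'I_q
  | Term of 'I_s.

Inductive bsym (q : nat) : Type :=
  | Top
  | Lhs of 'I_q
  | Cat.

Arguments End {q s}.
Arguments Rhs {q s}.
Arguments Term {q s}.
Arguments Top {q}.
Arguments Lhs {q}.
Arguments Cat {q}.

Inductive term (q s : nat) (V : Type) : Type :=
  | Var of V
  | Leaf of nsym q s
  | Node of bsym q & term q s V & term q s V.

Arguments Var {q s V}.
Arguments Leaf {q s V}.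
Arguments Node {q s V}.

Definition tree (q s : nat) : Type := term q s void.

Fixpoint lift q s V (t : tree q s) : term q s V :=
  match t with
  | Var v => of_void _ v
  | Leaf a => Leaf a
  | Node f l r => Node f (lift V l) (lift V r)
  end.

Fixpoint term_size q s V (t : term q s V) : nat :=
  if t is Node _ l r then (term_size l + term_size r).+1 else 1.

Fixpoint decode_rhs q s (t : tree q s) : option (seq (symb q s)) :=
  match t with
  | Leaf (Rhs A) => Some [:: inl A]
  | Leaf (Term a) => Some [:: inr a]
  | Node Cat l r =>
      if (decode_rhs l, decode_rhs r) is (Some u, Some v) then Some (u ++ v)
      else None
  | _ => None
  end.

Fixpoint decode_spine q s (t : tree q s) : option (cfg q s) :=
  match t with
  | Leaf End => Some [::]
  | Node (Lhs A) l r =>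
      if (decode_rhs l, decode_spine r) is (Some alpha, Some G)
      then Some ((A, alpha) :: G) else None
  | _ => None
  end.

(** [None] if the tree is not a syntax tree. *)
Definition decode q s (S : 'I_q) (t : tree q s) : option (cfg q s) :=
  if t is Node Top l r then
    if (decode_rhs l, decode_spine r) is (Some alpha, Some G)
    then Some ((S, alpha) :: G) else None
  else None.

Record rtg (q s : nat) : Type := Rtg {
  rtg_nt : nat;
  rtg_start : 'I_rtg_nt;
  rtg_rules : seq ('I_rtg_nt * term q s 'I_rtg_nt)
}.

Inductive rtg_step q s (MG : rtg q s) :
    term q s 'I_(rtg_nt MG) -> term q s 'I_(rtg_nt MG) -> Prop :=
  | StepRoot X u : List.In (X, u) (rtg_rules MG) -> rtg_step (Var X) u
  | StepLeft f l l' r : rtg_step l l' -> rtg_step (Node f l r) (Node f l' r)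
  | StepRight f l r r' : rtg_step r r' -> rtg_step (Node f l r) (Node f l r').

Definition rtg_lang q s (MG : rtg q s) (t : tree q s) : Prop :=
  clos_refl_trans _ (@rtg_step q s MG) (Var (rtg_start MG)) (lift _ t).

Definition rtg_size q s (MG : rtg q s) : nat :=
  rtg_nt MG + sumn [seq (term_size r.2).+1 | r <- rtg_rules MG].

Definition separates q s (S : 'I_q) (P N : seq (seq 'I_s)) (G : cfg q s) : Prop :=
  (forall w, w \in P -> cfg_lang S G w) /\
  (forall w, w \in N -> ~ cfg_lang S G w).

Definition solution q s (S : 'I_q) (P N : seq (seq 'I_s)) (MG : rtg q s)
    (t : tree q s) : Prop :=
  rtg_lang MG t /\ exists2 G, decode S t = Some G & separates S P N G.

Definition max_length s (P N : seq (seq 'I_s)) : nat :=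
  \max_(w <- P ++ N) size w.

(** The model of computation is the uniform-cost RAM with addition and
    truncated subtraction (no multiplication, division or bitwise operations),
    presented through structured programs over directly addressed registers and
    an indirectly addressed memory.  A guard holds when its value is nonzero. *)

Inductive expr : Type :=
  | Const of nat
  | Reg of nat
  | Fetch of expr
  | Plus of expr & expr
  | Minus of expr & expr.

Inductive cmd : Type :=
  | Skip
  | Assign of nat & expr
  | Store of expr & expr
  | Seq of cmd & cmd
  | If of expr & cmd & cmd
  | While of expr & cmd.

Record state : Type := State { regs : nat -> nat; mem : nat -> nat }.

Definition update (f : nat -> nat) (i v : nat) : nat -> nat :=
  fun j => if j == i then v else f j.

Fixpoint eval (st : state) (e : expr) : nat :=
  match e with
  | Const n => n
  | Reg x => regs st x
  | Fetch a => mem st (eval st a)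
  | Plus a b => eval st a + eval st b
  | Minus a b => eval st a - eval st b
  end.

Fixpoint cost (e : expr) : nat :=
  match e with
  | Const _ | Reg _ => 1
  | Fetch a => (cost a).+1
  | Plus a b | Minus a b => (cost a + cost b).+1
  end.

(** [exec c st t st']: started in [st], the program [c] halts in [st'] after
    exactly [t] steps. *)
Inductive exec : cmd -> state -> nat -> state -> Prop :=
  | ExecSkip st : exec Skip st 1 st
  | ExecAssign x e st :
      exec (Assign x e) st (cost e).+1
        (State (update (regs st) x (eval st e)) (mem st))
  | ExecStore a e st :
      exec (Store a e) st (cost a + cost e).+1
        (State (regs st) (update (mem st) (eval st a) (eval st e)))
  | ExecSeq c1 c2 st1 t1 st2 t2 st3 :
      exec c1 st1 t1 st2 -> exec c2 st2 t2 st3 ->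
      exec (Seq c1 c2) st1 (t1 + t2) st3
  | ExecIfTrue e c1 c2 st t st' :
      eval st e != 0 -> exec c1 st t st' ->
      exec (If e c1 c2) st (cost e + t).+1 st'
  | ExecIfFalse e c1 c2 st t st' :
      eval st e = 0 -> exec c2 st t st' ->
      exec (If e c1 c2) st (cost e + t).+1 st'
  | ExecWhileFalse e c st :
      eval st e = 0 -> exec (While e c) st (cost e).+1 st
  | ExecWhileTrue e c st1 t1 st2 t2 st3 :
      eval st1 e != 0 -> exec c st1 t1 st2 -> exec (While e c) st2 t2 st3 ->
      exec (While e c) st1 (cost e + t1 + t2).+1 st3.

Definition nsym_code q s (a : nsym q s) : nat * nat :=
  match a with
  | End => (1, 0)
  | Rhs A => (2, val A)
  | Term b => (3, val b)
  end.

Definition bsym_code q (f : bsym q) : nat * nat :=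
  match f with
  | Top => (4, 0)
  | Lhs A => (5, val A)
  | Cat => (6, 0)
  end.

(** Prefix notation, two cells per symbol. *)
Fixpoint term_code q s g (t : term q s 'I_g) : seq nat :=
  match t with
  | Var X => [:: 0; val X]
  | Leaf a => [:: (nsym_code a).1; (nsym_code a).2]
  | Node f l r =>
      [:: (bsym_code f).1, (bsym_code f).2 & term_code l ++ term_code r]
  end.

Definition word_code s (w : seq 'I_s) : seq nat :=
  size w :: [seq val a | a <- w].

Definition words_code s (W : seq (seq 'I_s)) : seq nat :=
  size W :: flatten [seq word_code w | w <- W].

Definition rtg_code q s (MG : rtg q s) : seq nat :=
  [:: rtg_nt MG, val (rtg_start MG), size (rtg_rules MG)
    & flatten [seq val r.1 :: term_code r.2 | r <- rtg_rules MG]].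

Definition instance_code q s (S : 'I_q) (P N : seq (seq 'I_s)) (MG : rtg q s) :
    seq nat :=
  [:: q, s, val S & words_code P ++ words_code N ++ rtg_code MG].

Definition initial_state (input : seq nat) : state :=
  State (fun _ => 0) (nth 0 input).

(** [stored M a t]: the memory [M] holds at address [a] a linked
    representation of the tree [t].  Subtrees may be shared: the smallest tree
    of a regular tree language can be exponentially larger than the grammar,
    so it cannot be written out symbol by symbol within the time bound. *)
Fixpoint stored q s (M : nat -> nat) (a : nat) (t : tree q s) : Prop :=
  match t with
  | Var _ => False
  | Leaf b => (M a, M a.+1) = nsym_code b
  | Node f l r =>
      [/\ (M a, M a.+1) = bsym_code f, stored M (M a.+2) l
        & stored M (M a.+3) r]
  end.

(** Register 0 contains 0 to declare that there is no solution, and otherwise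
    the address of a solution. *)
Definition correct_output q s (S : 'I_q) (P N : seq (seq 'I_s)) (MG : rtg q s)
    (st : state) : Prop :=
  if regs st 0 == 0 then forall t, ~ solution S P N MG t
  else exists2 t, stored (mem st) (regs st 0) t & solution S P N MG t.

(* Main.v *)
(* For a productive grammar G and a word u, the table T of the spans of u derived
   by the nonterminals is the unique solution of the one-step equation T =
   refine G T, because a right-hand side containing a terminal splits a span into
   strictly smaller ones.  So one may guess T for all words of P and N at once and
   check it while reading the syntax tree of G bottom-up: relative to T, a subtree
   only contributes the set of spans it matches.  A state of this tree automaton
   is a pair (set, T) coded by O(k) bits when k > 0, so that there are D =
   2^O(k) of them.

   The product of this automaton with the meta-grammar is saturated by a worklist
   of facts (position of the meta-grammar, state).  Each of them is derived once,
   with a heap record pointing to the records of its premises; these records are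
   the linked representation of a witness tree.  Chaining the occurrences of each
   nonterminal of the meta-grammar lets a fact move along one occurrence at a
   time, so that handling a fact costs poly(D) whatever the meta-grammar, and the
   running time is linear in its size.

   The program is written in a small language of expressions and bounded loops
   whose numbers of iterations are capped by a register; up to that cap B, the
   running time of a fragment is then a polynomial in B read off its syntax. *)
From Stdlib Require Import Relation_Operators Operators_Properties.
From mathcomp Require Import all_boot all_algebra zify.
Require Import Defs.

Set Implicit Arguments.
Unset Strict Implicit.
Unset Printing Implicit Defensive.

(** * Programs with syntactic time bounds *)

(** The exponent may depend on [k] alone, and [k = 0] as soon as [n = 0], however many nonterminals
    there are. A state with one table entry per nonterminal would then be too large. But a
    productive grammar derives no empty word, so for [n = 0] separation just says that [P] is empty;
    the program sets [Q = 0] and is left with a single state. The absence of repetitions in [P] and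
    [N] bounds [m] in that case.

    The machine has no multiplication, division or shift, so all arithmetic on states and addresses
    consists of loops. To keep the time linear in the meta-grammar, none of these may run over a
    quantity that grows with it: they are capped by a number depending only on the words and on [q],
    and a product with the row length [V] loops over the row number instead. Only the four outermost
    loops (scanning, linking, leaves, worklist) are uncapped. *)

Definition run c st T (Q : state -> Prop) : Prop :=
  exists t st', [/\ exec c st t st', t <= T & Q st'].

Lemma run_weaken c st T T' (Q Q' : state -> Prop) :
  run c st T Q -> T <= T' -> (forall st', Q st' -> Q' st') -> run c st T' Q'.
Proof.
move=> [t [st' [ex le_tT Qst']]] le_TT' sQ; exists t, st'.
by split=> //; [apply: leq_trans le_TT' | apply: sQ].
Qed.

Lemma run_assign x e st T (Q : state -> Prop) :
  Q (State (update (regs st) x (eval st e)) (mem st)) -> (cost e).+1 <= T ->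
  run (Assign x e) st T Q.
Proof. by move=> Qst le_T; do 2!eexists; split; [exact: ExecAssign | | ]. Qed.

Lemma run_store a e st T (Q : state -> Prop) :
  Q (State (regs st) (update (mem st) (eval st a) (eval st e))) ->
  (cost a + cost e).+1 <= T -> run (Store a e) st T Q.
Proof. by move=> Qst le_T; do 2!eexists; split; [exact: ExecStore | | ]. Qed.

Lemma run_seq c1 c2 st T1 T2 T (Q1 Q : state -> Prop) :
  run c1 st T1 Q1 -> (forall st1, Q1 st1 -> run c2 st1 T2 Q) -> T1 + T2 <= T ->
  run (Seq c1 c2) st T Q.
Proof.
move=> [t1 [st1 [ex1 le1 Q1st]]] run2 le_T.
have [t2 [st2 [ex2 le2 Qst]]] := run2 _ Q1st.
exists (t1 + t2), st2; split=> //; first exact: ExecSeq ex1 ex2.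
by apply: leq_trans le_T; apply: leq_add.
Qed.

Lemma run_if e c1 c2 st T1 T2 T (Q : state -> Prop) :
  (eval st e != 0 -> run c1 st T1 Q) -> (eval st e = 0 -> run c2 st T2 Q) ->
  (cost e + (T1 + T2)).+1 <= T -> run (If e c1 c2) st T Q.
Proof.
move=> run1 run2 le_T; have [e0|e0] := eqVneq (eval st e) 0.
  have [t [st' [ex le_t Qst]]] := run2 e0.
  exists (cost e + t).+1, st'; split=> //; first exact: ExecIfFalse.
  by lia.
have [t [st' [ex le_t Qst]]] := run1 e0.
exists (cost e + t).+1, st'; split=> //; first exact: ExecIfTrue.
by lia.
Qed.

(** The variant is an index of the invariant rather than a function of the state: later it measures
    ghost data, such as the number of facts already processed, over which the invariants quantify
    existentially. *)
Lemma run_while_rel (I : nat -> state -> Prop) e c k n T Tb st (Q : state -> Prop) :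
  I k st -> k <= n ->
  (forall k s, I k s -> eval s e != 0 ->
     run c s Tb (fun s' => exists2 k', k' < k & I k' s')) ->
  (forall k s, I k s -> eval s e = 0 -> Q s) ->
  n * (Tb + cost e).+1 + (cost e).+1 <= T -> run (While e c) st T Q.
Proof.
move=> Ist le_kn step stop.
elim: n k st le_kn Ist T => [|n IHn] k st le_kn Ist T le_T.
  have [e0|e0] := eqVneq (eval st e) 0.
    exists (cost e).+1, st; split; [exact: ExecWhileFalse| |exact: stop Ist e0].
    by move: le_T; rewrite mul0n.
  by have [t [st' [_ _ [k' lt_k' _]]]] := step _ _ Ist e0; lia.
have [e0|e0] := eqVneq (eval st e) 0.
  exists (cost e).+1, st; split; [exact: ExecWhileFalse| |exact: stop Ist e0].
  by apply: leq_trans le_T; apply: leq_addl.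
have [t1 [st1 [ex1 le1 [k' lt_k' Ist1]]]] := step _ _ Ist e0.
have [|t2 [st2 [ex2 le2 Qst2]]] := IHn k' st1 _ Ist1 _ (leqnn _); first by lia.
exists (cost e + t1 + t2).+1, st2; split=> //; first exact: ExecWhileTrue ex1 ex2.
by move: le_T le2; rewrite mulSn; lia.
Qed.

Lemma run_while (I : state -> Prop) (mu : state -> nat) e c n T Tb st
    (Q : state -> Prop) :
  I st -> mu st <= n ->
  (forall s, I s -> eval s e != 0 ->
     run c s Tb (fun s' => I s' /\ mu s' < mu s)) ->
  (forall s, I s -> eval s e = 0 -> Q s) ->
  n * (Tb + cost e).+1 + (cost e).+1 <= T -> run (While e c) st T Q.
Proof.
move=> Ist mu_n step stop.
apply: (@run_while_rel (fun k s => I s /\ k = mu s) _ _ (mu st)) => //.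
- move=> _ s [Is ->] /(step s Is) /run_weaken; apply=> // s' [Is' lt_mu].
  by exists (mu s').
- by move=> _ s [Is _]; apply: stop.
Qed.

(* Registers below [nglob] are program variables, the others are scratch;
   register 1 holds the cap on the number of iterations of the bounded loops,
   so that running times are bounded by the syntax alone. *)
Definition nglob := 40.

(* De Bruijn expressions: [EFold n e0 b] iterates [b] (binding accumulator 0 and
   index 1); [EArg a1 (.. (EArg ak (ECall b)))] evaluates [b] in the environment
   [ak; ..; a1]. *)
Inductive pexp : Type :=
  | ENum of nat
  | EReg of nat
  | EVar of nat
  | EFetch of pexp
  | EAdd of pexp & pexp
  | ESub of pexp & pexp
  | EIf of pexp & pexp & pexp
  | EFold of pexp & pexp & pexp
  | EArg of pexp & pexp
  | ECall of pexp.

(** An [EReg] outside the program variables reads as 0, so that values cannot depend on the scratch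
    registers of the compiled code. Folds are cut off at the cap [g 1], which lets [pbound] ignore
    the values of their counts. *)
Fixpoint peval (g M : nat -> nat) (env args : seq nat) (e : pexp) : nat :=
  match e with
  | ENum n => n
  | EReg x => if x < nglob then g x else 0
  | EVar i => nth 0 env i
  | EFetch a => M (peval g M env [::] a)
  | EAdd a b => peval g M env [::] a + peval g M env [::] b
  | ESub a b => peval g M env [::] a - peval g M env [::] b
  | EIf c a b =>
      if peval g M env [::] c != 0 then peval g M env [::] a
      else peval g M env [::] b
  | EFold n e0 b =>
      iteri (minn (peval g M env [::] n) (g 1))
        (fun i acc => peval g M [:: acc, i & env] [::] b)
        (peval g M env [::] e0)
  | EArg a k => peval g M env (peval g M env [::] a :: args) k
  | ECall b => peval g M args [::] b
  end.

Definition agree (n : nat) (f g : nat -> nat) := forall x, x < n -> f x = g x.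

Lemma eq_iteri T n (f g : nat -> T -> T) x :
  (forall i y, f i y = g i y) -> iteri n f x = iteri n g x.
Proof. by move=> fg; elim: n => //= n ->. Qed.

Lemma peval_agree g g' M env args e :
  agree nglob g g' -> peval g M env args e = peval g' M env args e.
Proof.
move=> gg'; elim: e env args => //=.
- by move=> x _ _; case: ifP => // /gg'.
- by move=> a IHa env _; rewrite IHa.
- by move=> a IHa b IHb env _; rewrite IHa IHb.
- by move=> a IHa b IHb env _; rewrite IHa IHb.
- by move=> c IHc a IHa b IHb env _; rewrite IHc IHa IHb.
- move=> n IHn e0 IH0 b IHb env _; rewrite IHn IH0 gg' //.
  by apply: eq_iteri => i y.
- by move=> a IHa k IHk env args; rewrite IHa IHk.
Qed.

Definition sel (rho : seq nat) (i : nat) : expr :=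
  nth (Const 0) (map Reg rho) i.

(** Registers are allocated at compile time: [rho] and [phi] list those holding the environment and
    the arguments, and [fr], the first free one, receives the result. In a fold, truncated
    subtraction makes [a - (a - b)] the minimum of [a] and [b]. *)
Fixpoint pcomp (rho phi : seq nat) (fr : nat) (e : pexp) : cmd :=
  match e with
  | ENum n => Assign fr (Const n)
  | EReg x => Assign fr (if x < nglob then Reg x else Const 0)
  | EVar i => Assign fr (sel rho i)
  | EFetch a => Seq (pcomp rho [::] fr a) (Assign fr (Fetch (Reg fr)))
  | EAdd a b =>
      Seq (pcomp rho [::] fr a)
        (Seq (pcomp rho [::] fr.+1 b) (Assign fr (Plus (Reg fr) (Reg fr.+1))))
  | ESub a b =>
      Seq (pcomp rho [::] fr a)
        (Seq (pcomp rho [::] fr.+1 b) (Assign fr (Minus (Reg fr) (Reg fr.+1))))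
  | EIf c a b =>
      Seq (pcomp rho [::] fr c)
        (If (Reg fr) (pcomp rho [::] fr a) (pcomp rho [::] fr b))
  | EFold n e0 b =>
      Seq (pcomp rho [::] fr n)
        (Seq (Assign fr (Minus (Reg fr) (Minus (Reg fr) (Reg 1))))
          (Seq (pcomp rho [::] fr.+2 e0)
            (Seq (Assign fr.+1 (Const 0))
              (Seq
                (While (Minus (Reg fr) (Reg fr.+1))
                  (Seq (pcomp [:: fr.+2, fr.+1 & rho] [::] fr.+3 b)
                    (Seq (Assign fr.+2 (Reg fr.+3))
                      (Assign fr.+1 (Plus (Reg fr.+1) (Const 1))))))
                (Assign fr (Reg fr.+2))))))
  | EArg a k =>
      Seq (pcomp rho [::] fr a)
        (Seq (pcomp rho (fr :: phi) fr.+1 k) (Assign fr (Reg fr.+1)))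
  | ECall b => pcomp phi [::] fr b
  end.

Fixpoint pbound (B : nat) (e : pexp) : nat :=
  match e with
  | ENum _ | EReg _ | EVar _ => 2
  | EFetch a => pbound B a + 3
  | EAdd a b | ESub a b => pbound B a + pbound B b + 4
  | EIf c a b => pbound B c + pbound B a + pbound B b + 2
  | EFold n e0 b => pbound B n + pbound B e0 + B * (pbound B b + 10) + 20
  | EArg a k => pbound B a + pbound B k + 2
  | ECall b => pbound B b
  end.

Definition holds (st : state) (fr : nat) (rho env : seq nat) : Prop :=
  all (ltn^~ fr) rho /\ map (regs st) rho = env.

Lemma holds_agree st st' fr rho env :
  holds st fr rho env -> agree fr (regs st') (regs st) -> holds st' fr rho env.
Proof.
move=> [lt_rho <-] ag; split=> //; apply/eq_in_map => x x_rho.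
by apply: ag; apply: (allP lt_rho).
Qed.

Lemma holds_widen st fr fr' rho env :
  holds st fr rho env -> fr <= fr' -> holds st fr' rho env.
Proof.
move=> [lt_rho e] le_fr; split=> //; apply/allP => x /(allP lt_rho) /= lt_x.
exact: leq_trans lt_x le_fr.
Qed.

Lemma holds_cons st fr x rho env :
  holds st fr rho env -> x < fr -> holds st fr (x :: rho) (regs st x :: env).
Proof. by move=> [lt_rho <-] lt_x; split=> //=; rewrite lt_x. Qed.

Lemma eval_sel st fr rho env i :
  holds st fr rho env -> eval st (sel rho i) = nth 0 env i.
Proof.
move=> [_ <-]; rewrite /sel; have [lt_i|le_i] := ltnP i (size rho).
  by rewrite !(nth_map 0).
by rewrite !nth_default ?size_map.
Qed.

Lemma cost_sel rho i : cost (sel rho i) = 1.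
Proof.
rewrite /sel; have [lt_i|le_i] := ltnP i (size rho).
  by rewrite (nth_map 0).
by rewrite nth_default ?size_map.
Qed.

Definition evals_to st fr v (st' : state) : Prop :=
  [/\ regs st' fr = v, agree fr (regs st') (regs st) & mem st' = mem st].

Lemma updateE f i v : update f i v i = v.
Proof. by rewrite /update eqxx. Qed.

Lemma updateN f i v j : j != i -> update f i v j = f j.
Proof. by rewrite /update => /negbTE ->. Qed.

Lemma agree_update n f i v : n <= i -> agree n (update f i v) f.
Proof. by move=> le_ni x lt_x; rewrite updateN //; lia. Qed.

Lemma agree_trans n f g h : agree n f g -> agree n g h -> agree n f h.
Proof. by move=> fg gh x lt_x; rewrite fg ?gh. Qed.

Lemma agree_le n n' f g : agree n f g -> n' <= n -> agree n' f g.
Proof. by move=> fg le_n x lt_x; apply: fg; apply: leq_trans le_n. Qed.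

Lemma peval_evals st fr v st' env args e : nglob <= fr -> evals_to st fr v st' ->
  peval (regs st') (mem st') env args e = peval (regs st) (mem st) env args e.
Proof.
by move=> le_fr [_ ag ->]; apply: peval_agree; apply: agree_le ag _.
Qed.

(** The code writes to no register below [fr] and to no memory cell. Operands parked from [fr] on
    thus survive the evaluation of the next ones, which starts at a higher register, and program
    variables survive because [nglob <= fr]. *)
Lemma run_pcomp e rho phi fr env args st :
  holds st fr rho env -> holds st fr phi args -> nglob <= fr ->
  run (pcomp rho phi fr e) st (pbound (regs st 1) e)
    (evals_to st fr (peval (regs st) (mem st) env args e)).
Proof.
elim: e rho phi fr env args st => /=.
- move=> n rho phi fr env args st _ _ le_fr; apply: run_assign => //.
  by split; rewrite /= ?updateE //; apply: agree_update.
- move=> x rho phi fr env args st _ _ le_fr; apply: run_assign.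
    by split=> //=; [rewrite updateE; case: ifP | apply: agree_update].
  by case: ifP.
- move=> i rho phi fr env args st hr _ le_fr; apply: run_assign.
    by split; rewrite /= ?updateE ?(eval_sel _ hr) //; apply: agree_update.
  by rewrite cost_sel.
- move=> a IHa rho phi fr env args st hr hp le_fr.
  apply: (run_seq (T2 := 3) (IHa rho [::] fr env [::] st hr _ le_fr)) => //.
  move=> st1 [v1 ag1 m1]; apply: run_assign => //.
  split; rewrite /= ?updateE ?v1 ?m1 //.
  by apply: agree_trans ag1; apply: agree_update.
- move=> a IHa b IHb rho phi fr env args st hr hp le_fr.
  apply: (run_seq (T2 := pbound (regs st 1) b + 4)
            (IHa rho [::] fr env [::] st hr _ le_fr)) => //; last by lia.
  move=> st1 ev1; have [v1 ag1 m1] := ev1.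
  have hr1 : holds st1 fr.+1 rho env.
    by apply: (holds_widen (fr := fr)); [apply: holds_agree hr _ | ].
  have r1 : regs st1 1 = regs st 1 by apply: ag1; apply: leq_trans le_fr.
  apply: (run_seq (T2 := 4) (IHb rho [::] fr.+1 env [::] st1 hr1 _ _)) => //.
  - exact: leqW.
  - rewrite (peval_evals _ _ _ le_fr ev1) => st2 [v2 ag2 m2].
    apply: run_assign => //=.
    split; rewrite /= ?updateE ?v2 ?ag2 ?v1 ?m2 //.
    apply: agree_trans (agree_update _ _ _) _ => //.
    by apply: agree_trans ag1; apply: agree_le ag2 _.
  - by rewrite r1.
- move=> a IHa b IHb rho phi fr env args st hr hp le_fr.
  apply: (run_seq (T2 := pbound (regs st 1) b + 4)
            (IHa rho [::] fr env [::] st hr _ le_fr)) => //; last by lia.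
  move=> st1 ev1; have [v1 ag1 m1] := ev1.
  have hr1 : holds st1 fr.+1 rho env.
    by apply: (holds_widen (fr := fr)); [apply: holds_agree hr _ | ].
  have r1 : regs st1 1 = regs st 1 by apply: ag1; apply: leq_trans le_fr.
  apply: (run_seq (T2 := 4) (IHb rho [::] fr.+1 env [::] st1 hr1 _ _)) => //.
  - exact: leqW.
  - rewrite (peval_evals _ _ _ le_fr ev1) => st2 [v2 ag2 m2].
    apply: run_assign => //=.
    split; rewrite /= ?updateE ?v2 ?ag2 ?v1 ?m2 //.
    apply: agree_trans (agree_update _ _ _) _ => //.
    by apply: agree_trans ag1; apply: agree_le ag2 _.
  - by rewrite r1.
- move=> c IHc a IHa b IHb rho phi fr env args st hr hp le_fr.
  apply: (run_seq (T2 := pbound (regs st 1) a + pbound (regs st 1) b + 2)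
            (IHc rho [::] fr env [::] st hr _ le_fr)) => //; last by lia.
  move=> st1 ev1; have [v1 ag1 m1] := ev1.
  have hr1 : holds st1 fr rho env by apply: holds_agree hr _.
  have r1 : regs st1 1 = regs st 1 by apply: ag1; apply: leq_trans le_fr.
  have wk st' v : evals_to st1 fr v st' -> evals_to st fr v st'.
    by case=> ? ag2 m2; split; rewrite ?m2 //; apply: agree_trans ag2 ag1.
  apply: (@run_if _ _ _ _ (pbound (regs st 1) a) (pbound (regs st 1) b)).
  - rewrite /= v1 => ->; apply: (run_weaken (IHa rho [::] fr env [::] st1 hr1 _ _)).
    + by [].
    + by [].
    + by rewrite r1.
    + by move=> st2 /wk; rewrite (peval_evals _ _ _ le_fr ev1).
  - rewrite /= v1 => ->; apply: (run_weaken (IHb rho [::] fr env [::] st1 hr1 _ _)).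
    + by [].
    + by [].
    + by rewrite r1.
    + by move=> st2 /wk; rewrite (peval_evals _ _ _ le_fr ev1).
  - by rewrite /=; lia.
- move=> n IHn e0 IH0 b IHb rho phi fr env args st hr hp le_fr.
  set B := regs st 1.
  apply: (run_seq (T2 := pbound B e0 + B * (pbound B b + 10) + 20)
            (IHn rho [::] fr env [::] st hr _ le_fr)) => //; last by rewrite -/B; lia.
  move=> st1 ev1; have [v1 ag1 m1] := ev1.
  have lt1fr : 1 < fr by apply: leq_trans le_fr.
  have r1 : regs st1 1 = B by apply: ag1.
  set cnt := minn (peval (regs st) (mem st) env [::] n) B.
  apply: (run_seq (T1 := 6) (T2 := pbound B e0 + B * (pbound B b + 10) + 14)
            (Q1 := evals_to st fr cnt)).
  - apply: run_assign => //.
    split; rewrite /= ?updateE ?v1 ?r1 ?m1 //; first by rewrite /cnt; lia.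
    by apply: agree_trans ag1; apply: agree_update.
  - move=> {v1 ag1 m1 r1 ev1}st1 ev1; have [v1 ag1 m1] := ev1.
    have r1 : regs st1 1 = B by apply: ag1.
    have hr1 : holds st1 fr rho env by apply: holds_agree hr _.
    have hr12 : holds st1 fr.+2 rho env by apply: holds_widen hr1 _; lia.
    apply: (run_seq (T2 := B * (pbound B b + 10) + 14)
              (IH0 rho [::] fr.+2 env [::] st1 hr12 _ _)) => //; last by rewrite r1; lia.
    - by lia.
    rewrite (peval_evals _ _ _ le_fr ev1) => st2 [v2 ag2 m2].
    pose F i acc := peval (regs st) (mem st) [:: acc, i & env] [::] b.
    set a0 := peval _ _ _ _ _ in v2.
    pose I (s : state) := [/\ regs s fr = cnt, agree fr (regs s) (regs st),
      mem s = mem st, regs s fr.+1 <= cnt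
      & regs s fr.+2 = iteri (regs s fr.+1) F a0].
    apply: (run_seq (T1 := 2) (T2 := B * (pbound B b + 10) + 12)
       (Q1 := fun s => I s /\ regs s fr.+1 = 0)); last by lia.
      apply: run_assign => //; split; last by rewrite /= updateE.
      split; rewrite /= ?updateE //.
      + by rewrite updateN ?ag2 //; lia.
      + apply: agree_trans (agree_update _ _ _) _; first by lia.
        by apply: agree_trans ag1; apply: agree_le ag2 _; lia.
      + by rewrite m2 m1.
      + by rewrite /= updateN ?v2 //; lia.
    move=> st3 [I3 i0].
    apply: (run_seq (T1 := B * (pbound B b + 10) + 4) (T2 := 2)
       (Q1 := fun s => I s /\ cnt <= regs s fr.+1)); last by lia.
      apply: (@run_while I (fun s => cnt - regs s fr.+1) _ _ B _ (pbound B b + 6)).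
      - by [].
      - by rewrite i0 subn0 geq_minr.
      - move=> s [sv sag sm si sa] /=; rewrite sv subn_eq0 -ltnNge => lt_i.
        have hs : holds s fr.+3 [:: fr.+2, fr.+1 & rho]
                    [:: regs s fr.+2, regs s fr.+1 & env].
          apply: holds_cons; last by lia.
          apply: holds_cons; last by lia.
          apply: (holds_widen (fr := fr)); last by lia.
          exact: holds_agree hr _.
        have rs : regs s 1 = B by apply: sag.
        apply: (run_seq (T2 := 6) (IHb _ [::] fr.+3 _ [::] s hs _ _)) => //.
        + by lia.
        + rewrite (@peval_agree _ (regs st)); last exact: agree_le sag _.
          rewrite sm -/(F _ _) => s1 [w1 ag3 m3].
          apply: (run_seq (T1 := 2) (T2 := 4) (Q1 := fun s2 =>
             [/\ agree fr.+2 (regs s2) (regs s), mem s2 = mem st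
               & regs s2 fr.+2 = F (regs s fr.+1) (regs s fr.+2)])) => //.
            apply: run_assign => //=; split; rewrite ?updateE ?m3 ?w1 //.
            apply: agree_trans (agree_update _ _ _) _; first by lia.
            by apply: agree_le ag3 _.
          move=> s2 [ag4 m4 v4]; apply: run_assign => //=.
          rewrite updateE ag4 //; split; last by lia.
          split; rewrite /= ?updateE.
          * by rewrite updateN ?ag4 //; lia.
          * apply: agree_trans (agree_update _ _ _) _; first by lia.
            by apply: agree_trans sag; apply: agree_le ag4 _; lia.
          * by [].
          * by lia.
          * by rewrite addn1 updateN ?v4 ?sa //=; lia.
        + by rewrite rs.
      - move=> s Is /=; have [sv _ _ _ _] := Is; rewrite sv => c0.
        by split=> //; lia.
      - by rewrite /=; lia.
    move=> s [[sv sag sm si sa] le_c]; apply: run_assign => //.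
    have ci : regs s fr.+1 = cnt by lia.
    split; rewrite /= ?updateE ?sm //; first by rewrite sa ci.
    by apply: agree_trans sag; apply: agree_update.
  - by lia.
- move=> a IHa k IHk rho phi fr env args st hr hp le_fr.
  apply: (run_seq (T2 := pbound (regs st 1) k + 2)
            (IHa rho [::] fr env [::] st hr _ le_fr)) => //; last by lia.
  move=> st1 ev1; have [v1 ag1 m1] := ev1.
  have hr1 : holds st1 fr.+1 rho env.
    by apply: (holds_widen (fr := fr)); [apply: holds_agree hr _ | ].
  have hp1 : holds st1 fr.+1 (fr :: phi)
               (peval (regs st) (mem st) env [::] a :: args).
    rewrite -v1; apply: holds_cons => //.
    by apply: (holds_widen (fr := fr)); [apply: holds_agree hp _ | ].
  have r1 : regs st1 1 = regs st 1 by apply: ag1; apply: leq_trans le_fr.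
  apply: (run_seq (T2 := 2) (IHk _ _ fr.+1 _ _ st1 hr1 hp1 _)) => //.
  + exact: leqW.
  + rewrite (peval_evals _ _ _ le_fr ev1) => st2 [v2 ag2 m2].
    apply: run_assign => //=.
    split; rewrite /= ?updateE ?v2 ?m2 //.
    apply: agree_trans (agree_update _ _ _) _ => //.
    by apply: agree_trans ag1; apply: agree_le ag2 _.
  + by rewrite r1.
- move=> b IHb rho phi fr env args st hr hp le_fr.
  exact: IHb.
Qed.

(** * Commands with bounded loops *)

Inductive pcmd : Type :=
  | PSkip
  | PAssign of nat & pexp
  | PStore of pexp & pexp
  | PSeq of pcmd & pcmd
  | PIf of pexp & pcmd & pcmd
  | PFor of nat & pexp & pcmd.

Definition peval0 (s : state) (e : pexp) : nat :=
  peval (regs s) (mem s) [::] [::] e.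

Definition setreg (s : state) x v := State (update (regs s) x v) (mem s).

(** [PFor] reads its bound once, before the first round, and its true counter lives in a scratch
    register; [x] only receives a copy, which the body may overwrite. *)
Fixpoint pden (c : pcmd) (s : state) : state :=
  match c with
  | PSkip => s
  | PAssign x e => setreg s x (peval0 s e)
  | PStore a e => State (regs s) (update (mem s) (peval0 s a) (peval0 s e))
  | PSeq c1 c2 => pden c2 (pden c1 s)
  | PIf e c1 c2 => if peval0 s e != 0 then pden c1 s else pden c2 s
  | PFor x e c =>
      iteri (minn (peval0 s e) (regs s 1)) (fun i s' => pden c (setreg s' x i)) s
  end.

Fixpoint passigned (c : pcmd) : seq nat :=
  match c with
  | PSkip | PStore _ _ => [::]
  | PAssign x _ => [:: x]
  | PSeq c1 c2 | PIf _ c1 c2 => passigned c1 ++ passigned c2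
  | PFor x _ c => x :: passigned c
  end.

Fixpoint pcompile (fr : nat) (c : pcmd) : cmd :=
  match c with
  | PSkip => Skip
  | PAssign x e => Seq (pcomp [::] [::] fr e) (Assign x (Reg fr))
  | PStore a e =>
      Seq (pcomp [::] [::] fr a)
        (Seq (pcomp [::] [::] fr.+1 e) (Store (Reg fr) (Reg fr.+1)))
  | PSeq c1 c2 => Seq (pcompile fr c1) (pcompile fr c2)
  | PIf e c1 c2 =>
      Seq (pcomp [::] [::] fr e) (If (Reg fr) (pcompile fr c1) (pcompile fr c2))
  | PFor x e c =>
      Seq (pcomp [::] [::] fr e)
        (Seq (Assign fr (Minus (Reg fr) (Minus (Reg fr) (Reg 1))))
          (Seq (Assign fr.+1 (Const 0))
            (While (Minus (Reg fr) (Reg fr.+1))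
              (Seq (Assign x (Reg fr.+1))
                (Seq (Assign fr.+1 (Plus (Reg fr.+1) (Const 1)))
                  (pcompile fr.+2 c))))))
  end.

Fixpoint pcbound (B : nat) (c : pcmd) : nat :=
  match c with
  | PSkip => 1
  | PAssign x e => pbound B e + 2
  | PStore a e => pbound B a + pbound B e + 3
  | PSeq c1 c2 => pcbound B c1 + pcbound B c2
  | PIf e c1 c2 => pbound B e + pcbound B c1 + pcbound B c2 + 2
  | PFor x e c => pbound B e + B * (pcbound B c + 10) + 12
  end.

(** Register 1 is excluded because [pcbound] refers to the initial cap throughout, and scratch
    registers because they hold loop counters. *)
Definition pvalid (c : pcmd) : bool :=
  all (fun x => (x < nglob) && (x != 1)) (passigned c).

Definition simulates (st s : state) : Prop :=
  agree nglob (regs st) (regs s) /\ mem st = mem s.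

(** The scratch registers below [fr] belong to the enclosing loops. *)
Definition keeps (fr : nat) (st st' : state) : Prop :=
  forall x, nglob <= x < fr -> regs st' x = regs st x.

Lemma iteri_invariant T (I : nat -> T -> Prop) n (f : nat -> T -> T) x :
  I 0 x -> (forall i y, i < n -> I i y -> I i.+1 (f i y)) -> I n (iteri n f x).
Proof.
move=> I0 step; elim: n step => //= n IHn step; apply: (step) => //.
by apply: IHn => i y lt_in; apply: step; apply: leqW.
Qed.

Lemma pden_regs c s x : x \notin passigned c -> regs (pden c s) x = regs s x.
Proof.
elim: c s => //=.
- by move=> y e s; rewrite inE => /negbTE nx; rewrite /update nx.
- by move=> c1 IH1 c2 IH2 s; rewrite mem_cat negb_or => /andP[? ?]; rewrite IH2 ?IH1.
- move=> e c1 IH1 c2 IH2 s; rewrite mem_cat negb_or => /andP[? ?].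
  by case: ifP; rewrite ?IH1 ?IH2.
- move=> y e c IHc s; rewrite inE negb_or => /andP[nxy nx].
  apply: (iteri_invariant (I := fun _ s' => regs s' x = regs s x)) => // i s' _ <-.
  by rewrite IHc // /setreg /= /update (negbTE nxy).
Qed.

Lemma pden_cap c s : pvalid c -> regs (pden c s) 1 = regs s 1.
Proof.
move=> v; apply: pden_regs.
by apply: contraTN isT => /(allP v); rewrite eqxx andbF.
Qed.

Lemma run_pcomp0 e fr st s : nglob <= fr -> simulates st s ->
  run (pcomp [::] [::] fr e) st (pbound (regs s 1) e)
    (fun st' => [/\ simulates st' s, keeps fr st st' & regs st' fr = peval0 s e]).
Proof.
move=> le_fr [ag m].
have h0 : holds st fr [::] [::] by [].
have := run_pcomp e h0 h0 le_fr; rewrite ag //.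
move/run_weaken; apply=> // st' [v ag' m']; split.
- by split; [apply: agree_trans ag; apply: agree_le ag' _ | rewrite m'].
- by move=> x /andP[_ lt_x]; apply: ag'.
- by rewrite v /peval0 m; apply: peval_agree.
Qed.

Lemma keeps_trans fr st1 st2 st3 :
  keeps fr st1 st2 -> keeps fr st2 st3 -> keeps fr st1 st3.
Proof. by move=> k12 k23 x lt_x; rewrite k23 ?k12. Qed.

Lemma keeps_le fr fr' st st' : keeps fr st st' -> fr' <= fr -> keeps fr' st st'.
Proof. by move=> k le_fr x lt_x; apply: k; lia. Qed.

Lemma run_pcompile c fr st s : pvalid c -> nglob <= fr -> simulates st s ->
  run (pcompile fr c) st (pcbound (regs s 1) c)
    (fun st' => simulates st' (pden c s) /\ keeps fr st st').
Proof.
rewrite /pvalid; elim: c fr st s => /=.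
- move=> fr st s _ _ sim; exists 1, st; split=> //; exact: ExecSkip.
- move=> x e fr st s /andP[/andP[lt_x _] _] le_fr sim.
  apply: run_seq (run_pcomp0 e le_fr sim) _ (leqnn _) => st1 [[ag m] k v].
  apply: run_assign => //=; split=> /=.
    by split=> //= y lt_y; rewrite v /update; case: eqP => // _; apply: ag.
  by move=> y lt_y; rewrite /= updateN ?k //; lia.
- move=> a e fr st s _ le_fr sim.
  apply: (run_seq (T2 := pbound (regs s 1) e + 3) (run_pcomp0 a le_fr sim)); last by lia.
  move=> st1 [sim1 k1 v1].
  apply: (run_seq (T2 := 3) (run_pcomp0 e (leqW le_fr) sim1)) => //.
  move=> st2 [[ag2 m2] k2 v2].
  apply: run_store => //=; rewrite v2 k2 ?leqnn ?andbT // v1 m2.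
  by split; [| apply: keeps_trans k1 _; apply: keeps_le k2 _].
- move=> c1 IH1 c2 IH2 fr st s; rewrite all_cat => /andP[v1 v2] le_fr sim.
  apply: run_seq (IH1 fr st s v1 le_fr sim) _ (leqnn _) => st1 [sim1 k1].
  have := IH2 fr st1 _ v2 le_fr sim1; rewrite pden_cap //.
  move/run_weaken; apply=> // st2 [sim2 k2]; split=> //.
  exact: keeps_trans k1 k2.
- move=> e c1 IH1 c2 IH2 fr st s; rewrite all_cat => /andP[v1 v2] le_fr sim.
  apply: (run_seq (T2 := pcbound (regs s 1) c1 + pcbound (regs s 1) c2 + 2)
            (run_pcomp0 e le_fr sim)); last by lia.
  move=> st1 [sim1 k1 v].
  apply: (@run_if _ _ _ _ (pcbound (regs s 1) c1) (pcbound (regs s 1) c2)) => /=; rewrite ?v.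
  + move=> ->; apply: (run_weaken (IH1 fr st1 s v1 le_fr sim1)) => // st2 [? k2].
    by split=> //; apply: keeps_trans k1 k2.
  + move=> ->; apply: (run_weaken (IH2 fr st1 s v2 le_fr sim1)) => // st2 [? k2].
    by split=> //; apply: keeps_trans k1 k2.
  + by lia.
- move=> x e c IHc fr st s /andP[/andP[lt_x x_1] vc] le_fr sim.
  have lt_xf : x < fr by apply: leq_trans le_fr.
  set B := regs s 1; have lt1fr : 1 < fr by apply: leq_trans le_fr.
  have agu st' z v : nglob <= z -> simulates st' s ->
      simulates (State (update (regs st') z v) (mem st')) s.
    by move=> le_z [ag m]; split=> //; apply: agree_trans ag; apply: agree_update.
  apply: (run_seq (T2 := B * (pcbound B c + 10) + 12)
            (run_pcomp0 e le_fr sim)); last by rewrite -/B; lia.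
  move=> st1 [sim1 k1 v1]; set cnt := minn _ _.
  apply: (run_seq (T1 := 6) (T2 := B * (pcbound B c + 10) + 6)
    (Q1 := fun s' => [/\ simulates s' s, keeps fr st s' & regs s' fr = cnt])); last by lia.
    apply: run_assign => //=; split; first exact: agu.
      by move=> y lt_y; rewrite /= updateN ?k1 //; lia.
    by rewrite updateE v1 sim1.1 // -/B /cnt; lia.
  move=> {sim1 k1 v1}st1 [sim1 k1 v1].
  pose F i s' := pden c (setreg s' x i).
  pose I (s' : state) := [/\ regs s' fr = cnt, regs s' fr.+1 <= cnt, keeps fr st s'
    & simulates s' (iteri (regs s' fr.+1) F s)].
  have capF i : regs (iteri i F s) 1 = B.
    apply: (iteri_invariant (I := fun _ s' => regs s' 1 = B)) => // j y _ <-.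
    by rewrite /F pden_cap //= updateN // eq_sym.
  apply: (run_seq (T1 := 2) (T2 := B * (pcbound B c + 10) + 4)
    (Q1 := fun s' => I s' /\ regs s' fr.+1 = 0)); last by lia.
    apply: run_assign => //=; rewrite /I /= updateE; split=> //; split=> //=.
    + by rewrite updateN ?v1 //; lia.
    + by move=> y lt_y; rewrite /= updateN ?k1 //; lia.
    + by apply: agu => //; lia.
  move=> st2 [I2 i0].
  apply: (@run_while I (fun s' => cnt - regs s' fr.+1) _ _ B _ (pcbound B c + 6)) => //.
  + by rewrite i0 subn0 geq_minr.
  + move=> s' [sv si ks [ag m]] /=; rewrite sv subn_eq0 -ltnNge => lt_i.
    set i := regs s' fr.+1 in lt_i si ag m *.
    apply: (run_seq (T1 := 2) (T2 := pcbound B c + 4) (Q1 := fun s1 =>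
       [/\ regs s1 fr = cnt, regs s1 fr.+1 = i, keeps fr st s1 &
        simulates s1 (setreg (iteri i F s) x i)])); last by lia.
      apply: run_assign => //=; split; rewrite /= ?updateN //; try by lia.
        by move=> y lt_y; rewrite /= updateN ?ks //; lia.
      by split=> //= y lt_y; rewrite -/i /update; case: eqP => // _; apply: ag.
    move=> s1 [w1 w2 kw sim3].
    apply: (run_seq (T1 := 4) (T2 := pcbound B c) (Q1 := fun s1 =>
       [/\ regs s1 fr = cnt, regs s1 fr.+1 = i.+1, keeps fr st s1 &
        simulates s1 (setreg (iteri i F s) x i)])); last by lia.
      apply: run_assign => //=; split; rewrite /= ?updateE ?w2 ?addn1 //.
      * by rewrite updateN //; lia.
      * by move=> y lt_y; rewrite /= updateN ?kw //; lia.
      * case: sim3 => ag3 m3; split=> //; apply: agree_trans ag3.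
        by apply: agree_update; lia.
    move=> {w1 w2 kw sim3}s1 [w1 w2 kw sim3].
    have := IHc fr.+2 s1 _ vc _ sim3; rewrite /= updateN 1?eq_sym // capF.
    move/(_ _)/run_weaken; apply=> //; first by lia.
    move=> s2 [sim4 k4].
    have e2 : regs s2 fr.+1 = i.+1 by rewrite k4 ?w2 //; lia.
    split; last by rewrite e2; lia.
    rewrite /I e2; split=> //; first by rewrite k4 ?w1 //; lia.
    by apply: keeps_trans kw _; apply: keeps_le k4 _; lia.
  + move=> s' [sv si ks sim'] /=; rewrite sv => c0.
    by have <- : regs s' fr.+1 = cnt by lia.
  + by rewrite /=; lia.
Qed.

(** * Polynomial growth of the syntactic bounds *)

Definition poly_bounded (f : nat -> nat) : Prop :=
  exists a d, forall B, 0 < B -> f B <= a * B ^ d.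

Lemma poly_bounded_const c : poly_bounded (fun _ => c).
Proof. by exists c, 0 => B _; rewrite muln1. Qed.

Lemma poly_bounded_id : poly_bounded id.
Proof. by exists 1, 1 => B _; rewrite mul1n. Qed.

Lemma poly_bounded_add f g :
  poly_bounded f -> poly_bounded g -> poly_bounded (fun B => f B + g B).
Proof.
move=> [a [d fP]] [b [e gP]]; exists (a + b), (d + e) => B B0.
rewrite mulnDl; apply: leq_add.
  by apply: leq_trans (fP B B0) _; rewrite leq_mul // leq_pexp2l // leq_addr.
by apply: leq_trans (gP B B0) _; rewrite leq_mul // leq_pexp2l // leq_addl.
Qed.

Lemma poly_bounded_mul f g :
  poly_bounded f -> poly_bounded g -> poly_bounded (fun B => f B * g B).
Proof.
move=> [a [d fP]] [b [e gP]]; exists (a * b), (d + e) => B B0.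
by rewrite expnD mulnACA; apply: leq_mul; [apply: fP | apply: gP].
Qed.

Lemma pbound_poly e : poly_bounded (pbound^~ e).
Proof.
by elim: e => /= *; repeat first [ assumption | exact: poly_bounded_const
  | exact: poly_bounded_id | apply: poly_bounded_add | apply: poly_bounded_mul ].
Qed.

Lemma pcbound_poly c : poly_bounded (pcbound^~ c).
Proof.
by elim: c => /= *; repeat first [ assumption | exact: poly_bounded_const
  | exact: poly_bounded_id | exact: pbound_poly
  | apply: poly_bounded_add | apply: poly_bounded_mul ].
Qed.

Definition guard x y := Minus (Reg x) (Reg y).

(** For the uncapped loops. The body costs a function of [B], so the length of the input enters the
    running time through the factor [n] only. *)
Lemma run_loop (J : nat -> state -> Prop) x y c B k n st s :
  simulates st s -> J k s -> k <= n -> pvalid c -> x < nglob -> y < nglob ->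
  (forall k s, J k s -> regs s 1 = B) ->
  (forall k s, J k s -> regs s y < regs s x -> exists2 k', k' < k & J k' (pden c s)) ->
  run (While (guard x y) (pcompile nglob c)) st (n * (pcbound B c + 4) + 4)
    (fun st' => exists k' s', [/\ simulates st' s', J k' s' & regs s' x <= regs s' y]).
Proof.
move=> sim Js le_kn vc lt_x lt_y cap step.
pose I k st := exists2 s, simulates st s & J k s.
apply: (@run_while_rel I _ _ k n _ (pcbound B c)) => //; first by exists s.
- move=> k1 st1 [s1 sim1 Js1]; rewrite /= !sim1.1 // subn_eq0 -ltnNge => lt_yx.
  have := run_pcompile vc (leqnn _) sim1; rewrite (cap _ _ Js1).
  move/run_weaken; apply=> // st2 [sim2 _].
  by have [k' lt_k' Js2] := step _ _ Js1 lt_yx; exists k' => //; exists (pden c s1).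
- move=> k1 st1 [s1 sim1 Js1]; rewrite /= !sim1.1 // => /eqP; rewrite subn_eq0 => le_xy.
  by exists k1, s1.
- by rewrite /=; lia.
Qed.

Lemma run_passign x e st s : simulates st s -> x < nglob ->
  run (pcompile nglob (PAssign x e)) st (pbound (regs s 1) e + 2)
    (fun st' => simulates st' (setreg s x (peval0 s e))).
Proof.
move=> sim lt_x; apply: run_seq (run_pcomp0 e (leqnn _) sim) _ (leqnn _).
move=> st1 [[ag m] k v]; apply: run_assign => //=.
split=> //= y lt_y; rewrite v /update; case: eqP => // _; exact: ag.
Qed.

(** * Spans derived by a productive grammar *)

(** Big-step derivations: what a nonterminal derives is kept apart from what follows it, so that a
    derivation respects the factorisation of the right-hand side and of the word. *)
Inductive yields q s (G : cfg q s) : seq (symb q s) -> seq 'I_s -> Prop :=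
  | YieldsNil : yields G [::] [::]
  | YieldsTerm a alpha u : yields G alpha u -> yields G (inr a :: alpha) (a :: u)
  | YieldsRule A beta alpha u v : (A, beta) \in G -> yields G beta u ->
      yields G alpha v -> yields G (inl A :: alpha) (u ++ v).

Lemma yields_cat q s (G : cfg q s) alpha beta u v :
  yields G alpha u -> yields G beta v -> yields G (alpha ++ beta) (u ++ v).
Proof.
move=> ga gb; elim: {alpha u}ga => //= [a al u _|A be al u u' Ab gu _ _].
  exact: YieldsTerm.
by move=> IH; rewrite -catA; apply: YieldsRule Ab gu IH.
Qed.

Lemma yields_split q s (G : cfg q s) alpha beta w :
  yields G (alpha ++ beta) w ->
  exists u v, [/\ w = u ++ v, yields G alpha u & yields G beta v].
Proof.
elim: alpha w => [|x alpha IH] w /=.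
  by move=> g; exists [::], w; split=> //; apply: YieldsNil.
move=> g; inversion g; subst.
  have [u1 [v1 [-> g1 g2]]] := IH _ H2; exists (a :: u1), v1; split=> //.
  exact: YieldsTerm.
have [u1 [v1 [-> g1 g2]]] := IH _ H4; exists (u ++ u1), v1; split=> //.
  by rewrite catA.
exact: YieldsRule H1 H2 g1.
Qed.

Lemma yields1 q s (G : cfg q s) A w :
  yields G [:: inl A] w <-> exists2 beta, (A, beta) \in G & yields G beta w.
Proof.
split=> [g|[beta Ab g]].
  by inversion g; subst; inversion H4; subst; rewrite cats0; exists beta.
by rewrite -[w]cats0; apply: YieldsRule Ab g _; apply: YieldsNil.
Qed.

Lemma yields_terminals q s (G : cfg q s) (w : seq 'I_s) :
  yields G [seq inr a | a <- w] w.
Proof. by elim: w => /= [|a w IH]; [apply: YieldsNil|apply: YieldsTerm]. Qed.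

Lemma yieldsP q s (G : cfg q s) alpha w :
  yields G alpha w <->
  clos_refl_trans _ (cfg_step G) alpha [seq inr a | a <- w].
Proof.
split.
  suff ctx pre post : yields G alpha w -> clos_refl_trans _ (cfg_step G)
      (pre ++ alpha ++ post) (pre ++ [seq inr a | a <- w] ++ post).
    by move=> /(ctx [::] [::]); rewrite /= !cats0.
  move=> g; elim: g pre post => [|a al u _ IH|A be al u v Ab _ IHu _ IHv] pre post.
  - exact: rt_refl.
  - by have := IH (rcons pre (inr a)) post; rewrite -!cats1 -!catA.
  - apply: rt_trans.
      by apply: rt_step; apply: (CfgStep pre (al ++ post) Ab).
    apply: rt_trans (IHu pre (al ++ post)) _.
    by rewrite map_cat -!catA; have := IHv (pre ++ map inr u) post; rewrite -!catA.
suff red z : clos_refl_trans_1n _ (cfg_step G) alpha z ->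
    z = [seq inr a | a <- w] -> yields G alpha w.
  by move=> /clos_rt_rt1n_iff /red; apply.
elim=> [x ->|x y z' xy _ IH /IH {}IH]; first exact: yields_terminals.
case: xy IH => A al u v Ab /yields_split[w1 [w2 [-> g1 /yields_split[w3 [w4 [-> g3 g4]]]]]].
by apply: yields_cat g1 _; apply: YieldsRule Ab g3 g4.
Qed.

Section Spans.
Context {q s : nat} (u : seq 'I_s) (n : nat).
Implicit Types (T : nat -> nat -> nat -> bool) (G : cfg q s).

Definition symb_span T (x : symb q s) i j : bool :=
  match x with
  | inl B => (i < j) && T B i j
  | inr b => [&& j == i.+1, i < size u & nth 0 [seq val a | a <- u] i == b]
  end.

Fixpoint span T (alpha : seq (symb q s)) i j : bool :=
  if alpha is x :: alpha' then
    has (fun k => symb_span T x i k && span T alpha' k j) (iota 0 n.+1)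
  else i == j.

Definition refine G T (A i j : nat) : bool :=
  has (fun r => (val r.1 == A) && span T r.2 i j) G.

Definition slice i j : seq 'I_s := take (j - i) (drop i u).

Lemma has_iotaP (p : pred nat) m :
  reflect (exists2 k, k < m & p k) (has p (iota 0 m)).
Proof.
by apply: (iffP hasP) => [[k]|[k lt_k pk]]; [rewrite mem_iota => *|];
  exists k; rewrite ?mem_iota.
Qed.

Lemma span_consP T x alpha i j :
  reflect (exists k, [/\ k <= n, symb_span T x i k & span T alpha k j])
    (span T (x :: alpha) i j).
Proof.
apply: (iffP (has_iotaP _ _)) => [[k lt_k /andP[]]|[k [le_k xk ak]]].
  by exists k.
by exists k; rewrite ?ltnS ?xk.
Qed.

Lemma span1 T x i j : j <= n -> span T [:: x] i j = symb_span T x i j.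
Proof.
move=> le_j; apply/span_consP/idP => [[k [_ xk /eqP <-]] //|xj].
by exists j; split=> //=.
Qed.

Lemma span_catP T alpha beta i j : i <= n ->
  reflect (exists k, [/\ k <= n, span T alpha i k & span T beta k j])
    (span T (alpha ++ beta) i j).
Proof.
elim: alpha i => [|x alpha IH] i le_i.
  apply: (iffP idP) => [sp|[k [_ /= /eqP ->]]] //.
  by exists i; split=> //=.
rewrite cat_cons; apply: (iffP (span_consP _ _ _ _ _)).
  move=> [k [le_k xk /(IH _ le_k)[k' [le_k' ak bk]]]].
  by exists k'; split=> //; apply/span_consP; exists k.
move=> [k [le_k /span_consP[k' [le_k' xk ak]] bk]].
by exists k'; split=> //; apply/(IH _ le_k'); exists k.
Qed.

Lemma symb_span_lt T x i j : symb_span T x i j -> i < j.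
Proof. by case: x => [B /andP[]|b /and3P[/eqP ->]] //. Qed.

Lemma span_le T alpha i j :
  span T alpha i j -> i + has (@is_terminal q s) alpha <= j.
Proof.
elim: alpha i => [|x alpha IH] i; first by move=> /= /eqP ->; rewrite addn0.
move=> /span_consP[k [_ /symb_span_lt lt_ik /IH]] /=.
case: (is_terminal x) => /=; first by case: (has _ _); lia.
by lia.
Qed.

Lemma slice_cat i k j : i <= k -> k <= j -> slice i j = slice i k ++ slice k j.
Proof.
move=> le_ik le_kj; rewrite /slice.
have -> : j - i = (k - i) + (j - k) by lia.
by rewrite takeD drop_drop; congr (_ ++ take _ (drop _ _)); lia.
Qed.

Lemma size_slice i j : j <= size u -> size (slice i j) = j - i.
Proof. by move=> le_j; rewrite /slice size_takel // size_drop; lia. Qed.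

Lemma slice_symb b i : i < size u -> nth 0 [seq val a | a <- u] i == val b ->
  slice i i.+1 = [:: b].
Proof.
move=> lt_i; rewrite (nth_map b) // => /eqP/val_inj e.
by rewrite /slice subSnn (drop_nth b) // e /= take0.
Qed.

Lemma yields_size G alpha w : productive G -> yields G alpha w ->
  size alpha <= size w.
Proof.
move=> pG y; elim: {alpha w} y => //= A be al v w Ab _ IHv _ IHw.
have /(allP pG) := Ab; move=> /hasP[x xbe _].
have : 0 < size be by case: (be) xbe => [|y l].
by move=> be0; rewrite size_cat -add1n; apply: leq_add IHw; apply: leq_trans IHv.
Qed.

Definition derives G (A : 'I_q) i j :=
  j <= size u /\ yields G [:: inl A] (slice i j).

Definition correct_below G T d := forall (A : 'I_q) i j,
  i < j <= n -> j - i < d -> T A i j <-> derives G A i j.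

(** The boolean in the bound measures the slack: next to a terminal, nonterminals have spans shorter
    than [j - i], whereas without one a single nonterminal may cover the whole span. The bound on
    [j] is conditional because an empty span may lie beyond the end of [u], positions ranging up to
    [n]. *)
Lemma span_yields G T d alpha i j : correct_below G T d -> j <= n ->
  j - i + (~~ has (@is_terminal q s) alpha) <= d -> span T alpha i j ->
  (i < j -> j <= size u) /\ yields G alpha (slice i j).
Proof.
move=> Tok le_jn; elim: alpha i => [|x alpha IH] i le_d.
  move=> /= /eqP ->; rewrite ltnn; split=> //.
  by rewrite /slice subnn take0; apply: YieldsNil.
move=> /span_consP[k [le_k xk ak]].
have lt_ik := symb_span_lt xk; have := span_le ak.
set ta := has _ _ in IH le_d * => le_kj.
have [| le_j ya] := IH k _ ak.
  by move: le_d => /=; rewrite -/ta; case: (is_terminal x); case: (ta) => /=; lia.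
have eqs : slice i j = slice i k ++ slice k j by apply: slice_cat; lia.
case: x xk le_d => [A /andP[_ TA]|b /and3P[/eqP ek lt_i nb]] /=; rewrite -/ta => le_d.
  have [| |le_ku yA] := (Tok A i k _ _).1 TA.
  - by rewrite lt_ik le_k.
  - by move: le_d le_kj; case: (ta) => /=; lia.
  split; first by move=> _; have [|] := ltnP k j; [exact: le_j | lia].
  by rewrite eqs; have := yields_cat yA ya.
split.
  by move=> _; have [|] := ltnP k j; [exact: le_j | rewrite ek; lia].
by rewrite eqs ek (slice_symb lt_i nb) -ek; apply: YieldsTerm.
Qed.

Lemma yields_span G T d alpha i j : productive G -> size u <= n ->
  correct_below G T d -> i <= j -> j <= size u ->
  j - i + (~~ has (@is_terminal q s) alpha) <= d ->
  yields G alpha (slice i j) -> span T alpha i j.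
Proof.
move=> pG le_un Tok; elim: alpha i => [|x alpha IH] i le_ij le_ju le_d ya.
  by inversion ya; apply/eqP; have := size_slice i le_ju; rewrite -H /=; lia.
have szs := size_slice i le_ju.
inversion ya as [|b al v yv e1 e2|A be al v w Abe yv yw e1 e2]; subst.
  have lt_ij : i < j by move: szs; rewrite -e2 /=; lia.
  have lt_iu : i < size u by lia.
  have [eb ev] : nth b u i :: slice i.+1 j = b :: v.
    by rewrite e2 (@slice_cat i i.+1 j) // {2}/slice subSnn (drop_nth b) //= take0.
  apply/span_consP; exists i.+1; split; first by lia.
    by rewrite /= eqxx lt_iu (nth_map b) // eb eqxx.
  by apply: IH; rewrite ?ev //; move: le_d => /=; case: (has _ _) => /=; lia.
have szv : size v + size w = j - i by rewrite -szs -e2 size_cat.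
have yA : yields G [:: inl A] v by apply/yields1; exists be.
have v0 := yields_size pG yA; have w0 := yields_size pG yw.
pose k := i + size v.
have le_kj : k <= j by rewrite /k; lia.
have szk : size v = size (slice i k).
  by rewrite size_slice ?(leq_trans le_kj) // /k addKn.
have := e2; rewrite (@slice_cat i k j) ?leq_addr //.
move/eqP; rewrite eqseq_cat // => /andP[/eqP ev /eqP ew].
have {}v0 : 0 < size v := v0.
have wt : has (@is_terminal q s) alpha -> 0 < size w.
  by case: (alpha) w0 => //= ? ?; lia.
apply/span_consP; exists k; split; first by rewrite /k; lia.
  rewrite /= -[X in X && _]/(i < k); apply/andP; split; first by rewrite /k; lia.
  apply/Tok; [by rewrite /k; lia | | by rewrite /derives -ev; split=> //; rewrite /k; lia].
  by move: le_d wt => /=; case: (has _ _) => /=; rewrite /k; lia.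
apply: IH; rewrite -?ew //; first by rewrite /k; lia.
Qed.

(** Productivity gains one unit of length: correctness on spans shorter than [d] becomes correctness
    on spans of length [d] as well. Existence and uniqueness of the fixed point both iterate
    this. *)
Lemma refine_correct G T d (A : 'I_q) i j : productive G -> size u <= n ->
  correct_below G T d -> i <= n -> j <= n -> j - i <= d ->
  refine G T A i j <-> i < j /\ derives G A i j.
Proof.
move=> pG le_un Tok le_in le_jn le_d; split.
  move=> /hasP[[A' be] Abe /= /andP[/eqP/val_inj eA sp]]; subst A'.
  have tbe := allP pG _ Abe; have := span_le sp; rewrite tbe addn1 => lt_ij.
  have [|le_j ys] := span_yields Tok le_jn _ sp; first by rewrite tbe addn0.
  by split=> //; split; [exact: le_j | apply/yields1; exists be].
move=> [lt_ij [le_ju /yields1[be Abe ys]]].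
have tbe := allP pG _ Abe.
apply/hasP; exists (A, be) => //=; rewrite eqxx /=.
by apply: (yields_span pG le_un Tok _ le_ju _ ys); rewrite ?(ltnW lt_ij) ?tbe ?addn0.
Qed.

(* A production of a productive grammar splits a span into strictly smaller
   ones, so that the equation [T = refine G T] determines [T]. *)
Lemma refine_fixpoint G T : productive G -> size u <= n ->
  (forall (A : 'I_q) i j, i <= n -> j <= n -> T A i j = refine G T A i j) ->
  forall (A : 'I_q) i j, i <= n -> j <= n ->
  T A i j <-> i < j /\ derives G A i j.
Proof.
move=> pG le_un fixT A i j le_i le_j.
suff Tok d : correct_below G T d.
  by rewrite fixT //; apply: (refine_correct A pG le_un (Tok (j - i))).
elim: d => [//|d IH] B k l /andP[lt_kl le_l] lt_d.
rewrite fixT //; last by lia.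
by rewrite (refine_correct B pG le_un IH); [split=> [[]|] | lia | lia | lia].
Qed.

(** Spans have length at most [n], so [n.+1] rounds settle all of them. *)
Definition table G := iter n.+1 (refine G) (fun _ _ _ => false).

(** The two sides are the iterates of rank [n.+1] and [n.+2], and both are already exact. *)
Lemma refine_table G (A : 'I_q) i j : productive G -> size u <= n ->
  i <= n -> j <= n -> table G A i j = refine G (table G) A i j.
Proof.
move=> pG le_un le_i le_j; pose T d := iter d (refine G) (fun _ _ _ => false).
have Tok d : correct_below G (T d) d.
  elim: d => [//|d IH] B k l /andP[lt_kl le_l] lt_d.
  by rewrite /T iterS (refine_correct B pG le_un IH); [split=> [[]|] | lia | lia | lia].
have TP m : n <= m -> T m.+1 A i j <-> i < j /\ derives G A i j.
  move=> le_m; rewrite /T iterS.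
  by apply: (refine_correct A pG le_un (Tok m)) => //; lia.
apply/idP/idP.
  by move=> /(TP n (leqnn _)) /(TP n.+1 (leqnSn _)).
by move=> /(TP n.+1 (leqnSn _)) /(TP n (leqnn _)).
Qed.

End Spans.

(** * Syntax trees and meta-grammars *)

Definition word s (W : seq (seq 'I_s)) w := nth [::] W w.

Definition letter_at s (u : seq 'I_s) i b : bool :=
  (i < size u) && (nth 0 [seq val a | a <- u] i == b).

Definition span_cat (n : nat) (X Y : nat -> nat -> bool) i j : bool :=
  has (fun k => X i k && Y k j) (iota 0 n.+1).

(* [sem T t A w i j]: assuming that [T] lists the spans derived by the
   nonterminals, a right-hand side [t] matches the factor [i, j) of the word
   number [w] (whatever [A] is); for a list of productions [t], some production
   of [A] does. *)
Fixpoint sem q s (ax : nat) (W : seq (seq 'I_s)) (n : nat)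
    (T : nat -> nat -> nat -> nat -> bool) (t : tree q s) A w i j : bool :=
  match t with
  | Var _ | Leaf End => false
  | Leaf (Rhs B) => (i < j) && T B w i j
  | Leaf (Term b) => (j == i.+1) && letter_at (word W w) i b
  | Node Cat l r =>
      span_cat n (sem ax W n T l A w) (sem ax W n T r A w) i j
  | Node (Lhs B) l r =>
      sem ax W n T r A w i j || (A == B) && sem ax W n T l A w i j
  | Node Top l r =>
      sem ax W n T r A w i j || (A == ax) && sem ax W n T l A w i j
  end.

Section Semantics.
Context {q s : nat} (ax : nat) (W : seq (seq 'I_s)) (n : nat).
Variable T : nat -> nat -> nat -> nat -> bool.
Implicit Types t : tree q s.

Lemma sem_rhs t alpha A w i j : decode_rhs t = Some alpha -> i <= n -> j <= n ->
  sem ax W n T t A w i j = span (word W w) n (fun A => T A w) alpha i j.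
Proof.
elim: t alpha i j => [[]|[|B|b]|[|B|] l IHl r IHr] alpha i j //=.
- by move=> [<-] le_i le_j; rewrite span1.
- by move=> [<-] le_i le_j; rewrite span1.
case el: (decode_rhs l) => [be|//]; case er: (decode_rhs r) => [ga|//] [<-] le_i le_j.
apply/(has_iotaP _ _)/(span_catP _ _ _ _ _ le_i).
  move=> [k lt_k /andP[sl sr]]; exists k.
  by rewrite -IHl // -IHr //; split.
move=> [k [le_k sl sr]]; exists k => //.
by rewrite (IHl be) // (IHr ga) // sl.
Qed.

Lemma sem_spine t G A w i j : decode_spine t = Some G -> i <= n -> j <= n ->
  sem ax W n T t A w i j = refine (word W w) n G (fun A => T A w) A i j.
Proof.
elim: t G => [[]|[|B|b]|[|B|] l IHl r IHr] G //=; first by move=> [<-].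
case el: (decode_rhs l) => [be|//]; case er: (decode_spine r) => [H|//] [<-] le_i le_j.
by rewrite (IHr H) // (sem_rhs A w el) //= orbC eq_sym.
Qed.

Lemma sem_decode (S : 'I_q) t G A w i j : ax = S ->
  decode S t = Some G -> i <= n -> j <= n ->
  sem ax W n T t A w i j = refine (word W w) n G (fun A => T A w) A i j.
Proof.
move=> axS; case: t => [[]|//|[|B|] l r] //=.
case el: (decode_rhs l) => [be|//]; case er: (decode_spine r) => [H|//] [<-] le_i le_j.
rewrite /= (sem_spine A w er) // (sem_rhs A w el) //= orbC.
by rewrite axS [A == S]eq_sym.
Qed.

End Semantics.

Definition accepts q s (S : 'I_q) (P N : seq (seq 'I_s)) n (t : tree q s)
    (T : nat -> nat -> nat -> nat -> bool) :=
  let W := P ++ N in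
  [/\ forall A w i j, A < q -> w < size W -> i <= n -> j <= n ->
        T A w i j = sem S W n T t A w i j,
      forall w, w < size P -> T S w 0 (size (word W w))
    & forall w, size P <= w -> w < size W -> ~~ T S w 0 (size (word W w))].

Lemma cfg_langP q s (S : 'I_q) (G : cfg q s) u :
  cfg_lang S G u <-> derives u G S 0 (size u).
Proof.
rewrite /cfg_lang /derives /slice subn0 drop0 take_size -yieldsP.
by split=> [|[]].
Qed.

Lemma productive_nonempty q s (S : 'I_q) (G : cfg q s) u :
  productive G -> cfg_lang S G u -> 0 < size u.
Proof.
by move=> pG; rewrite /cfg_lang -yieldsP => /(yields_size pG).
Qed.

(** From left to right, uniqueness of the fixed point identifies the guess [T] with the spans really
    derived by [G]; from right to left, [table] is a suitable guess. *)
Lemma accepts_separates q s (S : 'I_q) (P N : seq (seq 'I_s)) n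
    (t : tree q s) G :
  decode S t = Some G -> productive G ->
  (forall u, u \in P ++ N -> size u <= n) ->
  (exists T, accepts S P N n t T) <-> separates S P N G.
Proof.
move=> dec pG le_n; set W := P ++ N.
have szW w : w < size W -> size (word W w) <= n.
  by move=> lt_w; apply: le_n; apply: mem_nth.
have inP w : w < size P -> word W w \in P.
  by move=> lt_w; rewrite /word /W nth_cat lt_w mem_nth.
have inN w : size P <= w -> w < size W -> word W w \in N.
  move=> le_w lt_w; rewrite /word /W nth_cat ltnNge le_w /=; apply: mem_nth.
  by rewrite -(ltn_add2r (size P)) subnK // addnC -size_cat.
have TP T : (forall A w i j, A < q -> w < size W -> i <= n -> j <= n ->
      T A w i j = sem S W n T t A w i j) ->
    forall w, w < size W ->
    T S w 0 (size (word W w)) <-> cfg_lang S G (word W w).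
  move=> fixT w lt_w; rewrite cfg_langP.
  have := @refine_fixpoint q s (word W w) n G (fun A => T A w) pG (szW w lt_w).
  move=> /(_ _ S 0 (size (word W w))) -> //.
  - split=> [[_ d] //|d]; split=> //.
    by apply: (productive_nonempty (S := S) pG); apply: (cfg_langP S G _).2.
  - by move=> A i j le_i le_j; rewrite fixT // (sem_decode W T _ _ _ dec).
  - exact: szW.
split=> [[T [fixT accP rejN]]|[sepP sepN]].
  split=> u /(nthP [::]) [w lt_w <-].
    have lt_wW : w < size W by rewrite size_cat (leq_trans lt_w) ?leq_addr.
    by have /TP := accP w lt_w; rewrite /word /W nth_cat lt_w; apply.
  have lt_wW : size P + w < size W by rewrite size_cat ltn_add2l.
  have := rejN (size P + w) (leq_addr _ _) lt_wW.
  have := TP T fixT _ lt_wW; rewrite /word /W nth_cat ltnNge leq_addr /= addKn => TN.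
  by move=> nT lN; move/negP: nT; apply; apply/TN.
pose T A w := table (word W w) n G A.
have fixT A w i j : A < q -> w < size W -> i <= n -> j <= n ->
    T A w i j = sem S W n T t A w i j.
  move=> lt_A lt_w le_i le_j; rewrite (sem_decode W T _ _ _ dec) //.
  exact: (refine_table (Ordinal lt_A) pG (szW w lt_w)).
exists T; split=> // w.
  move=> lt_w; apply/(TP T fixT); first by rewrite size_cat (leq_trans lt_w) ?leq_addr.
  exact: sepP (inP w lt_w).
by move=> le_w lt_w; apply/negP => /(TP T fixT w lt_w) /sepN; apply; exact: inN.
Qed.

(** * Big-step generation of trees by the meta-grammar *)

Inductive generates q s (MG : rtg q s) :
    term q s 'I_(rtg_nt MG) -> tree q s -> Prop :=
  | GenLeaf b : @generates q s MG (Leaf b) (Leaf b)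
  | GenNode f l r tl tr : generates l tl -> generates r tr ->
      generates (Node f l r) (Node f tl tr)
  | GenVar X u t : List.In (X, u) (rtg_rules MG) -> generates u t ->
      generates (Var X) t.

Lemma generates_lift q s (MG : rtg q s) t : @generates q s MG (Defs.lift _ t) t.
Proof. by elim: t => [[]|b|f l IHl r IHr] /=; constructor. Qed.

Lemma generates_step q s (MG : rtg q s) u u' t :
  @rtg_step q s MG u u' -> generates u' t -> generates u t.
Proof.
move=> st; elim: st t => {u u'} [X u Xu|f l l' r _ IH|f l r r' _ IH] t g.
- exact: GenVar Xu g.
- by inversion g; subst; constructor=> //; apply: IH.
- by inversion g; subst; constructor=> //; apply: IH.
Qed.

Lemma rtg_langP q s (MG : rtg q s) t :
  rtg_lang MG t <-> generates (Var (rtg_start MG)) t.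
Proof.
rewrite /rtg_lang; move: (Var _) => u; split.
  move=> /clos_rt_rt1n_iff st.
  suff red z : clos_refl_trans_1n _ (@rtg_step q s MG) u z ->
      z = Defs.lift _ t -> generates u t by apply: red st _.
  elim=> [x ->|x y z' xy _ IH /IH]; first exact: generates_lift.
  exact: generates_step.
have ctx (F : term q s 'I_(rtg_nt MG) -> term q s 'I_(rtg_nt MG)) :
    (forall x y, rtg_step x y -> rtg_step (F x) (F y)) -> forall x y,
    clos_refl_trans _ (@rtg_step q s MG) x y ->
    clos_refl_trans _ (@rtg_step q s MG) (F x) (F y).
  move=> FS x y; elim=> [x' y' xy|x'|x' y' z' _ xy _ yz].
  - by apply: rt_step; apply: FS.
  - exact: rt_refl.
  - exact: rt_trans xy yz.
elim=> {u t} [b|f l r tl tr _ IHl _ IHr|X u t Xu _ IH].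
- exact: rt_refl.
- apply: (rt_trans _ _ _ (Node f (Defs.lift _ tl) r)).
    by apply: (ctx (fun x => Node f x r)) IHl => x y; constructor.
  by apply: (ctx (fun x => Node f _ x)) IHr => x y; constructor.
- by apply: rt_trans IH; apply: rt_step; constructor.
Qed.

(** * States of the tree automaton *)

Definition bit (y b : nat) : bool := odd (iter b half y).

Lemma bits_exist K (f : nat -> bool) :
  exists2 y, y < 2 ^ K & forall b, b < K -> bit y b = f b.
Proof.
elim: K f => [|K IH] f; first by exists 0.
have [y lt_y yP] := IH (fun b => f b.+1).
exists (f 0 + y.*2); first by rewrite expnS mul2n; case: (f 0); lia.
case=> [|b] lt_b; rewrite /bit; first by rewrite oddD odd_double; case: (f 0).
by rewrite iterSr halfD doubleK odd_double andbF -yP //; case: (f 0).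
Qed.

Definition all4 Q m n (p : nat -> nat -> nat -> nat -> bool) : bool :=
  all (fun A => all (fun w => all (fun i => all (p A w i)
    (iota 0 n.+1)) (iota 0 n.+1)) (iota 0 m)) (iota 0 Q).

Lemma all_iotaP (p : pred nat) k :
  reflect (forall i, i < k -> p i) (all p (iota 0 k)).
Proof.
apply: (iffP allP) => h i; last by rewrite mem_iota => /h.
by move=> lt_i; apply: h; rewrite mem_iota.
Qed.

Lemma all4P Q m n (p : nat -> nat -> nat -> nat -> bool) :
  reflect (forall A w i j, A < Q -> w < m -> i <= n -> j <= n -> p A w i j)
    (all4 Q m n p).
Proof.
apply: (iffP (all_iotaP _ _)) => h A.
  move=> w i j /h /all_iotaP h1 /h1 /all_iotaP h2 le_i le_j.
  by have /all_iotaP := h2 i le_i; apply.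
move=> lt_A; apply/all_iotaP => w lt_w; apply/all_iotaP => i lt_i.
by apply/all_iotaP => j lt_j; apply: h.
Qed.

Section States.
(* [Q] is [q], or 0 when all words are empty. *)
Context {q s : nat} (S : 'I_q) (P N : seq (seq 'I_s)) (Q n : nat).
Hypothesis Qq : Q = 0 \/ Q = q.
Let W := P ++ N.
Let m := size W.
Implicit Types t : tree q s.

(** Mixed-radix number of a cell. The leading digit ranges over [Q + Q]: below [Q] it addresses the
    set of matched spans, and [Q + A] addresses the guessed table. *)
Definition index4 A w i j := ((A * m + w) * n.+1 + i) * n.+1 + j.
Definition nbits := n.+1 * (n.+1 * (m * (Q + Q))).
Definition nstates := 2 ^ nbits.
Definition set_bit y A w i j := bit y (index4 A w i j).
Definition table_bit y A w i j := bit y (index4 (Q + A) w i j).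

Lemma index4_lt A w i j : A < Q + Q -> w < m -> i <= n -> j <= n ->
  index4 A w i j < nbits.
Proof.
clear Qq; move=> lt_A lt_w le_i le_j; rewrite /index4 /nbits.
have h1 : A * m + w < m * (Q + Q).
  by rewrite (mulnC m); apply: (@leq_trans (A.+1 * m)); [rewrite mulSn; lia | rewrite leq_mul].
have h2 : (A * m + w) * n.+1 + i < n.+1 * (m * (Q + Q)).
  rewrite (mulnC n.+1); apply: (@leq_trans ((A * m + w).+1 * n.+1)).
    by rewrite mulSn; lia.
  by rewrite leq_mul.
rewrite [leqRHS]mulnC; apply: (@leq_trans (((A * m + w) * n.+1 + i).+1 * n.+1)).
  by rewrite mulSn; lia.
by rewrite leq_mul.
Qed.

Lemma states_exist (F : nat -> nat -> nat -> nat -> bool) :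
  exists2 y, y < nstates & forall A w i j, A < Q + Q -> w < m -> i <= n -> j <= n ->
    set_bit y A w i j = F A w i j.
Proof.
pose f b := F (b %/ n.+1 %/ n.+1 %/ m) (b %/ n.+1 %/ n.+1 %% m)
              (b %/ n.+1 %% n.+1) (b %% n.+1).
have [y lt_y yP] := bits_exist nbits f.
exists y => // A w i j lt_A lt_w le_i le_j.
rewrite /set_bit yP ?index4_lt // /f /index4.
have m0 : 0 < m by apply: leq_ltn_trans lt_w.
rewrite !divnMDl // [j %/ _]divn_small // addn0 !divnMDl // [i %/ _]divn_small //.
by rewrite addn0 !divnMDl // [w %/ _]divn_small // addn0 !modnMDl !modn_small.
Qed.

Definition leaf_test sym arg y : bool :=
  all4 Q m n (fun A w i j => set_bit y A w i j ==
    if sym == 1 then false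
    else if sym == 2 then (i < j) && table_bit y arg w i j
    else (j == i.+1) && letter_at (word W w) i arg).

(** Both children must carry the table of the parent, so that a single guess is shared by the whole
    tree. Symbols are given by their numeric codes, as the program reads them from memory. *)
Definition node_test sym arg y1 y2 y : bool :=
  all4 Q m n (fun A w i j =>
    [&& table_bit y1 A w i j == table_bit y A w i j,
        table_bit y2 A w i j == table_bit y A w i j
      & set_bit y A w i j ==
        if sym == 6 then span_cat n (set_bit y1 A w) (set_bit y2 A w) i j
        else set_bit y2 A w i j ||
          (A == if sym == 4 then val S else arg) && set_bit y1 A w i j]).

Definition accept_test y : bool :=
  [&& all4 Q m n (fun A w i j => table_bit y A w i j == set_bit y A w i j),
      all (fun w => table_bit y S w 0 (size (word W w))) (iota 0 (size P))
    & all (fun w => (size P <= w) ==> ~~ table_bit y S w 0 (size (word W w)))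
        (iota 0 m)].

Definition represents y t := forall A w i j, A < Q -> w < m -> i <= n -> j <= n ->
  set_bit y A w i j = sem S W n (table_bit y) t A w i j.

Lemma eq_sem T T' t A w i j :
  (forall A w i j, A < Q -> w < m -> i <= n -> j <= n -> T A w i j = T' A w i j) ->
  A < Q -> w < m -> i <= n -> j <= n ->
  sem S W n T t A w i j = sem S W n T' t A w i j.
Proof.
move=> eqT lt_A lt_w.
(* [A < Q] rules out [Q = 0]; with [Q = q], the nonterminals occurring in [t] lie in the range where
   the tables agree. *)
have eqQ : Q = q by case: Qq lt_A => -> //.
elim: t i j => [[]|[|B|b]|[|B|] l IHl r IHr] i j le_i le_j //=.
- by rewrite eqT // eqQ.
- by rewrite IHl ?IHr.
- by rewrite IHl ?IHr.
- by apply: eq_in_has => k; rewrite mem_iota /= add0n ltnS => le_k; rewrite IHl ?IHr.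
Qed.

Lemma leaf_testP b y :
  reflect (represents y (Leaf b)) (leaf_test (nsym_code b).1 (nsym_code b).2 y).
Proof.
apply: (iffP (all4P _ _ _ _)) => h A w i j lt_A lt_w le_i le_j.
  by rewrite (eqP (h A w i j lt_A lt_w le_i le_j)); case: (b).
by rewrite h //; case: (b) => /=.
Qed.

Lemma node_test_sound f l r y1 y2 y :
  represents y1 l -> represents y2 r ->
  node_test (bsym_code f).1 (bsym_code f).2 y1 y2 y -> represents y (Node f l r).
Proof.
move=> r1 r2 /all4P h A w i j lt_A lt_w le_i le_j.
have e1 A' w' i' j' : A' < Q -> w' < m -> i' <= n -> j' <= n ->
    table_bit y1 A' w' i' j' = table_bit y A' w' i' j'.
  by move=> a b c d; have /and3P[/eqP] := h A' w' i' j' a b c d.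
have e2 A' w' i' j' : A' < Q -> w' < m -> i' <= n -> j' <= n ->
    table_bit y2 A' w' i' j' = table_bit y A' w' i' j'.
  by move=> a b c d; have /and3P[_ /eqP] := h A' w' i' j' a b c d.
have g1 i' j' : i' <= n -> j' <= n ->
    set_bit y1 A w i' j' = sem S W n (table_bit y) l A w i' j'.
  by move=> le_i' le_j'; rewrite r1 //; apply: eq_sem.
have g2 i' j' : i' <= n -> j' <= n ->
    set_bit y2 A w i' j' = sem S W n (table_bit y) r A w i' j'.
  by move=> le_i' le_j'; rewrite r2 //; apply: eq_sem.
have /and3P[_ _ /eqP ->] := h A w i j lt_A lt_w le_i le_j.
case: (f) => [|B|] /=; rewrite ?g1 ?g2 //.
apply: eq_in_has => k; rewrite mem_iota /= add0n ltnS => le_k.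
by rewrite g1 ?g2.
Qed.

(** Every guess can be carried along every tree; it is only the acceptance test at the root that
    rejects wrong guesses. *)
Lemma represents_exists T t : exists y, [/\ y < nstates,
  forall A w i j, A < Q -> w < m -> i <= n -> j <= n ->
    table_bit y A w i j = T A w i j & represents y t].
Proof.
have [y lt_y yP] := states_exist (fun A w i j =>
  if A < Q then sem S W n T t A w i j else T (A - Q) w i j).
have tb A w i j : A < Q -> w < m -> i <= n -> j <= n ->
    table_bit y A w i j = T A w i j.
  move=> lt_A *; rewrite [LHS]yP //; last by rewrite ltn_add2l.
  by rewrite ltnNge leq_addr /= addKn.
exists y; split=> // A w i j lt_A *.
rewrite yP //; last exact: leq_trans lt_A (leq_addr _ _).
rewrite lt_A.
by apply: eq_sem => // *; rewrite tb.
Qed.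

Lemma node_test_complete f l r y : represents y (Node f l r) ->
  exists y1 y2, [/\ y1 < nstates, y2 < nstates, represents y1 l, represents y2 r
    & node_test (bsym_code f).1 (bsym_code f).2 y1 y2 y].
Proof.
move=> rep.
have [y1 [lt1 e1 r1]] := represents_exists (table_bit y) l.
have [y2 [lt2 e2 r2]] := represents_exists (table_bit y) r.
exists y1, y2; split=> //; apply/all4P => A w i j lt_A lt_w le_i le_j.
rewrite e1 // e2 // !eqxx rep //=.
have g1 i' j' : i' <= n -> j' <= n ->
    sem S W n (table_bit y) l A w i' j' = set_bit y1 A w i' j'.
  by move=> le_i' le_j'; rewrite r1 //; apply: eq_sem => // *; rewrite e1.
have g2 i' j' : i' <= n -> j' <= n ->
    sem S W n (table_bit y) r A w i' j' = set_bit y2 A w i' j'.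
  by move=> le_i' le_j'; rewrite r2 //; apply: eq_sem => // *; rewrite e2.
apply/eqP; case: (f) => [|B|] /=; rewrite ?g1 ?g2 //.
apply: eq_in_has => k; rewrite mem_iota /= add0n ltnS => le_k.
by rewrite g1 ?g2.
Qed.

Lemma accept_testP t : (forall u, u \in W -> size u <= n) -> Q = q ->
  (exists2 y, y < nstates & represents y t /\ accept_test y) <->
  (exists T, accepts S P N n t T).
Proof.
move=> le_n eqQ; have SQ : S < Q by rewrite eqQ.
have szW w : w < m -> size (word W w) <= n.
  by move=> lt_w; apply: le_n; apply: mem_nth.
have lt_P w : w < size P -> w < m.
  by move=> lt_w; rewrite /m size_cat (leq_trans lt_w) ?leq_addr.
split=> [[y _ [rep /and3P[/all4P fixT /all_iotaP accP /all_iotaP rejN]]]|[T [fixT accP rejN]]].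
  exists (table_bit y); split=> //; last first.
    by move=> w le_w lt_w; have /implyP := rejN w lt_w; apply.
  by move=> A w i j *; rewrite -rep -?(eqP (fixT _ _ _ _ _ _ _ _)) ?eqQ.
have [y [lt_y yT rep]] := represents_exists T t.
exists y => //; split=> //; apply/and3P; split.
- apply/all4P => A w i j lt_A lt_w le_i le_j.
  rewrite rep // yT // fixT -?eqQ //; apply/eqP.
  by apply: eq_sem => // *; rewrite yT.
- by apply/all_iotaP => w lt_w; rewrite yT ?accP ?szW ?lt_P.
- by apply/all_iotaP => w lt_w; apply/implyP => le_w; rewrite yT ?rejN ?szW.
Qed.

(** All bits of state 0 are clear, so it claims that no word is derived. This is the truth about
    productive grammars when all words are empty. *)
Lemma accept_test0 t : Q = 0 -> accept_test 0 = (P == [::]).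
Proof.
have b0 b : bit 0 b = false by rewrite /bit; have -> : iter b half 0 = 0 by elim: b => //= b ->.
move=> Q0; rewrite /accept_test /all4 Q0 /= /table_bit.
case: (P) => [|u P'] /=; last by rewrite b0.
by apply/all_iotaP => w _; rewrite b0.
Qed.

Lemma represents0 y t : Q = 0 -> represents y t.
Proof. by move=> Q0 A w i j; rewrite Q0. Qed.

End States.

(** * Transitions as expressions *)

Arguments peval : simpl never.

Section PevalEquations.
Variables (g M : nat -> nat) (env args : seq nat).
Local Notation ev := (peval g M env args).
Local Notation ev0 := (peval g M env [::]).
Lemma peval_num n : ev (ENum n) = n. Proof. by []. Qed.
Lemma peval_reg x : ev (EReg x) = if x < nglob then g x else 0. Proof. by []. Qed.
Lemma peval_var i : ev (EVar i) = nth 0 env i. Proof. by []. Qed.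
Lemma peval_fetch a : ev (EFetch a) = M (ev0 a). Proof. by []. Qed.
Lemma peval_add a b : ev (EAdd a b) = ev0 a + ev0 b. Proof. by []. Qed.
Lemma peval_sub a b : ev (ESub a b) = ev0 a - ev0 b. Proof. by []. Qed.
Lemma peval_if c a b : ev (EIf c a b) = if ev0 c != 0 then ev0 a else ev0 b.
Proof. by []. Qed.
Lemma peval_fold n e0 b : ev (EFold n e0 b) =
  iteri (minn (ev0 n) (g 1)) (fun i acc => peval g M [:: acc, i & env] [::] b) (ev0 e0).
Proof. by []. Qed.
Lemma peval_arg a k : ev (EArg a k) = peval g M env (ev0 a :: args) k.
Proof. by []. Qed.
Lemma peval_call b : ev (ECall b) = peval g M args [::] b. Proof. by []. Qed.
End PevalEquations.

Definition pevalE := (peval_num, peval_reg, peval_var, peval_fetch, peval_add,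
  peval_sub, peval_if, peval_arg, peval_call).

Arguments pden : simpl never.
Arguments peval0 : simpl never.

(* [update] on registers, which [simpl] may compute. *)
Definition upd (g : nat -> nat) x v y := if y == x then v else g y.
Arguments upd g x v y /.

Section PdenEquations.
Variables (g M : nat -> nat).
Local Notation s := (State g M).
Lemma peval0_state e : peval0 s e = peval g M [::] [::] e. Proof. by []. Qed.
Lemma pden_assign x e :
  pden (PAssign x e) s = State (upd g x (peval0 s e)) M.
Proof. by []. Qed.
Lemma pden_store a e :
  pden (PStore a e) s = State g (update M (peval0 s a) (peval0 s e)).
Proof. by []. Qed.
Lemma pden_if e c1 c2 :
  pden (PIf e c1 c2) s = if peval0 s e != 0 then pden c1 s else pden c2 s.
Proof. by []. Qed.
End PdenEquations.

Lemma pden_skip s : pden PSkip s = s. Proof. by []. Qed.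

Lemma pden_seq c1 c2 s : pden (PSeq c1 c2) s = pden c2 (pden c1 s).
Proof. by []. Qed.

Lemma pden_for x e c s : pden (PFor x e c) s =
  iteri (minn (peval0 s e) (regs s 1)) (fun i s' => pden c (setreg s' x i)) s.
Proof. by []. Qed.

Definition pdenE := (pden_skip, pden_assign, pden_store, pden_seq, pden_if,
  peval0_state).

Definition Ecall1 f a := EArg a (ECall f).
Definition Ecall2 f a b := EArg b (EArg a (ECall f)).
Definition Ecall3 f a b c := EArg c (EArg b (EArg a (ECall f))).
Definition Ecall4 f a b c d := EArg d (EArg c (EArg b (EArg a (ECall f)))).
Definition Ecall5 f a b c d e :=
  EArg e (EArg d (EArg c (EArg b (EArg a (ECall f))))).

Definition Enot a := EIf a (ENum 0) (ENum 1).
Definition Eand a b := EIf a (EIf b (ENum 1) (ENum 0)) (ENum 0).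
Definition Eor a b := EIf a (ENum 1) (EIf b (ENum 1) (ENum 0)).
Definition Elt a b := EIf (ESub b a) (ENum 1) (ENum 0).
Definition Eeq a b := EIf (EAdd (ESub a b) (ESub b a)) (ENum 0) (ENum 1).
Definition Eall n b :=
  EFold n (ENum 1) (EIf (EVar 0) (EIf b (ENum 1) (ENum 0)) (ENum 0)).
Definition Ehas n b :=
  EFold n (ENum 0) (EIf (EVar 0) (ENum 1) (EIf b (ENum 1) (ENum 0))).

Lemma nat_of_bool_neq0 (b : bool) : ((b : nat) != 0) = b.
Proof. by case: b. Qed.

Section BooleanExpressions.
Variables (g M : nat -> nat) (env args : seq nat).
Local Notation ev := (peval g M env args).
Local Notation ev0 := (peval g M env [::]).

Lemma peval_not a : ev (Enot a) = (ev0 a == 0).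
Proof. by rewrite !pevalE; case: eqP. Qed.
Lemma peval_and a b : ev (Eand a b) = (ev0 a != 0) && (ev0 b != 0).
Proof. by rewrite !pevalE; case: eqP => //=; case: eqP. Qed.
Lemma peval_or a b : ev (Eor a b) = (ev0 a != 0) || (ev0 b != 0).
Proof. by rewrite !pevalE; case: eqP => //=; case: eqP. Qed.
Lemma peval_lt a b : ev (Elt a b) = (ev0 a < ev0 b).
Proof. by rewrite !pevalE subn_eq0 -ltnNge; case: ltnP. Qed.
Lemma peval_eq a b : ev (Eeq a b) = (ev0 a == ev0 b).
Proof. by rewrite !pevalE addn_eq0 !subn_eq0 -eqn_leq; case: eqP. Qed.

(** The body is evaluated only while the accumulator is still 1, so variable 0 can be fixed to 1 in
    its environment; dually, it is 0 in [peval_has]. *)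
Lemma peval_all n b : ev (Eall n b) =
  all (fun i => peval g M [:: 1, i & env] [::] b != 0)
    (iota 0 (minn (ev0 n) (g 1))).
Proof.
rewrite peval_fold; elim: (minn _ _) => [|k IH]; first by rewrite pevalE.
rewrite -addn1 iotaD all_cat addn1 /= IH add0n andbT !pevalE /=.
by case: (all _ _) => //=; case: (_ != 0).
Qed.

Lemma peval_has n b : ev (Ehas n b) =
  has (fun i => peval g M [:: 0, i & env] [::] b != 0)
    (iota 0 (minn (ev0 n) (g 1))).
Proof.
rewrite peval_fold; elim: (minn _ _) => [|k IH]; first by rewrite pevalE.
rewrite -addn1 iotaD has_cat addn1 /= IH add0n orbF !pevalE /=.
by case: (has _ _) => //=; case: (_ != 0).
Qed.
End BooleanExpressions.

Definition pboolE := (nat_of_bool_neq0, peval_not, peval_and, peval_or, peval_lt,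
  peval_eq).

(** The loop runs over the first argument, which must therefore be the small one in every product.
    [locked] stops [pevalE] at calls, each function being rewritten by its own lemma. *)
Definition fn_mul : pexp := locked
  (EFold (EVar 0) (ENum 0) (EAdd (EVar 0) (EVar 3))).
Definition fn_pow2 : pexp := locked
  (EFold (EVar 0) (ENum 1) (EAdd (EVar 0) (EVar 0))).
Definition fn_half : pexp := locked
  (EFold (EVar 0) (ENum 0)
    (EIf (ESub (EVar 2) (EAdd (EAdd (EVar 0) (EVar 0)) (ENum 1)))
      (EAdd (EVar 0) (ENum 1)) (EVar 0))).
Definition fn_odd : pexp := locked
  (ESub (EVar 0) (EAdd (Ecall1 fn_half (EVar 0)) (Ecall1 fn_half (EVar 0)))).
Definition fn_bit : pexp := locked
  (Ecall1 fn_odd (EFold (EVar 1) (EVar 0) (Ecall1 fn_half (EVar 0)))).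

Lemma peval_mul g M a b : a <= g 1 -> peval g M [:: a; b] [::] fn_mul = a * b.
Proof.
move=> le_a; rewrite /fn_mul -lock peval_fold !pevalE /= (minn_idPl le_a).
by elim: a {le_a} => //= a ->; rewrite !pevalE /= mulSn addnC.
Qed.

Lemma peval_pow2 g M a : a <= g 1 -> peval g M [:: a] [::] fn_pow2 = 2 ^ a.
Proof.
move=> le_a; rewrite /fn_pow2 -lock peval_fold !pevalE /= (minn_idPl le_a).
by elim: a {le_a} => //= a ->; rewrite !pevalE /= expnS mul2n addnn.
Qed.

Lemma peval_half g M y : y <= g 1 -> peval g M [:: y] [::] fn_half = y./2.
Proof.
move=> le_y; rewrite /fn_half -lock peval_fold !pevalE /= (minn_idPl le_y).
(* The accumulator grows as long as [2 * acc + 1 < y], so it stops at [y./2], which [y] rounds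
   suffice to reach. *)
suff it k : iteri k (fun i acc => peval g M [:: acc, i, y & [::]] [::]
    (EIf (ESub (EVar 2) (EAdd (EAdd (EVar 0) (EVar 0)) (ENum 1)))
      (EAdd (EVar 0) (ENum 1)) (EVar 0))) 0 = minn k y./2.
  by rewrite it; lia.
elim: k => [|k /= ->]; first by rewrite min0n.
by rewrite !pevalE /=; case: ifP; lia.
Qed.

(** The alternative [y = 0] covers indices beyond the cap: when [Q = 0], the acceptance test looks
    up the axiom in a table that has no entry for it, and must read 0. *)
Lemma peval_bit g M y b : y <= g 1 -> b <= g 1 \/ y = 0 ->
  peval g M [:: y; b] [::] fn_bit = bit y b.
Proof.
move=> le_y hb; rewrite /fn_bit -lock /Ecall1 !pevalE peval_fold !pevalE /=.
have it k : iteri k (fun i acc => peval g M [:: acc, i, y, b & [::]] [::]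
    (EArg (EVar 0) (ECall fn_half))) y = iter k half y /\ iter k half y <= y.
  elim: k => [//|k [/= -> le_k]]; rewrite !pevalE /= peval_half; last by lia.
  by split=> //; lia.
have [-> le_k] := it (minn b (g 1)).
rewrite /fn_odd -lock /Ecall1 !pevalE /= peval_half; last by lia.
have -> : iter (minn b (g 1)) half y = iter b half y.
  case: hb => [/minn_idPl -> //|->].
  by have z k : iter k half 0 = 0 by [elim: k => //= k ->]; rewrite !z.
by rewrite /bit -[X in X - _]odd_double_half -addnn addnK.
Qed.

(** Each word is preceded by its length, so a word is located by skipping its predecessors. Those of
    [P] start at address 4, after [q], [s], the axiom and the size of [P]; those of [N] start one
    cell after the address in register 3. *)
Definition fn_wpos_step : pexp :=
  EAdd (EVar 0) (EAdd (EFetch (EVar 0)) (ENum 1)).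
Definition fn_wpos : pexp := locked
  (EIf (ESub (EReg 2) (EVar 0))
    (EFold (EVar 0) (ENum 4) fn_wpos_step)
    (EFold (ESub (EVar 0) (EReg 2)) (EAdd (EReg 3) (ENum 1)) fn_wpos_step)).

Definition fn_index : pexp := locked
  (EAdd (Ecall2 fn_mul (EAdd (EReg 5) (ENum 1))
    (EAdd (Ecall2 fn_mul (EAdd (EReg 5) (ENum 1))
      (EAdd (Ecall2 fn_mul (EReg 4) (EVar 0)) (EVar 1))) (EVar 2))) (EVar 3)).

Definition fn_set_bit : pexp := locked
  (Ecall2 fn_bit (EVar 0) (Ecall4 fn_index (EVar 1) (EVar 2) (EVar 3) (EVar 4))).
Definition fn_table_bit : pexp := locked
  (Ecall2 fn_bit (EVar 0)
    (Ecall4 fn_index (EAdd (EReg 6) (EVar 1)) (EVar 2) (EVar 3) (EVar 4))).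

Definition fn_all4 (cell : pexp) : pexp :=
  Eall (EReg 6) (Eall (EReg 4)
    (Eall (EAdd (EReg 5) (ENum 1)) (Eall (EAdd (EReg 5) (ENum 1)) cell))).

(* Inside [fn_all4], [A], [w], [i], [j] are the variables 7, 5, 3, 1. *)
Definition fn_leaf_test : pexp := locked
  (fn_all4 (Eeq
    (Ecall5 fn_set_bit (EVar 10) (EVar 7) (EVar 5) (EVar 3) (EVar 1))
    (EIf (Eeq (EVar 8) (ENum 1)) (ENum 0)
      (EIf (Eeq (EVar 8) (ENum 2))
        (Eand (Elt (EVar 3) (EVar 1))
          (Ecall5 fn_table_bit (EVar 10) (EVar 9) (EVar 5) (EVar 3) (EVar 1)))
        (Eand (Eeq (EVar 1) (EAdd (EVar 3) (ENum 1)))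
          (Eand (Elt (EVar 3) (EFetch (Ecall1 fn_wpos (EVar 5))))
            (Eeq (EFetch (EAdd (EAdd (Ecall1 fn_wpos (EVar 5)) (ENum 1)) (EVar 3)))
              (EVar 9)))))))).

Definition fn_node_test : pexp := locked
  (fn_all4
    (Eand (Eeq (Ecall5 fn_table_bit (EVar 10) (EVar 7) (EVar 5) (EVar 3) (EVar 1))
               (Ecall5 fn_table_bit (EVar 12) (EVar 7) (EVar 5) (EVar 3) (EVar 1)))
    (Eand (Eeq (Ecall5 fn_table_bit (EVar 11) (EVar 7) (EVar 5) (EVar 3) (EVar 1))
               (Ecall5 fn_table_bit (EVar 12) (EVar 7) (EVar 5) (EVar 3) (EVar 1)))
      (Eeq (Ecall5 fn_set_bit (EVar 12) (EVar 7) (EVar 5) (EVar 3) (EVar 1))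
        (EIf (Eeq (EVar 8) (ENum 6))
          (Ehas (EAdd (EReg 5) (ENum 1))
            (Eand (Ecall5 fn_set_bit (EVar 12) (EVar 9) (EVar 7) (EVar 5) (EVar 1))
                  (Ecall5 fn_set_bit (EVar 13) (EVar 9) (EVar 7) (EVar 1) (EVar 3))))
          (Eor (Ecall5 fn_set_bit (EVar 11) (EVar 7) (EVar 5) (EVar 3) (EVar 1))
            (Eand (Eeq (EVar 7) (EIf (Eeq (EVar 8) (ENum 4)) (EReg 7) (EVar 9)))
              (Ecall5 fn_set_bit (EVar 10) (EVar 7) (EVar 5) (EVar 3) (EVar 1))))))))).

Definition fn_accept_test : pexp := locked
  (Eand
    (fn_all4 (Eeq
      (Ecall5 fn_table_bit (EVar 8) (EVar 7) (EVar 5) (EVar 3) (EVar 1))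
      (Ecall5 fn_set_bit (EVar 8) (EVar 7) (EVar 5) (EVar 3) (EVar 1))))
  (Eand
    (Eall (EReg 2) (Ecall5 fn_table_bit (EVar 2) (EReg 7) (EVar 1) (ENum 0)
      (EFetch (Ecall1 fn_wpos (EVar 1)))))
    (Eall (EReg 4) (EIf (Elt (EVar 1) (EReg 2)) (ENum 1)
      (Enot (Ecall5 fn_table_bit (EVar 2) (EReg 7) (EVar 1) (ENum 0)
        (EFetch (Ecall1 fn_wpos (EVar 1))))))))).

Lemma eq_in_all4 Q m n (p p' : nat -> nat -> nat -> nat -> bool) :
  (forall A w i j, A < Q -> w < m -> i <= n -> j <= n -> p A w i j = p' A w i j) ->
  all4 Q m n p = all4 Q m n p'.
Proof.
move=> e; apply/all4P/all4P => h A w i j *; first by rewrite -e ?h.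
by rewrite e ?h.
Qed.

Section Tests.
Context {q s : nat} (S : 'I_q) (P N : seq (seq 'I_s)) (Q n : nat).
Variables (g M : nat -> nat).
Let W := P ++ N.
Let m := size W.

Definition words_ready : Prop :=
  forall w, w < m ->
    let a := peval g M [:: w] [::] fn_wpos in
    M a = size (word W w) /\
    forall i, i < size (word W w) ->
      M (a + 1 + i) = nth 0 [seq val b | b <- word W w] i.

Definition params_ready : Prop :=
  [/\ g 2 = size P, g 4 = m, g 5 = n, g 6 = Q & g 7 = S].

Definition cap_ready : Prop :=
  [/\ m <= g 1, n < g 1, Q <= g 1, nbits P N Q n <= g 1 & nstates P N Q n <= g 1].

Hypotheses (wordsP : words_ready) (paramsP : params_ready) (capP : cap_ready).
Hypothesis Qq : Q = 0 \/ Q = q.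
Hypothesis le_n : forall u, u \in W -> size u <= n.

Lemma peval_index A w i j :
  peval g M [:: A; w; i; j] [::] fn_index = index4 P N n A w i j.
Proof.
have [g2 g4 g5 g6 g7] := paramsP; have [mB nB _ _ _] := capP.
rewrite /fn_index -lock /Ecall2 !pevalE /= g4 g5 !peval_mul ?addn1 //.
by rewrite /index4 -/W -/m !(mulnC n.+1) (mulnC m).
Qed.

Lemma peval_set_bit y A w i j :
  y < nstates P N Q n -> A < Q -> w < m -> i <= n -> j <= n ->
  peval g M [:: y; A; w; i; j] [::] fn_set_bit = set_bit P N n y A w i j.
Proof.
move=> lt_y lt_A lt_w le_i le_j; have [_ _ _ bB yB] := capP.
rewrite /fn_set_bit -lock /Ecall2 /Ecall4 !pevalE /= peval_index peval_bit //.
  by lia.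
left; apply: leq_trans bB; apply: ltnW; apply: index4_lt => //; apply: leq_trans lt_A (leq_addr _ _).
Qed.

Lemma peval_table_bit y A w i j :
  y < nstates P N Q n -> A < Q \/ y = 0 -> w < m -> i <= n -> j <= n ->
  peval g M [:: y; A; w; i; j] [::] fn_table_bit = table_bit P N Q n y A w i j.
Proof.
move=> lt_y hA lt_w le_i le_j; have [_ _ _ bB yB] := capP.
have [g2 g4 g5 g6 g7] := paramsP.
rewrite /fn_table_bit -lock /Ecall2 /Ecall4 !pevalE /= peval_index g6 peval_bit //.
  by lia.
case: hA => [lt_A|->]; [left | by right].
by apply: leq_trans bB; apply: ltnW; apply: index4_lt => //; rewrite ltn_add2l.
Qed.

Lemma peval_all4 env cell : peval g M env [::] (fn_all4 cell) =
  all4 Q m n (fun A w i j =>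
    peval g M [:: 1, j, 1, i, 1, w, 1, A & env] [::] cell != 0).
Proof.
have [g2 g4 g5 g6 g7] := paramsP; have [mB nB QB _ _] := capP.
rewrite /fn_all4 peval_all pevalE /= g6 (minn_idPl QB) /all4; congr nat_of_bool.
apply: eq_all => A; rewrite peval_all pevalE /= g4 (minn_idPl mB) nat_of_bool_neq0.
apply: eq_all => w; rewrite peval_all !pevalE /= g5 addn1 (minn_idPl nB) nat_of_bool_neq0.
by apply: eq_all => i; rewrite peval_all !pevalE /= g5 addn1 (minn_idPl nB) nat_of_bool_neq0.
Qed.

Lemma letter_atE w i b : w < m ->
  ((i < M (peval g M [:: w] [::] fn_wpos)) &&
   (M (peval g M [:: w] [::] fn_wpos + 1 + i) == b)) = letter_at (word W w) i b.
Proof.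
move=> lt_w; have [-> e] := wordsP lt_w; rewrite /letter_at.
by case: ltnP => // /e ->.
Qed.

Lemma peval_leaf_test (b : nsym q s) y : y < nstates P N Q n ->
  peval g M [:: (nsym_code b).1; (nsym_code b).2; y] [::] fn_leaf_test =
  leaf_test P N Q n (nsym_code b).1 (nsym_code b).2 y.
Proof.
move=> lt_y; rewrite /fn_leaf_test -lock peval_all4; congr nat_of_bool.
apply: eq_in_all4 => A w i j lt_A lt_w le_i le_j.
have eQ : Q = q by case: Qq lt_A => ->.
rewrite /Ecall5 /Ecall1 !(pboolE, pevalE) /= peval_set_bit //.
have eqb (b1 b2 : bool) : ((b1 : nat) == b2) = (b1 == b2) by case: b1; case: b2.
case: b => [|B|b] /=.
- by rewrite -(eqb _ false).
- rewrite peval_table_bit //; last by left; rewrite eQ.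
  by rewrite nat_of_bool_neq0 eqb.
- by rewrite -letter_atE // addn1 eqb.
Qed.

Lemma peval_node_test (f : bsym q) y1 y2 y :
  y1 < nstates P N Q n -> y2 < nstates P N Q n -> y < nstates P N Q n ->
  peval g M [:: (bsym_code f).1; (bsym_code f).2; y1; y2; y] [::] fn_node_test =
  node_test S P N Q n (bsym_code f).1 (bsym_code f).2 y1 y2 y.
Proof.
move=> lt_y1 lt_y2 lt_y; rewrite /fn_node_test -lock peval_all4; congr nat_of_bool.
have [g2 g4 g5 g6 g7] := paramsP; have [mB nB QB _ _] := capP.
apply: eq_in_all4 => A w i j lt_A lt_w le_i le_j.
rewrite /Ecall5 !(pboolE, peval_has, pevalE) /= !(peval_set_bit, peval_table_bit) //; try by left.
rewrite g5 addn1 (minn_idPl nB).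
set h1 := has _ _.
have -> : h1 = span_cat n (set_bit P N n y1 A w) (set_bit P N n y2 A w) i j.
  apply: eq_in_has => k; rewrite mem_iota /= add0n ltnS => le_k.
  by rewrite !(pboolE, pevalE) /= !peval_set_bit // !nat_of_bool_neq0.
rewrite g7.
have eqb (b b' : bool) : ((b : nat) == b') = (b == b') by case: b; case: b'.
by case: f @h1 => [|B|] /=; rewrite ?nat_of_bool_neq0 !eqb //.
Qed.

Lemma peval_accept_test y : y < nstates P N Q n ->
  peval g M [:: y] [::] fn_accept_test = accept_test S P N Q n y.
Proof.
move=> lt_y; rewrite /fn_accept_test -lock !pboolE peval_all4.
have [g2 g4 g5 g6 g7] := paramsP; have [mB nB QB _ _] := capP.
rewrite !(peval_all, pboolE) !pevalE /= g2 g4 (minn_idPl mB).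
have mP : size P <= m by rewrite /m /W size_cat leq_addr.
(* With [Q = 0] there are no bits, hence a single state, and the lookups of the axiom fall under the
   case [y = 0] of [peval_table_bit]. *)
have Sy : S < Q \/ y = 0.
  case: Qq => e; last by left; rewrite e.
  by right; move: lt_y; rewrite /nstates /nbits e !muln0 expn0; lia.
have szW w : w < m -> size (word W w) <= n.
  by move=> lt_w; apply: le_n; apply: mem_nth.
rewrite (minn_idPl (leq_trans mP mB)) ?nat_of_bool_neq0.
congr (nat_of_bool (_ && (_ && _))).
- apply: eq_in_all4 => A w i j lt_A lt_w le_i le_j.
  rewrite /Ecall5 !(pboolE, pevalE) /= peval_set_bit // peval_table_bit //; last by left.
  by case: table_bit; case: set_bit.
- apply: eq_in_all => w; rewrite mem_iota /= add0n => lt_w.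
  have lt_wm : w < m by apply: leq_trans mP.
  rewrite /Ecall5 /Ecall1 !pevalE /= g7 (wordsP lt_wm).1 peval_table_bit ?szW //.
  by rewrite nat_of_bool_neq0.
- apply: eq_in_all => w; rewrite mem_iota /= add0n => lt_w.
  rewrite /Ecall5 /Ecall1 !(pboolE, pevalE) /= g7 g2 (wordsP lt_w).1.
  rewrite peval_table_bit ?szW //.
  by rewrite [size P <= w]leqNgt; case: (w < size P) => //=; case: table_bit.
Qed.

End Tests.

(** * Reading the meta-grammar *)

Definition pseq := foldr PSeq PSkip.

(** The product loops over the row number [r], which the cap bounds, and not over the row length,
    which grows with the meta-grammar. *)
Definition Ecell r z := EAdd (Ecall2 fn_mul r (EReg 10)) z.

(* Registers: 9 end L of the input, 10 row length V, 14 reading position,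
   15 remaining rules, 16 number of pending terms. *)
Definition scan_step : pcmd :=
  PIf (EReg 16)
    (pseq [::
      PIf (Elt (ENum 3) (EFetch (EReg 14)))
        (PAssign 16 (EAdd (EReg 16) (ENum 1)))
        (PSeq (PAssign 16 (ESub (EReg 16) (ENum 1)))
          (PIf (EReg 16) PSkip (PAssign 15 (ESub (EReg 15) (ENum 1)))));
      PAssign 14 (EAdd (EReg 14) (ENum 2))])
    (pseq [:: PAssign 14 (EAdd (EReg 14) (ENum 1)); PAssign 16 (ENum 1)]).

(** Insertion at the head of the list of occurrences, whose entry point is the slot of the
    nonterminal (register 18). *)
Definition link_var : pcmd :=
  PIf (EFetch (EReg 14)) PSkip
    (pseq [:: PAssign 18 (EAdd (EReg 9) (EFetch (EAdd (EReg 14) (ENum 1))));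
      PStore (Ecell (ENum 2) (EReg 14)) (EFetch (Ecell (ENum 2) (EReg 18)));
      PStore (Ecell (ENum 2) (EReg 18)) (EReg 14)]).

(** After a complete term, the innermost open node expects its right child, in the slot after its
    own address. It leaves the stack at once, the right child being the last. *)
Definition link_pop : pcmd :=
  PIf (EReg 16)
    (pseq [:: PAssign 17 (EAdd (EReg 16) (ENum 1));
      PAssign 16 (EFetch (Ecell (ENum 3) (EReg 16)))])
    (pseq [:: PAssign 17 (ENum 0); PAssign 15 (ESub (EReg 15) (ENum 1))]).

(* Register 16 is now the innermost node waiting for its right child and 17 the
   slot receiving the trees of the next term (0 before a rule). *)
Definition link_step : pcmd :=
  PIf (EReg 17)
    (pseq [::
      PStore (Ecell (ENum 1) (EReg 14)) (EReg 17);
      PIf (Elt (ENum 3) (EFetch (EReg 14)))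
        (pseq [:: PStore (Ecell (ENum 3) (EReg 14)) (EReg 16);
                  PAssign 16 (EReg 14); PAssign 17 (EReg 14)])
        (PSeq link_var link_pop);
      PAssign 14 (EAdd (EReg 14) (ENum 2))])
    (pseq [:: PAssign 17 (EAdd (EReg 9) (EFetch (EReg 14)));
              PAssign 14 (EAdd (EReg 14) (ENum 1))]).

Definition seg (M : nat -> nat) a (l : seq nat) : Prop :=
  forall i, i < size l -> M (a + i) = nth 0 l i.

Lemma seg_cat M a l1 l2 : seg M a (l1 ++ l2) <-> seg M a l1 /\ seg M (a + size l1) l2.
Proof.
split=> [h|[h1 h2] i].
  split=> i lt_i; first by rewrite h ?nth_cat ?lt_i // size_cat ltn_addr.
  by rewrite -addnA h ?size_cat ?ltn_add2l // nth_cat ltnNge leq_addr addKn.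
rewrite size_cat nth_cat => lt_i; case: ltnP => [/h1 //|le_i].
by rewrite -h2 ?ltn_subLR // -addnA subnKC.
Qed.

Lemma seg_cons M a x l : seg M a (x :: l) <-> M a = x /\ seg M a.+1 l.
Proof.
rewrite -[x :: l]cat1s seg_cat /= addn1; split=> -[h1 h2]; split=> //.
  by have := h1 0 isT; rewrite addn0.
by case=> // _; rewrite addn0.
Qed.

Lemma seg_agree n M M' a l : agree n M M' -> a + size l <= n -> seg M' a l -> seg M a l.
Proof. by move=> ag le_n h i lt_i; rewrite ag ?h //; lia. Qed.

Lemma size_term_code q s g (u : term q s 'I_g) : size (term_code u) = 2 * term_size u.
Proof. by elim: u => //= f l IHl r IHr; rewrite size_cat IHl IHr mulnS mulnDr. Qed.

Section Parsing.
Context {q s : nat} (MG : rtg q s).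
Notation nt := (rtg_nt MG).
Notation trm := (term q s 'I_nt).
Variables (M0 : nat -> nat) (L : nat).

Definition rules_code (rs : seq ('I_nt * trm)) : seq nat :=
  flatten [seq val r.1 :: term_code r.2 | r <- rs].

Definition pending_code (ps : seq trm) rs : seq nat :=
  flatten [seq term_code u | u <- ps] ++ rules_code rs.

Lemma pending_code_rule (X : 'I_nt) (u : trm) rs :
  pending_code [::] ((X, u) :: rs) = val X :: term_code u ++ rules_code rs.
Proof. by []. Qed.

Lemma pending_code_cons u ps rs :
  pending_code (u :: ps) rs = term_code u ++ pending_code ps rs.
Proof. by rewrite /pending_code /= catA. Qed.

(** The length of the input is not given, yet the rows are placed after it; hence this first pass.
    Counting the pending terms suffices to see where a rule ends, and a rule is discounted from
    register 15 only when its last term has been read. *)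
Definition scan_inv (g0 : nat -> nat) k (st : state) : Prop :=
  exists ps rs, [/\ seg M0 (regs st 14) (pending_code ps rs),
    regs st 14 + size (pending_code ps rs) = L,
    regs st 15 = size rs + (0 < size ps), regs st 16 = size ps
    & [/\ mem st = M0, (forall x, x \notin [:: 14; 15; 16] -> regs st x = g0 x)
        & k = L - regs st 14]].

Lemma scan_step_inv g0 k st : scan_inv g0 k st -> 0 < regs st 15 ->
  exists2 k', k' < k & scan_inv g0 k' (pden scan_step st).
Proof.
move=> [ps [rs [sg eL g15 g16 [eM g0P ek]]]] lt0.
have fr x : x \notin [:: 14; 15; 16] -> regs (pden scan_step st) x = g0 x.
  by move=> nx; rewrite pden_regs ?g0P //; move: nx; rewrite !inE /= !negb_or => /and3P[-> -> ->].
(* [c] is the code consumed by this step: one cell for the left-hand side of a rule, two for a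
   symbol. *)
suff [c [ps' [rs' [eps c0 [h14 h15 h16] hM]]]] : exists c ps' rs',
    [/\ pending_code ps rs = c ++ pending_code ps' rs', 0 < size c,
     [/\ regs (pden scan_step st) 14 = regs st 14 + size c,
      regs (pden scan_step st) 15 = size rs' + (0 < size ps') &
      regs (pden scan_step st) 16 = size ps'] & mem (pden scan_step st) = M0].
  move: sg eL; rewrite eps seg_cat size_cat => -[_ sg] eL.
  exists (L - regs (pden scan_step st) 14); first by rewrite ek h14; lia.
  by exists ps', rs'; split=> //; rewrite h14 -?addnA //.
case: st eM g15 g16 sg lt0 {g0P eL ek fr} => g M /= -> g15 g16 sg lt0.
case: ps g15 g16 sg => [|u ps] g15 g16 sg.
  case: rs g15 sg => [|[X u] rs] g15 sg; first by rewrite g15 in lt0.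
  exists [:: val X], [:: u], rs; split=> //.
  - by rewrite /pending_code /= cats0.
  - rewrite /scan_step /= ?(pdenE, pboolE, pevalE) /= g16 /= ?(pdenE, pevalE) /=.
    by rewrite g15 /= addn0 !addn1.
  - by rewrite /scan_step /= ?(pdenE, pboolE, pevalE) /= g16 /= ?(pdenE, pevalE) /=.
have u0 : M0 (g 14) = nth 0 (term_code u) 0.
  move: sg; rewrite /pending_code /= -catA seg_cat => -[sg _].
  by rewrite -[X in M0 X]addn0 sg // size_term_code; case: (u).
have stepE : pden scan_step (State g M0) = State (upd (if 3 < M0 (g 14) then
    upd g 16 (size ps).+2 else if 0 < size ps then upd g 16 (size ps)
    else upd (upd g 16 0) 15 (size rs)) 14 (g 14 + 2)) M0.
  rewrite /scan_step /= ?(pdenE, pboolE, pevalE) /= g16 /=.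
  case: ifP => _; rewrite ?(pdenE, pboolE, pevalE) /= ?g16 ?addn1 ?subn1 //=.
  rewrite lt0n; case: eqP => e0; rewrite ?(pdenE, pboolE, pevalE) /= ?g15 ?addn1 ?e0 //.
rewrite stepE {stepE lt0}; case: u u0 sg g15 g16 => [X|b|f l r] /= u0 sg g15 g16.
- exists [:: 0; val X], ps, rs; rewrite u0 /=; split=> //.
  by case: (posnP (size ps)) => [->|ps0]; split=> //=; rewrite ?addn0 ?g15 ?ps0.
- have -> : (3 < M0 (g 14)) = false by rewrite u0; case: (b).
  exists (term_code (Leaf b : trm)), ps, rs; split=> //.
  by case: (posnP (size ps)) => [->|ps0]; split=> //=; rewrite ?addn0 ?g15 ?ps0.
- have -> : (3 < M0 (g 14)) = true by rewrite u0; case: (f).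
  exists [:: (bsym_code f).1; (bsym_code f).2], [:: l, r & ps], rs; split=> //=.
  by rewrite /pending_code /= -!catA.
Qed.

Lemma run_scan B rs st s0 :
  simulates st s0 -> regs s0 1 = B -> regs s0 39 = 0 -> mem s0 = M0 ->
  seg M0 (regs s0 14) (rules_code rs) -> regs s0 14 + size (rules_code rs) = L ->
  regs s0 15 = size rs -> regs s0 16 = 0 ->
  run (While (guard 15 39) (pcompile nglob scan_step)) st
    (L * (pcbound B scan_step + 4) + 4)
    (fun st' => exists s', [/\ simulates st' s', mem s' = M0, regs s' 14 = L &
       forall x, x \notin [:: 14; 15; 16] -> regs s' x = regs s0 x]).
Proof.
move=> sim capB r39 m0 sg eL r15 r16.
have I0 : scan_inv (regs s0) (L - regs s0 14) s0.
  by exists [::], rs; split=> //; rewrite addn0.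
apply: (run_weaken (run_loop (B := B) (n := L) sim I0 _ _ _ _ _ _)) => //.
- exact: leq_subr.
- by move=> k st1 [? [? [_ _ _ _ [_ gP _]]]]; rewrite gP.
- move=> k st1 Is lt0; apply: scan_step_inv => //.
  by have [? [? [_ _ _ _ [_ g0P _]]]] := Is; move: lt0; rewrite [regs st1 39]g0P ?r39.
- move=> st' [k [s' [sim' [ps [rs' [_ eL' e15 _ [eM g0P _]]]]]]].
  rewrite [regs s' 39]g0P // r39 leqn0 e15 addn_eq0 => /andP[/nilP rs0 ps0].
  exists s'; split=> //; move: eL'; case: ps ps0 {e15} => // _.
  by rewrite rs0 /pending_code /= addn0.
Qed.
End Parsing.

(** * Linking the occurrences of nonterminals *)

Lemma all_In T (p : pred T) l x : all p l -> List.In x l -> p x.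
Proof. by elim: l => //= y l IH /andP[py /IH pl] [<-|/pl]. Qed.

Lemma In_cat T (x : T) l1 l2 : List.In x (l1 ++ l2) <-> List.In x l1 \/ List.In x l2.
Proof. by split=> h; [apply: List.in_app_or h | apply: List.in_or_app]. Qed.

Section Linking.
Context {q s : nat} (MG : rtg q s).
Notation nt := (rtg_nt MG).
Notation trm := (term q s 'I_nt).
Variables (M0 : nat -> nat) (L start : nat).
Let V := L + nt.

(* A token is the address of a subterm in the input, the subterm itself, and the
   slot that receives the trees it generates: the nonterminal [X] has slot
   [L + X], and the children of a node at [a] have slots [a] and [a + 1]. *)
Fixpoint term_tokens (a d : nat) (u : trm) : seq (nat * trm * nat) :=
  (a, u, d) ::
  match u with
  | Node _ l r =>
      term_tokens (a + 2) a l ++ term_tokens (a + 2 + 2 * term_size l) (a + 1) r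
  | _ => [::]
  end.

Fixpoint rule_tokens (a : nat) (rs : seq ('I_nt * trm)) :=
  if rs is (X, u) :: rs' then
    term_tokens (a + 1) (L + X) u ++ rule_tokens (a + 1 + 2 * term_size u) rs'
  else [::].

Fixpoint pending_tokens (a : nat) (ps : seq (nat * trm)) rs :=
  if ps is (d, u) :: ps' then
    term_tokens a d u ++ pending_tokens (a + 2 * term_size u) ps' rs
  else rule_tokens a rs.

Definition tokens := rule_tokens start (rtg_rules MG).

(** A symbol occupies two cells, so the slots [a] and [a + 1] of a node never meet those of another
    token. *)
Definition apart (x y : nat * trm * nat) : bool := x.1.1 + 2 <= y.1.1.

Lemma term_size_gt0 (u : trm) : 0 < term_size u.
Proof. by case: u. Qed.

Lemma term_tokens_range a d u x : List.In x (term_tokens a d u) ->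
  a <= x.1.1 /\ x.1.1 + 2 <= a + 2 * term_size u.
Proof.
elim: u a d => [X|b|f l IHl r IHr] a d /=.
- by move=> [<-|//] /=; lia.
- by move=> [<-|//] /=; lia.
move=> [<-|/In_cat[/IHl|/IHr]] /=; lia.
Qed.

Lemma allrelI T S (r : T -> S -> bool) l1 l2 :
  (forall x y, List.In x l1 -> List.In y l2 -> r x y) -> allrel r l1 l2.
Proof.
elim: l1 => //= x l1 IH h; rewrite allrel_consl IH ?andbT; last first.
  by move=> y z iy iz; apply: h => //; right.
have {}h y : List.In y l2 -> r x y by move=> iy; apply: h => //; left.
by elim: l2 h {IH} => //= y l2 IH h; rewrite h ?IH //; [move=> z iz; apply: h; right|left].
Qed.

Lemma allrel_In T S (r : T -> S -> bool) l1 l2 x y :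
  allrel r l1 l2 -> List.In x l1 -> List.In y l2 -> r x y.
Proof.
elim: l1 => //= z l1 IH; rewrite allrel_consl => /andP[al /IH h] [<-|/h] //.
exact: all_In al.
Qed.

Lemma term_tokens_apart a d u : pairwise apart (term_tokens a d u).
Proof.
elim: u a d => //= f l IHl r IHr a d; rewrite pairwise_cat IHl IHr /= !andbT.
apply/andP; split.
  suff : allrel apart [:: (a, Node f l r, d)]
    (term_tokens (a + 2) a l ++ term_tokens (a + 2 + 2 * term_size l) (a + 1) r).
    by rewrite allrel_consl andbT.
  apply: allrelI => x y [<-|//] /In_cat[/term_tokens_range|/term_tokens_range];
  rewrite /apart /=; lia.
apply: allrelI => x y /term_tokens_range ? /term_tokens_range; rewrite /apart; lia.
Qed.

Lemma rules_code_cons (X : 'I_nt) (u : trm) rs :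
  rules_code ((X, u) :: rs) = val X :: term_code u ++ rules_code rs.
Proof. by []. Qed.

Lemma rule_tokens_range a rs x : List.In x (rule_tokens a rs) ->
  a < x.1.1 /\ x.1.1 + 2 <= a + size (rules_code rs).
Proof.
elim: rs a => [//|[X u] rs IH a]; rewrite rules_code_cons /= size_cat size_term_code.
move=> /In_cat[/term_tokens_range|/IH]; last by lia.
by lia.
Qed.

Lemma rule_tokens_apart a rs : pairwise apart (rule_tokens a rs).
Proof.
elim: rs a => //= -[X u] rs IH a; rewrite pairwise_cat IH term_tokens_apart !andbT.
by apply: allrelI => x y /term_tokens_range ? /rule_tokens_range; rewrite /apart; lia.
Qed.

Lemma tokens_eq_or_apart x y : List.In x tokens -> List.In y tokens ->
  [\/ x = y, apart x y | apart y x].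
Proof.
have := rule_tokens_apart start (rtg_rules MG); rewrite -/tokens.
elim: tokens => //= z l IH /andP[az pl] [<-|xl] [<-|yl].
- exact: Or31.
- by apply: Or32; apply: all_In az yl.
- by apply: Or33; apply: all_In az xl.
- exact: IH.
Qed.

Lemma term_tokens_children a d u a' f l r d' :
  List.In (a', Node f l r, d') (term_tokens a d u) ->
  List.In (a' + 2, l, a') (term_tokens a d u) /\
  List.In (a' + 2 + 2 * term_size l, r, a' + 1) (term_tokens a d u).
Proof.
have hd b e v : List.In (b, v, e) (term_tokens b e v) by case: v => *; left.
elim: u a d => [X|b|f' l' IHl r' IHr] a d /=; [by case|by case|].
case=> [[<- _ -> -> _]|].
  by split; right; apply/In_cat; [left|right]; apply: hd.
by case/In_cat=> [/IHl|/IHr] [h1 h2]; split; right; apply/In_cat; auto.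
Qed.

Lemma rule_tokens_children a rs a' f l r d' :
  List.In (a', Node f l r, d') (rule_tokens a rs) ->
  List.In (a' + 2, l, a') (rule_tokens a rs) /\
  List.In (a' + 2 + 2 * term_size l, r, a' + 1) (rule_tokens a rs).
Proof.
elim: rs a => //= -[X u] rs IH a.
by case/In_cat=> [/term_tokens_children|/IH] [h1 h2]; split; apply/In_cat; auto.
Qed.

Lemma term_tokens_code M a d u x : seg M a (term_code u) ->
  List.In x (term_tokens a d u) -> seg M x.1.1 (term_code x.1.2).
Proof.
elim: u a d => [X|b|f l IHl r IHr] a d /= sg.
- by case=> [<-|//].
- by case=> [<-|//].
case=> [<- //|].
move: sg => /seg_cons[_ /seg_cons[_ /seg_cat[]]].
rewrite size_term_code -[a.+2]addn2 => sl sr.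
by case/In_cat=> [/(IHl _ _ sl)|/(IHr _ _ sr)].
Qed.

Lemma rule_tokens_code M a rs x : seg M a (rules_code rs) ->
  List.In x (rule_tokens a rs) -> seg M x.1.1 (term_code x.1.2).
Proof.
elim: rs a => [//|[X u] rs IH a]; rewrite rules_code_cons seg_cons seg_cat.
rewrite -addn1 size_term_code => -[_ [su sr]] /In_cat[]; last exact: IH.
exact: term_tokens_code.
Qed.

Lemma term_tokens_dst a d u x : List.In x (term_tokens a d u) ->
  x = (a, u, d) \/ exists p f l r d', List.In (p, Node f l r, d') (term_tokens a d u) /\
    (x.2 = p /\ x.1.2 = l \/ x.2 = p + 1 /\ x.1.2 = r).
Proof.
elim: u a d => [X|b|f l IHl r IHr] a d /=; [by case=> [<-|//]; left|by case=> [<-|//]; left|].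
case=> [<-|/In_cat[/IHl|/IHr]]; first by left.
- case=> [->|[p [f' [l' [r' [d' [h1 h2]]]]]]]; right.
    by exists a, f, l, r, d; split; left.
  by exists p, f', l', r', d'; split=> //; right; apply/In_cat; left.
- case=> [->|[p [f' [l' [r' [d' [h1 h2]]]]]]]; right.
    by exists a, f, l, r, d; split; [left|right].
  by exists p, f', l', r', d'; split=> //; right; apply/In_cat; right.
Qed.

Lemma rule_tokens_dst a rs x : List.In x (rule_tokens a rs) ->
  (exists2 X : 'I_nt, x.2 = L + X & List.In (X, x.1.2) rs) \/
  exists p f l r d', List.In (p, Node f l r, d') (rule_tokens a rs) /\
    (x.2 = p /\ x.1.2 = l \/ x.2 = p + 1 /\ x.1.2 = r).
Proof.
elim: rs a => //= -[X u] rs IH a /In_cat[/term_tokens_dst|/IH].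
  case=> [->|[p [f' [l' [r' [d' [h1 h2]]]]]]]; [left|right].
    by exists X => //; left.
  by exists p, f', l', r', d'; split=> //; apply/In_cat; left.
case=> [[Y e i]|[p [f' [l' [r' [d' [h1 h2]]]]]]]; [left|right].
  by exists Y => //; right.
by exists p, f', l', r', d'; split=> //; apply/In_cat; right.
Qed.

Lemma rule_tokens_root a rs (X : 'I_nt) u : List.In (X, u) rs ->
  exists a', List.In (a', u, L + X) (rule_tokens a rs).
Proof.
elim: rs a => //= -[Y v] rs IH a [[-> ->]|/IH h].
  by exists (a + 1); apply/In_cat; left; case: (u) => *; left.
by have [a' i] := h (a + 1 + 2 * term_size v); exists a'; apply/In_cat; right.
Qed.


Definition is_var (X : 'I_nt) (x : nat * trm * nat) : bool :=
  if x.1.2 is Var Y then Y == X else false.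

(** Latest first, because [link_var] inserts at the head. *)
Definition occurrences (X : 'I_nt) (dn : seq (nat * trm * nat)) : seq nat :=
  [seq x.1.1 | x <- rev dn & is_var X x].

Fixpoint chain (next : nat -> nat) (z : nat) (l : seq nat) : Prop :=
  if l is a :: l' then next z = a /\ chain next a l' else next z = 0.

(** Only right children wait on the stack. The links decrease strictly below the reading position
    [b], so pushing a node at [b] does not disturb them; 0 can end the stack because no token has
    address 0. *)
Fixpoint stack (next : nat -> nat) (b z : nat) (ps : seq (nat * trm)) : Prop :=
  if ps is (d, _) :: ps' then [/\ 0 < z < b, d = z + 1 & stack next z (next z) ps']
  else z = 0.

(* Rows of length V after the input: destination slots of the tokens, chains of
   the occurrences of each nonterminal, stack links (then the facts). *)
Definition cell_at (M : nat -> nat) r z := M (r * V + z).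

(** [rows_token] and [rows_link] are converses of the preceding clauses: a nonzero cell certifies a
    token, or membership in a chain, which justifies the tests for zero in the program. [rows_zero]
    makes the table of facts start empty. *)
Record rows_ok (dn : seq (nat * trm * nat)) (M : nat -> nat) : Prop := RowsOk {
  rows_input : agree V M M0;
  rows_dst : forall a u d, List.In (a, u, d) dn -> cell_at M 1 a = d;
  rows_token : forall z, z < V -> cell_at M 1 z != 0 -> exists u d, List.In (z, u, d) dn;
  rows_chain : forall X : 'I_nt, chain (cell_at M 2) (L + X) (occurrences X dn);
  rows_link : forall z, z < V -> cell_at M 2 z != 0 ->
    exists X : 'I_nt, z \in L + X :: occurrences X dn;
  rows_zero : forall x, 4 * V <= x -> M x = 0 }.

(** The ghost lists are the tokens already linked, the pending terms with their destinations, and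
    the rules left. The first destination is in register 17, and the others are recovered from the
    stack. *)
Definition link_inv (g0 : nat -> nat) k (st : state) : Prop :=
  exists dn ps rs, let g := regs st in let M := mem st in
  [/\ tokens = dn ++ pending_tokens (g 14) ps rs,
      seg M0 (g 14) (pending_code [seq p.2 | p <- ps] rs) /\
      g 14 + size (pending_code [seq p.2 | p <- ps] rs) = L,
      g 15 = size rs + (0 < size ps),
      (if ps is (d, _) :: ps' then
         [/\ g 17 = d, 0 < d & stack (cell_at M 3) (g 14) (g 16) ps']
       else g 17 = 0 /\ g 16 = 0)
    & [/\ rows_ok dn M, (forall x, x \notin [:: 14; 15; 16; 17; 18] -> g x = g0 x)
        & k = L - g 14]].

Lemma rows_ok_start M : agree V M M0 -> (forall x, V <= x -> M x = 0) -> rows_ok [::] M.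
Proof.
move=> ag z0; have r0 r z : 0 < r -> cell_at M r z = 0.
  by move=> r_gt0; rewrite /cell_at z0 //; case: r r_gt0 => // r _; rewrite mulSn -addnA leq_addr.
split=> //.
- by move=> z lt_z; rewrite r0.
- by move=> X; rewrite /= r0.
- by move=> z lt_z; rewrite r0.
- by move=> x le_x; apply: z0; lia.
Qed.

Lemma In_occurrences X dn a :
  List.In a (occurrences X dn) <-> exists d, List.In (a, Var X, d) dn.
Proof.
rewrite /occurrences; elim/last_ind: dn => [|dn [[a' u] d] IH].
  by split=> [|[]].
rewrite rev_rcons /= -cats1.
have eqI b : (if is_var X (a', u, d) then List.In a (a' :: b) else List.In a b) <->
    (u = Var X /\ a' = a) \/ List.In a b.
  rewrite /is_var /=; case: u => [Y|c|f l r]; [|by split=> [|[[]|]]; auto|by split=> [|[[]|]]; auto].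
  by case: eqP => [->|ne] /=; split; [case; auto|case=> [[]|]; auto|auto|case=> [[[]]|]].
have -> : List.In a [seq x.1.1 | x <- if is_var X (a', u, d)
    then (a', u, d) :: [seq x <- rev dn | is_var X x]
    else [seq x <- rev dn | is_var X x]] <-> (u = Var X /\ a' = a) \/
    List.In a [seq x.1.1 | x <- [seq x <- rev dn | is_var X x]].
  by rewrite -eqI; case: ifP.
rewrite IH; split.
  case=> [[-> ->]|[d' i]]; first by exists d; apply/In_cat; right; left.
  by exists d'; apply/In_cat; left.
by case=> d' /In_cat[i|[[-> -> _]|//]]; [right; exists d'|left].
Qed.

Lemma mem_InP (l : seq nat) a : (a \in l) <-> List.In a l.
Proof.
elim: l => //= b l IH; rewrite inE; split=> [/predU1P[->|/IH]|[->|/IH ->]]; auto.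
  by rewrite eqxx.
by rewrite orbT.
Qed.

Lemma chain_eq next next' z l : (forall a, a \in z :: l -> next' a = next a) ->
  chain next z l -> chain next' z l.
Proof.
elim: l z => [|a l IH] z e /=; first by rewrite e ?inE.
move=> [ez ch]; rewrite e ?mem_head //; split=> //; apply: IH => // b bl.
by apply: e; rewrite inE bl orbT.
Qed.

Lemma stack_eq next next' b z ps : (forall a, a < b -> next' a = next a) ->
  stack next b z ps -> stack next' b z ps.
Proof.
elim: ps b z => //= -[d u] ps IH b z e [/andP[z0 zb] -> st].
rewrite z0 zb e //; split=> //; apply: IH st => a lt_a; apply: e.
exact: ltn_trans zb.
Qed.

Lemma stack_widen next b b' z ps : b <= b' -> stack next b z ps -> stack next b' z ps.
Proof.
by move=> le_b; case: ps => //= -[d u] ps [/andP[-> zb] -> st]; rewrite (leq_trans zb).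
Qed.

Lemma occurrences_rcons X dn x : occurrences X (rcons dn x) =
  if is_var X x then x.1.1 :: occurrences X dn else occurrences X dn.
Proof. by rewrite /occurrences rev_rcons /=; case: ifP. Qed.

Lemma occurrences_lt X dn a b :
  (forall b v e, List.In (b, v, e) dn -> b < a) -> b \in occurrences X dn -> b < a.
Proof. by move=> lt_dn /mem_InP /In_occurrences[e /lt_dn]. Qed.

(** * Linking one more token *)

Section Extend.
Variables (dn : seq (nat * trm * nat)) (M M' : nat -> nat) (a : nat) (u : trm) (d : nat).
Hypotheses (okM : rows_ok dn M) (lt_a : a < L).
Hypothesis lt_dn : forall b v e, List.In (b, v, e) dn -> b < a.
Hypothesis agM : agree V M' M.
Hypothesis row1 : forall z, z < V -> cell_at M' 1 z = if z == a then d else cell_at M 1 z.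
Hypothesis row4 : forall x, 4 * V <= x -> M' x = M x.

Let lt_aV : a < V. Proof. exact: leq_trans lt_a (leq_addr _ _). Qed.

Lemma rows_dst_rcons b v e :
  List.In (b, v, e) (rcons dn (a, u, d)) -> cell_at M' 1 b = e.
Proof.
rewrite -cats1 => /In_cat[i|[[<- _ <-]|//]]; last by rewrite row1 ?eqxx.
have lt_b := lt_dn i; rewrite row1 ?(ltn_trans lt_b) // ltn_eqF //.
exact: rows_dst i.
Qed.

Lemma rows_token_rcons z : z < V -> cell_at M' 1 z != 0 ->
  exists v e, List.In (z, v, e) (rcons dn (a, u, d)).
Proof.
move=> lt_z; rewrite row1 // -cats1; have [->|_ nz] := eqVneq z a.
  by exists u, d; apply/In_cat; right; left.
by have [v [e i]] := rows_token okM lt_z nz; exists v, e; apply/In_cat; left.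
Qed.

Lemma occurrences_ltV (X : 'I_nt) z : z \in L + X :: occurrences X dn -> z < V.
Proof.
rewrite inE => /predU1P[->|/(occurrences_lt lt_dn) lt_z].
  by rewrite /V ltn_add2l.
exact: ltn_trans lt_aV.
Qed.

Lemma rows_ok_rcons : (forall X, ~~ is_var X (a, u, d)) ->
  (forall z, z < V -> cell_at M' 2 z = cell_at M 2 z) -> rows_ok (rcons dn (a, u, d)) M'.
Proof.
move=> nvar row2; split.
- exact: agree_trans agM (rows_input okM).
- exact: rows_dst_rcons.
- exact: rows_token_rcons.
- move=> X; rewrite occurrences_rcons (negbTE (nvar X)).
  apply: chain_eq (rows_chain okM X) => z /occurrences_ltV; exact: row2.
- move=> z lt_z; rewrite row2 // => /(rows_link okM lt_z)[X zX].
  by exists X; rewrite occurrences_rcons (negbTE (nvar X)).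
- by move=> x le_x; rewrite row4 // (rows_zero okM).
Qed.

Lemma rows_ok_rcons_var (X : 'I_nt) : u = Var X ->
  (forall z, z < V -> cell_at M' 2 z = if z == L + X then a
     else if z == a then cell_at M 2 (L + X) else cell_at M 2 z) ->
  rows_ok (rcons dn (a, u, d)) M'.
Proof.
move=> eu row2.
have lt_x (Y : 'I_nt) : L + Y < V by rewrite /V ltn_add2l.
split.
- exact: agree_trans agM (rows_input okM).
- exact: rows_dst_rcons.
- exact: rows_token_rcons.
- move=> Y; rewrite occurrences_rcons /is_var eu /=.
  have ch := rows_chain okM Y.
  have old (Z : 'I_nt) z : z \in occurrences Z dn -> cell_at M' 2 z = cell_at M 2 z.
    move=> /(occurrences_lt lt_dn) lt_z; rewrite row2 ?(ltn_trans lt_z) //.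
    by rewrite !ltn_eqF // (leq_trans (ltn_trans lt_z lt_a)) ?leq_addr.
  case: eqP => [eXY|neXY]; last first.
    apply: chain_eq ch => z; rewrite inE => /predU1P[->|]; last exact: old.
    rewrite row2 // eqn_add2l; case: eqP => [/val_inj e|_]; first by case: neXY.
    by rewrite gtn_eqF // (leq_trans lt_a) ?leq_addr.
  subst Y; rewrite /= row2 // eqxx; split=> //.
  have ea : cell_at M' 2 a = cell_at M 2 (L + X).
    by rewrite row2 // eqxx ltn_eqF // (leq_trans lt_a) ?leq_addr.
  case eo: (occurrences X dn) ch => [|b l] /= => [|[eb ch]]; rewrite ea //.
  by split=> //; apply: chain_eq ch => z; rewrite -eo; apply: old.
- move=> z lt_z; rewrite row2 //; have [->|_] := eqVneq z (L + X).
    by exists X; rewrite mem_head.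
  have [->|_ /(rows_link okM lt_z)[Y zY]] := eqVneq z a.
    by exists X; rewrite occurrences_rcons /is_var eu /= eqxx !inE eqxx orbT.
  exists Y; rewrite occurrences_rcons; case: ifP => // _.
  by move: zY; rewrite !inE => /orP[->|->]; rewrite ?orbT.
- by move=> x le_x; rewrite row4 // (rows_zero okM).
Qed.
End Extend.

Lemma peval_cell g M env r z : g 10 = V -> peval g M env [::] r <= g 1 ->
  peval g M env [::] (Ecell r z) = peval g M env [::] r * V + peval g M env [::] z.
Proof. by move=> g10 le_r; rewrite /Ecell /Ecall2 !pevalE /= peval_mul ?g10. Qed.

Lemma row_update M r z v r' z' : z < V -> z' < V ->
  cell_at (update M (r * V + z) v) r' z' = if (r' == r) && (z' == z) then v else cell_at M r' z'.
Proof.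
move=> lt_z lt_z'; rewrite /cell_at /update; congr (if _ then _ else _).
apply/eqP/andP => [e|[/eqP -> /eqP -> //]].
have V0 : 0 < V by apply: leq_ltn_trans lt_z.
have := congr1 (divn^~ V) e; rewrite !divnMDl // !divn_small // !addn0 => er.
by move: e; rewrite er => /addnI ->.
Qed.

Lemma update_row_lt M r z v x : x < r * V -> update M (r * V + z) v x = M x.
Proof. by move=> lt_x; rewrite updateN // ltn_eqF // (leq_trans lt_x) ?leq_addr. Qed.

Lemma update_row_ge M r z v x : z < V -> r.+1 * V <= x -> update M (r * V + z) v x = M x.
Proof. by move=> lt_z; rewrite mulSn => le_x; rewrite updateN //; lia. Qed.

Lemma link_step_inv g0 k st : g0 9 = L -> g0 10 = V -> 4 <= g0 1 -> 0 < L -> 0 < start ->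
  link_inv g0 k st -> 0 < regs st 15 ->
  exists2 k', k' < k & link_inv g0 k' (pden link_step st).
Proof.
move=> g09 g010 g01 L0 start0 [dn [ps [rs /= [etok [sg eL] g15 g17 [okM gP ek]]]]] lt0.
have fr x : x \notin [:: 14; 15; 16; 17; 18] -> regs (pden link_step st) x = g0 x.
  move=> nx; rewrite -gP // pden_regs //; apply: contraNN nx.
  by rewrite !inE; do !case/orP; move=> /eqP ->.
suff [c [dn' [ps' [rs' [eps c0 etok' [h14 h15] [h17 okM']]]]]] : exists c dn' ps' rs',
    let g := regs (pden link_step st) in let M := mem (pden link_step st) in
    [/\ pending_code [seq p.2 | p <- ps] rs = c ++ pending_code [seq p.2 | p <- ps'] rs',
      0 < size c, tokens = dn' ++ pending_tokens (g 14) ps' rs',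
      g 14 = regs st 14 + size c /\ g 15 = size rs' + (0 < size ps') &
      (if ps' is (d, _) :: ps'' then
         [/\ g 17 = d, 0 < d & stack (cell_at M 3) (g 14) (g 16) ps'']
       else g 17 = 0 /\ g 16 = 0) /\ rows_ok dn' M].
  move: sg eL; rewrite eps seg_cat size_cat => -[_ sg] eL.
  exists (L - regs (pden link_step st) 14); first by rewrite ek h14; lia.
  exists dn', ps', rs'; split=> //; split; rewrite h14 -?addnA //.
have g9 : regs st 9 = L by rewrite gP.
have g10 : regs st 10 = V by rewrite gP.
have g1 : 4 <= regs st 1 by rewrite gP.
case: st sg eL g15 g17 okM etok lt0 g9 g10 g1 {gP ek fr} => g M /=.
set ip := g 14 => sg eL g15 g17 okM etok lt0 g9 g10 g1.
case: ps sg eL g15 g17 etok => [|[d u] ps] sg eL g15 g17 etok.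
  case: rs sg eL g15 etok => [|[X u] rs] sg eL g15 etok; first by rewrite g15 in lt0.
  have [g17' g16] := g17.
  have -> : pden link_step (State g M) = State (upd (upd g 17 (L + M ip)) 14 (ip + 1)) M.
    by rewrite /link_step /= ?(pdenE, pboolE, pevalE) /= g17' /= ?(pdenE, pevalE) /= g9.
  have lt_ip : ip < V.
    by move: eL; rewrite pending_code_rule /V /=; lia.
  have eip : M ip = X.
    rewrite (rows_input okM) //; move: sg; rewrite pending_code_rule.
    by move=> /seg_cons[].
  exists [:: val X], dn, [:: (L + X, u)], rs; split=> //=.
  - by rewrite /pending_code /= cats0.
  - by split=> //; rewrite g15 /= addn0 addn1.
  - by rewrite eip g16; split=> //; split=> //; lia.
have {g17} [g17 d0 stk] := g17.
have szu := term_size_gt0 u.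
have lt_ip : ip < L.
  by move: eL; rewrite pending_code_cons size_cat size_term_code -[(d, u).2]/u; lia.
have lt_ipV : ip < V by rewrite (leq_trans lt_ip) ?leq_addr.
(* Tokens are listed in reading order, so those already linked end before [ip]. *)
have lt_dn b v e : List.In (b, v, e) dn -> b < ip.
  have := rule_tokens_apart start (rtg_rules MG); rewrite -/tokens etok pairwise_cat.
  move=> /andP[al _] i; suff : apart (b, v, e) (ip, u, d) by rewrite /apart /=; lia.
  by apply: allrel_In al i _ => /=; case: (u) => *; left.
have ip0 : 0 < ip.
  have [] := @rule_tokens_range start (rtg_rules MG) (ip, u, d); last by rewrite /=; lia.
  by rewrite -/tokens etok; apply/In_cat; right; apply/In_cat; left; case: (u) => *; left.
have sgu : seg M0 ip (term_code u).
  by move: sg; rewrite pending_code_cons => /seg_cat[].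
have eM x : x < V -> M x = M0 x by apply: (rows_input okM).
pose M1 := update M (1 * V + ip) d.
have eM1 x : x < V -> M1 x = M x by move=> lt_x; rewrite /M1 update_row_lt ?mul1n.
have row1 z : z < V -> cell_at M1 1 z = if z == ip then d else cell_at M 1 z.
  by move=> lt_z; rewrite /M1 row_update.
have rowN r z : r != 1 -> z < V -> cell_at M1 r z = cell_at M r z.
  by move=> r1 lt_z; rewrite /M1 row_update // (negbTE r1).
have row4 x : 4 * V <= x -> M1 x = M x.
  by move=> le_x; rewrite /M1 update_row_ge //; lia.
have c0 : M1 ip = nth 0 (term_code u) 0.
  rewrite eM1 // eM // -[X in M0 X]addn0 sgu //.
  by rewrite size_term_code; lia.
have start_step : pden link_step (State g M) =
    pden (PAssign 14 (EAdd (EReg 14) (ENum 2)))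
      (pden (PIf (Elt (ENum 3) (EFetch (EReg 14)))
        (pseq [:: PStore (Ecell (ENum 3) (EReg 14)) (EReg 16);
                  PAssign 16 (EReg 14); PAssign 17 (EReg 14)])
        (PSeq link_var link_pop)) (State g M1)).
  rewrite /link_step pden_if peval0_state pevalE /= g17 -lt0n d0.
  rewrite pden_seq pden_store !peval0_state peval_cell //=; last by rewrite pevalE; lia.
  by rewrite !pevalE /= g17.
(* Leaves and nonterminals both complete a term, after which [link_pop] finds the place of the next
   one; they differ only in the rows that they leave behind. *)
have fin g2 M2 c : (forall x, x != 18 -> g2 x = g x) ->
    rows_ok (rcons dn (ip, u, d)) M2 ->
    (forall z, z < V -> cell_at M2 3 z = cell_at M 3 z) -> term_code u = c -> size c = 2 ->
    (term_tokens ip d u = [:: (ip, u, d)]) ->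
    pden link_step (State g M) = pden (PAssign 14 (EAdd (EReg 14) (ENum 2)))
      (pden link_pop (State g2 M2)) ->
    exists c dn' ps' rs',
    let g' := regs (pden link_step (State g M)) in
    let M' := mem (pden link_step (State g M)) in
    [/\ pending_code [seq p.2 | p <- (d, u) :: ps] rs =
         c ++ pending_code [seq p.2 | p <- ps'] rs',
      0 < size c, tokens = dn' ++ pending_tokens (g' 14) ps' rs',
      g' 14 = ip + size c /\ g' 15 = size rs' + (0 < size ps') &
      (if ps' is (d, _) :: ps'' then
         [/\ g' 17 = d, 0 < d & stack (cell_at M' 3) (g' 14) (g' 16) ps'']
       else g' 17 = 0 /\ g' 16 = 0) /\ rows_ok dn' M'].
  move=> g2P ok2 row3 ec szc tk ->.
  exists c, (rcons dn (ip, u, d)), ps, rs.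
  have e14 : g2 14 = ip by rewrite g2P.
  have tk2 : tokens = rcons dn (ip, u, d) ++ pending_tokens (ip + 2) ps rs.
    rewrite etok /= tk cat_rcons; congr (_ ++ _ :: pending_tokens (_ + _) _ _).
    by rewrite -size_term_code ec szc.
  have epc : pending_code [seq p.2 | p <- (d, u) :: ps] rs =
      c ++ pending_code [seq p.2 | p <- ps] rs.
    by rewrite pending_code_cons ec.
  case: ps stk {sg eL etok} g15 tk2 epc => [|[e v] ps] stk g15 tk2 epc.
    have g16 : g 16 = 0 := stk.
    have -> : pden (PAssign 14 (EAdd (EReg 14) (ENum 2)))
        (pden link_pop (State g2 M2)) =
        State (upd (upd (upd g2 17 0) 15 (size rs)) 14 (ip + 2)) M2.
      rewrite /link_pop pden_if peval0_state pevalE /= g2P // g16.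
      by rewrite ?(pdenE, pevalE) /= ?(pdenE, pevalE) /= e14 !g2P // g15 addn1 subn1.
    by rewrite szc /= g2P // g16 addn0.
  case: stk => /andP[z0 zb] ez stk.
  have zV : g 16 < V by apply: ltn_trans lt_ipV.
  have -> : pden (PAssign 14 (EAdd (EReg 14) (ENum 2)))
      (pden link_pop (State g2 M2)) =
      State (upd (upd (upd g2 17 (g 16 + 1)) 16 (cell_at M2 3 (g 16))) 14 (ip + 2)) M2.
    rewrite /link_pop pden_if peval0_state pevalE /= g2P // -lt0n z0.
    rewrite pden_seq pden_assign peval0_state !pevalE /= pden_seq pden_assign !peval0_state.
    rewrite pevalE peval_cell /= ?g2P // !pevalE /= ?g2P //; last by lia.
    by rewrite pden_skip pden_assign peval0_state !pevalE /= e14.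
  rewrite szc /=; split=> //; last first.
    split=> //; split; rewrite ?ez ?addn1 // row3 //.
    apply: (stack_widen (b := g 16)); first by lia.
    apply: (stack_eq (next := cell_at M 3)) stk => a lt_a.
    by apply: row3; apply: ltn_trans zV.
  by rewrite g2P.
have lt3 : peval g M1 [::] [::] (Elt (ENum 3) (EFetch (EReg 14))) = (3 < M1 ip).
  by rewrite !(pboolE, pevalE).
have leaf_step : M1 ip <= 3 -> pden link_step (State g M) =
    pden (PAssign 14 (EAdd (EReg 14) (ENum 2)))
      (pden link_pop (pden link_var (State g M1))).
  by move=> le3; rewrite start_step pden_if peval0_state lt3 ltnNge le3 /= pden_seq.
case: u g15 okM etok {sg eL} szu lt_dn sgu row1 c0 start_step fin leaf_step
  => [X|b|f l r] /= g15 okM etok szu lt_dn sgu row1 c0 start_step fin leaf_step.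
- have lt_X : L + X < V by rewrite /V ltn_add2l.
  have ipX : (ip == L + X) = false by rewrite ltn_eqF // (leq_trans lt_ip) ?leq_addr.
  have ip1 : ip + 1 < V.
    by have := ltn_ord X; rewrite /V; lia.
  have eX : M1 (ip + 1) = X by rewrite eM1 // eM // sgu.
  pose M2 := update M1 (2 * V + ip) (cell_at M1 2 (L + X)).
  pose M3 := update M2 (2 * V + (L + X)) ip.
  apply: (fin (upd g 18 (L + X)) M3 [:: 0; val X]) => //.
  + by move=> x /= /negbTE ->.
  + have rowM3 r z : z < V -> cell_at M3 r z = if (r == 2) && (z == L + X) then ip
        else if (r == 2) && (z == ip) then cell_at M 2 (L + X) else cell_at M1 r z.
      move=> lt_z; rewrite /M3 row_update // /M2 row_update //.
      by case: ifP => // _; case: ifP => // _; rewrite rowN.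
    apply: (rows_ok_rcons_var okM lt_ip lt_dn _ _ _ (erefl _)).
    * by move=> x lt_x; rewrite /M3 /M2 !update_row_lt ?eM1 //; lia.
    * by move=> z lt_z; rewrite rowM3 //= row1.
    * by move=> x le_x; rewrite /M3 /M2 !update_row_ge ?row4 //; lia.
    * by move=> z lt_z; rewrite rowM3 //=; case: ifP => // _; case: ifP => // _; rewrite rowN.
  + by move=> z lt_z; rewrite /M3 /M2 !row_update //= rowN.
  + rewrite leaf_step ?c0 //; congr (pden _ (pden _ _)).
    rewrite /link_var pden_if peval0_state !pevalE /= c0 /=.
    rewrite !pden_seq pden_assign peval0_state !pevalE /= g9 eX.
    rewrite pden_store !peval0_state pevalE !peval_cell /= ?pevalE /= ?pevalE //; [|lia|lia].
    by rewrite pden_store !peval0_state !peval_cell /= ?pevalE /= ?pevalE ?pden_skip //; lia.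
- apply: (fin g M1 (term_code (Leaf b : trm))) => //.
  + apply: (rows_ok_rcons okM lt_ip lt_dn _ row1 row4) => //.
    by move=> z lt_z; rewrite rowN.
  + by move=> z lt_z; rewrite rowN.
  + rewrite leaf_step ?c0; last by case: (b).
    congr (pden _ (pden _ _)).
    by rewrite /link_var pden_if peval0_state !pevalE /= c0; case: (b).
(* A node is pushed: its left child goes to slot [ip], and its presence on the stack recalls that
   the right child goes to [ip + 1]. *)
- pose M2 := update M1 (3 * V + ip) (g 16).
  have -> : pden link_step (State g M) =
      State (upd (upd (upd g 16 ip) 17 ip) 14 (ip + 2)) M2.
    rewrite start_step pden_if peval0_state lt3 c0.
    have -> /= : 3 < (bsym_code f).1 by case: (f).
    by rewrite !pden_seq pden_store !peval0_state peval_cell //= ?pevalE; lia.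
  exists [:: (bsym_code f).1; (bsym_code f).2], (rcons dn (ip, Node f l r, d)),
    [:: (ip, l), (ip + 1, r) & ps], rs => /=; split=> //.
  + by rewrite /pending_code /= !catA.
  + rewrite etok cat_rcons /= -!catA; congr (_ ++ _ :: _ ++ _ ++ pending_tokens _ _ _).
    by lia.
  + split.
      split=> //.
      split=> //; first by lia.
      rewrite -/(cell_at M2 3 ip) /M2 row_update // !eqxx.
      apply: (stack_eq (next := cell_at M 3)) => // a lt_a.
      have lt_aV : a < V by apply: ltn_trans lt_ipV.
      by rewrite row_update // (ltn_eqF lt_a) andbF rowN.
    apply: (rows_ok_rcons okM lt_ip lt_dn) => //.
    * by move=> x lt_x; rewrite /M2 update_row_lt ?eM1 //; lia.
    * by move=> z lt_z; rewrite /M2 row_update //= row1.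
    * by move=> x le_x; rewrite /M2 update_row_ge ?row4 //; lia.
    * by move=> z lt_z; rewrite /M2 row_update //= rowN.
Qed.

Lemma run_link B st s0 :
  simulates st s0 -> regs s0 1 = B -> regs s0 39 = 0 -> mem s0 = M0 ->
  (forall x, L <= x -> M0 x = 0) ->
  regs s0 9 = L -> regs s0 10 = V -> 4 <= B -> 0 < start -> regs s0 14 = start ->
  seg M0 start (rules_code (rtg_rules MG)) ->
  start + size (rules_code (rtg_rules MG)) = L ->
  regs s0 15 = size (rtg_rules MG) -> regs s0 16 = 0 -> regs s0 17 = 0 ->
  run (While (guard 15 39) (pcompile nglob link_step)) st
    (L * (pcbound B link_step + 4) + 4)
    (fun st' => exists s', [/\ simulates st' s', rows_ok tokens (mem s') &
       forall x, x \notin [:: 14; 15; 16; 17; 18] -> regs s' x = regs s0 x]).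
Proof.
move=> sim capB r39 m0 z0 r9 r10 B4 start0 r14 sg eL r15 r16 r17.
have I0 : link_inv (regs s0) (L - regs s0 14) s0.
  exists [::], [::], (rtg_rules MG); rewrite /= m0 r14 r15 addn0; split=> //.
  split=> //; apply: rows_ok_start => // x le_x; apply: z0; apply: leq_trans le_x.
  exact: leq_addr.
apply: (run_weaken (run_loop (B := B) (n := L) sim I0 _ _ _ _ _ _)) => //.
- exact: leq_subr.
- by move=> k st1 [? [? [? [_ _ _ _ [_ gP _]]]]]; rewrite gP.
- move=> k st1 Is lt0.
  have lt1 : 0 < regs st1 15.
    by have [? [? [? [_ _ _ _ [_ gP _]]]]] := Is; move: lt0; rewrite [regs st1 39]gP ?r39.
  by apply: (link_step_inv _ _ _ _ _ Is lt1); rewrite ?capB //; lia.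
- move=> st' [k [s' [sim' [dn [ps [rs [etok [_ eL'] e15 _ [okM gP _]]]]]]]].
  rewrite [regs s' 39]gP // r39 leqn0 e15 addn_eq0 => /andP[/nilP rs0 ps0].
  exists s'; split=> //; move: etok; case: ps ps0 {e15 eL'} => // _.
  by rewrite rs0 /= cats0 => ->.
Qed.
End Linking.

(** * Facts *)

(* A fact is a heap record (symbol, argument, left, right, slot), that is, a node
   of the linked representation of the tree it stands for, followed by the slot
   to which it belongs.  Register 12 is the end of the heap.  [derive] adds a
   fact for the state (register 21) at the slot (register 20) unless there is
   one already. *)
Definition derive : pcmd :=
  PIf (EFetch (Ecell (EAdd (ENum 4) (EReg 21)) (EReg 20))) PSkip
    (pseq [:: PStore (Ecell (EAdd (ENum 4) (EReg 21)) (EReg 20)) (EReg 12);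
      PStore (EReg 12) (EReg 22);
      PStore (EAdd (EReg 12) (ENum 1)) (EReg 23);
      PStore (EAdd (EReg 12) (ENum 2)) (EReg 24);
      PStore (EAdd (EReg 12) (ENum 3)) (EReg 25);
      PStore (EAdd (EReg 12) (ENum 4)) (EReg 20);
      PAssign 12 (EAdd (EReg 12) (ENum 5))]).

(** The copy is a new record at the new slot but shares the children of the original, so its cost
    does not depend on the size of the tree. *)
Definition copy_one : pcmd :=
  pseq [:: PAssign 28 (EFetch (Ecell (EAdd (ENum 4) (EReg 21)) (EReg 26)));
    PIf (EReg 28)
      (pseq [:: PAssign 20 (EReg 27); PAssign 22 (EFetch (EReg 28));
        PAssign 23 (EFetch (EAdd (EReg 28) (ENum 1)));
        PAssign 24 (EFetch (EAdd (EReg 28) (ENum 2)));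
        PAssign 25 (EFetch (EAdd (EReg 28) (ENum 3))); derive])
      PSkip].

Definition copy : pcmd := PFor 21 (EReg 8) copy_one.

Definition combine_one : pcmd :=
  PIf (Ecall5 fn_node_test (EFetch (EReg 29)) (EFetch (EAdd (EReg 29) (ENum 1)))
         (EReg 30) (EReg 32) (EReg 21))
    (pseq [:: PAssign 20 (EReg 27); PAssign 22 (EFetch (EReg 29));
      PAssign 23 (EFetch (EAdd (EReg 29) (ENum 1)));
      PAssign 24 (EReg 31); PAssign 25 (EReg 33); derive])
    PSkip.

Definition combine_right : pcmd :=
  PSeq (PAssign 33 (EFetch (Ecell (EAdd (ENum 4) (EReg 32)) (EAdd (EReg 29) (ENum 1)))))
    (PIf (EReg 33) (PFor 21 (EReg 8) combine_one) PSkip).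

Definition combine_left : pcmd :=
  PSeq (PAssign 31 (EFetch (Ecell (EAdd (ENum 4) (EReg 30)) (EReg 29))))
    (PIf (EReg 31) (PFor 32 (EReg 8) combine_right) PSkip).

(** All triples of states are tried again whenever a fact of either child is processed. The
    repetition stays polynomial in the cap and avoids any record of the pairs already met. *)
Definition combine : pcmd := PFor 30 (EReg 8) combine_left.

(** Row 1 is nonzero exactly at tokens. There, the slot is the left one of a node or an occurrence
    of a nonterminal; elsewhere it is the right slot of the node one cell before. The code 0 of a
    nonterminal then tells copying from combining. *)
Definition dispatch : pcmd :=
  pseq [::
    PIf (EFetch (Ecell (ENum 1) (EReg 26))) (PAssign 29 (EReg 26))
      (PAssign 29 (ESub (EReg 26) (ENum 1)));
    PAssign 27 (EFetch (Ecell (ENum 1) (EReg 29)));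
    PIf (EFetch (EReg 29)) combine copy].

(** A fact moves one link down its chain, from the slot [L + X] to the first occurrence or from one
    occurrence to the next, and also up to the destination of its token. Slots from [L] on belong to
    nonterminals and have no destination. *)
Definition process_step : pcmd :=
  pseq [:: PAssign 26 (EFetch (EAdd (EReg 13) (ENum 4)));
    PAssign 13 (EAdd (EReg 13) (ENum 5));
    PAssign 27 (EFetch (Ecell (ENum 2) (EReg 26)));
    PIf (EReg 27) copy PSkip;
    PIf (Elt (EReg 26) (EReg 9)) dispatch PSkip].

Definition leaf_one : pcmd :=
  PIf (Ecall3 fn_leaf_test (EFetch (EReg 14)) (EFetch (EAdd (EReg 14) (ENum 1)))
         (EReg 21))
    (pseq [:: PAssign 20 (EReg 27); PAssign 22 (EFetch (EReg 14));
      PAssign 23 (EFetch (EAdd (EReg 14) (ENum 1)));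
      PAssign 24 (ENum 0); PAssign 25 (ENum 0); derive])
    PSkip.

(** Register 14 runs over all addresses, second cells of symbols included; row 1 tells which are
    tokens, and the codes 1 to 3 are those of leaves. *)
Definition leaf_step : pcmd :=
  pseq [:: PAssign 27 (EFetch (Ecell (ENum 1) (EReg 14)));
    PIf (Eand (EReg 27) (Eand (EFetch (EReg 14)) (Elt (EFetch (EReg 14)) (ENum 4))))
      (PFor 21 (EReg 8) leaf_one) PSkip;
    PAssign 14 (EAdd (EReg 14) (ENum 1))].

Definition accept_one (y : pexp) : pcmd :=
  PIf (EFetch (Ecell (EAdd (ENum 4) y) (EAdd (EReg 9) (EFetch (EAdd (EReg 11) (ENum 1))))))
    (PIf (Ecall1 fn_accept_test y)
      (PAssign 0 (EFetch (Ecell (EAdd (ENum 4) y)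
         (EAdd (EReg 9) (EFetch (EAdd (EReg 11) (ENum 1))))))) PSkip) PSkip.

Definition accept : pcmd := PFor 21 (EReg 8) (accept_one (EReg 21)).

(** Confining the records to the cells from [lo] up to [hi] makes the representation insensitive to
    writes elsewhere, in particular to records appended later. *)
Fixpoint stored_in q s (M : nat -> nat) lo hi a (t : tree q s) : Prop :=
  lo <= a /\ a + 4 <= hi /\
  match t with
  | Var _ => False
  | Leaf b => (M a, M a.+1) = nsym_code b
  | Node f l r => [/\ (M a, M a.+1) = bsym_code f, stored_in M lo hi (M a.+2) l
        & stored_in M lo hi (M a.+3) r]
  end.

Lemma stored_in_stored q s M lo hi a (t : tree q s) :
  stored_in M lo hi a t -> stored M a t.
Proof.
elim: t a => [[]|b|f l IHl r IHr] a /=; first by case=> _ [].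
by case=> _ [_ [-> /IHl ? /IHr]].
Qed.

Lemma stored_in_eq q s M M' lo hi hi' a (t : tree q s) :
  (forall x, lo <= x < hi -> M' x = M x) -> hi <= hi' ->
  stored_in M lo hi a t -> stored_in M' lo hi' a t.
Proof.
move=> e le_hi; elim: t a => [[]|b|f l IHl r IHr] a /= [lo_a [a_hi]].
  by rewrite !e; [split=> //; split=> //; lia | lia | lia].
move=> [ef sl sr]; rewrite !e; [|lia|lia|lia|lia].
split=> //; split; first by lia.
by split=> //; [apply: IHl | apply: IHr].
Qed.

(** * Slots and the terms they stand for *)

Section Slots.
Context {q s : nat} (MG : rtg q s).
Notation nt := (rtg_nt MG).
Notation trm := (term q s 'I_nt).
Variables (L start : nat).
Let V := L + nt.
Notation TK := (tokens MG L start).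
Hypothesis end_rules : start + size (rules_code (rtg_rules MG)) = L.

(** The second argument is the term whose generated trees the slot collects. Each occurrence of a
    nonterminal has a slot of its own, besides that of the nonterminal, so that facts can travel
    along the chain. *)
Inductive slot : nat -> trm -> Prop :=
  | SlotLeft p f l r d : List.In (p, Node f l r, d) TK -> slot p l
  | SlotRight p f l r d : List.In (p, Node f l r, d) TK -> slot (p + 1) r
  | SlotVar a X d : List.In (a, Var X, d) TK -> slot a (Var X)
  | SlotNt (X : 'I_nt) : slot (L + X) (Var X).

Lemma token_range a u d : List.In (a, u, d) TK -> start < a /\ a + 2 <= L.
Proof. by move=> /rule_tokens_range /=; rewrite end_rules. Qed.

Lemma token_inj a u d u' d' :
  List.In (a, u, d) TK -> List.In (a, u', d') TK -> u = u' /\ d = d'.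
Proof.
move=> i i'; case: (tokens_eq_or_apart i i') => [[-> ->] //||]; rewrite /apart /=; lia.
Qed.

Lemma token_not_succ a u d u' d' :
  List.In (a, u, d) TK -> ~ List.In (a + 1, u', d') TK.
Proof.
move=> i i'; case: (tokens_eq_or_apart i i') => [[e _ _]||]; rewrite /apart /=; lia.
Qed.

Lemma slot_lt z u : slot z u -> z < V.
Proof.
rewrite /V; case=> [p f l r d /token_range|p f l r d /token_range|a X d /token_range|X];
  try by lia.
by rewrite ltn_add2l.
Qed.

Lemma slot_inj z u u' : slot z u -> slot z u' -> u = u'.
Proof.
have tk_nt a v d (X : 'I_nt) : List.In (a, v, d) TK -> a <> L + X /\ a + 1 <> L + X.
  by move=> /token_range; lia.
move=> h; case: h u' => {z u}[p f l r d i|p f l r d i|a X d i|X] u' h; inversion h; subst.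
- by have [[]] := token_inj i H.
- by case: (token_not_succ H i).
- by have [] := token_inj i H.
- by case: (tk_nt _ _ _ X i).
- by case: (token_not_succ i H).
- by have e := @addIn 1 _ _ H; subst; have [[]] := token_inj i H0.
- by case: (token_not_succ i H).
- by have := tk_nt _ _ _ X i; lia.
- by have [] := token_inj i H.
- by case: (token_not_succ H i).
- by have [] := token_inj i H.
- by have := tk_nt _ _ _ X0 i; lia.
- by have := tk_nt _ _ _ X H; lia.
- by have := tk_nt _ _ _ X H0; lia.
- by have := tk_nt _ _ _ X H; lia.
- by have /addnI/val_inj -> := H0.
Qed.

Lemma token_dst a u d : List.In (a, u, d) TK ->
  slot d u \/ exists2 X : 'I_nt, d = L + X & List.In (X, u) (rtg_rules MG).
Proof.
move=> /rule_tokens_dst[[X /= -> i]|[p [f [l [r [d' [i [[/= -> ->]|[/= -> ->]]]]]]]]].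
- by right; exists X.
- by left; apply: SlotLeft i.
- by left; apply: SlotRight i.
Qed.

Lemma token_dst_generates a u d t : List.In (a, u, d) TK -> generates u t ->
  (exists u', slot d u') /\ forall u', slot d u' -> generates u' t.
Proof.
move=> /token_dst[sl|[X -> i]] g.
  by split=> [|u' sl']; [exists u | rewrite -(slot_inj sl sl')].
split=> [|u' sl']; first by exists (Var X); apply: SlotNt.
by rewrite (slot_inj sl' (SlotNt X)); apply: GenVar i g.
Qed.

End Slots.

(** * Saturation *)

Definition fixed_regs := iota 1 11.

Section Saturation.
Context {q s : nat} (S : 'I_q) (P N : seq (seq 'I_s)) (Q n : nat) (MG : rtg q s).
Notation nt := (rtg_nt MG).
Notation trm := (term q s 'I_nt).
Variables (M0 Mp : nat -> nat) (L start : nat) (g0 : nat -> nat).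
Let V := L + nt.
Let D := nstates P N Q n.
Notation TK := (tokens MG L start).
Notation row := (cell_at MG L).
Notation slot := (@slot q s MG L start).
Let HB := (4 + D) * V.

Hypothesis end_rules : start + size (rules_code (rtg_rules MG)) = L.
Hypothesis rules_seg : seg M0 start (rules_code (rtg_rules MG)).
Hypothesis rowsP : rows_ok M0 L TK Mp.
Hypothesis g0_regs : [/\ g0 8 = D, g0 9 = L & g0 10 = V].
Hypothesis g0_params : params_ready S P N Q n g0.
Hypothesis g0_cap : cap_ready P N Q n g0.
Hypothesis cap4 : 4 + D <= g0 1.
Hypothesis wordsP : forall g M, (forall x, x \in fixed_regs -> g x = g0 x) ->
  agree L M M0 -> words_ready P N g M.
Hypothesis Qq : Q = 0 \/ Q = q.
Hypothesis L0 : 0 < L.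

Notation fact := (nat * nat * tree q s)%type.
Implicit Types (H : seq fact).

Definition fact0 : fact := (0, 0, Leaf End).

Definition fact_sound z y (t : tree q s) : Prop :=
  [/\ represents S P N Q n y t, (exists u, slot z u)
    & forall u, slot z u -> generates u t].

(** [H] lists the facts in heap order. Their trees are ghost data, as a record only holds a symbol,
    pointers and a slot. Uniqueness of the keys bounds the number of facts and makes the address of
    a record a function of its key. *)
Record sat_ok H (g M : nat -> nat) : Prop := SatOk {
  sat_fixed : forall x, x \in fixed_regs -> g x = g0 x;
  sat_tail : g 12 = HB + 5 * size H;
  sat_rows : agree (4 * V) M Mp;
  sat_table : forall y z, y < D -> z < V -> row M (4 + y) z != 0 ->
    exists i, [/\ i < size H, row M (4 + y) z = HB + 5 * i & (nth fact0 H i).1 = (z, y)];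
  sat_facts : forall i, i < size H -> let: (z, y, t) := nth fact0 H i in
    [/\ z < V, y < D, row M (4 + y) z != 0 & M (HB + 5 * i + 4) = z] /\
    stored_in M HB (HB + 5 * size H) (HB + 5 * i) t /\ fact_sound z y t;
  sat_uniq : uniq [seq x.1 | x <- H] }.

Definition keys H : seq (nat * nat) := [seq x.1 | x <- H].

Lemma mem_keys H i : i < size H -> (nth fact0 H i).1 \in keys H.
Proof. by move=> lt_i; rewrite -(nth_map fact0 (0, 0) fst) // mem_nth ?size_map. Qed.

Lemma keysP H x : x \in keys H -> exists2 i, i < size H & (nth fact0 H i).1 = x.
Proof.
move=> /(nthP (0, 0))[i]; rewrite size_map => lt_i.
by rewrite (nth_map fact0) // => <-; exists i.
Qed.

(* The record about to be added represents [t]. *)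
Definition node_ok (M : nat -> nat) hi sym arg lp rp (t : tree q s) : Prop :=
  match t with
  | Var _ => False
  | Leaf b => (sym, arg) = nsym_code b
  | Node f l r =>
      [/\ (sym, arg) = bsym_code f, stored_in M HB hi lp l & stored_in M HB hi rp r]
  end.

Let V0 : 0 < V.
Proof. exact: leq_trans L0 (leq_addr _ _). Qed.

Lemma row_lt_heap y z : y < D -> z < V -> (4 + y) * V + z < HB.
Proof.
move=> lt_y lt_z; apply: (@leq_trans ((4 + y).+1 * V)); first by rewrite mulSn; lia.
by rewrite leq_mul2r -addnS leq_add2l lt_y orbT.
Qed.

Lemma heap_rows : 4 * V <= HB.
Proof. by rewrite leq_mul2r leq_addr orbT. Qed.

Lemma eval_row g M r z : (forall x, x \in fixed_regs -> g x = g0 x) ->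
  peval g M [::] [::] r <= g0 1 ->
  peval g M [::] [::] (Ecell r z) = peval g M [::] [::] r * V + peval g M [::] [::] z.
Proof.
move=> gP le_r; have [_ _ g010] := g0_regs.
by rewrite (peval_cell (MG := MG) (L := L)) ?gP.
Qed.

Lemma eval_fact_row g M r z : (forall x, x \in fixed_regs -> g x = g0 x) ->
  r < nglob -> g r < D ->
  peval g M [::] [::] (Ecell (EAdd (ENum 4) (EReg r)) z) =
  (4 + g r) * V + peval g M [::] [::] z.
Proof.
move=> gP lt_r lt_g; rewrite eval_row // !pevalE lt_r //.
by apply: leq_trans cap4; rewrite leq_add2l ltnW.
Qed.

(** [X] is empty or a single fact. A fact already known for the same key is kept whatever its
    witness tree, since one witness per state is enough. *)
Lemma derive_ok H g M z y t : sat_ok H g M ->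
  g 20 = z -> g 21 = y -> z < V -> y < D ->
  node_ok M (HB + 5 * size H) (g 22) (g 23) (g 24) (g 25) t -> fact_sound z y t ->
  exists X, let st := pden derive (State g M) in
    sat_ok (H ++ X) (regs st) (mem st) /\ (z, y) \in keys (H ++ X).
Proof.
move=> ok g20 g21 lt_z lt_y nok snd.
have [gP tailP rowsM tab facts un] := ok.
have ecell : peval g M [::] [::] (Ecell (EAdd (ENum 4) (EReg 21)) (EReg 20)) =
    (4 + y) * V + z.
  by rewrite eval_fact_row ?g21 // pevalE /= g20.
rewrite /derive pden_if peval0_state pevalE ecell.
have [r0|nz] := eqVneq (M ((4 + y) * V + z)) 0; last first.
  exists [::]; rewrite cats0 pden_skip; split=> //.
  have [i [lt_i _ e]] := tab y z lt_y lt_z nz.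
  by rewrite -e; apply: mem_keys.
set tl := g 12 in tailP *.
have lt_cell := row_lt_heap lt_y lt_z.
have tl0 : tl != 0 by lia.
pose M' := update (update (update (update (update (update M ((4 + y) * V + z) tl)
  tl (g 22)) (tl + 1) (g 23)) (tl + 2) (g 24)) (tl + 3) (g 25)) (tl + 4) z.
have -> : pden (pseq [:: PStore (Ecell (EAdd (ENum 4) (EReg 21)) (EReg 20)) (EReg 12);
      PStore (EReg 12) (EReg 22);
      PStore (EAdd (EReg 12) (ENum 1)) (EReg 23);
      PStore (EAdd (EReg 12) (ENum 2)) (EReg 24);
      PStore (EAdd (EReg 12) (ENum 3)) (EReg 25);
      PStore (EAdd (EReg 12) (ENum 4)) (EReg 20);
      PAssign 12 (EAdd (EReg 12) (ENum 5))]) (State g M) =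
    State (upd g 12 (tl + 5)) M'.
  rewrite !pden_seq pden_store !peval0_state ecell pevalE /=.
  by rewrite ?(pdenE, pevalE) /= g20.
have inHB x : x < HB -> M' x = if x == (4 + y) * V + z then tl else M x.
  by move=> lt_x; rewrite /M'; do 5![rewrite (@updateN _ _ _ x); last by lia].
have old x : HB <= x < tl -> M' x = M x.
  by move=> lt_x; rewrite /M' !(@updateN _ _ _ x) //; lia.
have new : [/\ M' tl = g 22, M' (tl + 1) = g 23, M' (tl + 2) = g 24, M' (tl + 3) = g 25
    & M' (tl + 4) = z].
  rewrite /M'; split; rewrite ?updateE //.
  - by do 4![rewrite (@updateN _ _ _ tl); last by lia]; rewrite updateE.
  - by do 3![rewrite (@updateN _ _ _ (tl + 1)); last by lia]; rewrite updateE.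
  - by do 2![rewrite (@updateN _ _ _ (tl + 2)); last by lia]; rewrite updateE.
  - by do 1![rewrite (@updateN _ _ _ (tl + 3)); last by lia]; rewrite updateE.
have row' y' z' : y' < D -> z' < V ->
    row M' (4 + y') z' = if (y' == y) && (z' == z) then tl else row M (4 + y') z'.
  move=> lt_y' lt_z'; rewrite /cell_at inHB ?row_lt_heap //; congr (if _ then _ else _).
  apply/eqP/andP => [e|[/eqP -> /eqP -> //]].
  have := congr1 (divn^~ V) e; rewrite !divnMDl // !divn_small // !addn0 => /addnI ey.
  by move: e; rewrite ey => /addnI ->.
(* The table cell of this key was zero, whereas those of recorded facts are not. *)
have key_new : (z, y) \notin [seq x.1 | x <- H].
  apply/negP => /keysP[i lt_i e].
  have := facts i lt_i; case en : (nth fact0 H i) e => [[z' y'] t'] /= [-> ->].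
  by case=> [[_ _]]; rewrite /cell_at r0.
exists [:: (z, y, t)]; rewrite /= cats1; split; last first.
  by rewrite /keys map_rcons mem_rcons mem_head.
split=> /=.
- by move=> x xf; case: eqP xf => [->|_ /gP].
- by rewrite tailP size_rcons; lia.
- move=> x lt_x; rewrite inHB; last by have := heap_rows; lia.
  rewrite rowsM // ltn_eqF //.
  by apply: leq_trans lt_x _; rewrite mulnDl -addnA leq_addr.
- move=> y' z' lt_y' lt_z'; rewrite row' // size_rcons; case: ifP => [/andP[/eqP -> /eqP ->] _|_].
    by exists (size H); rewrite tailP nth_rcons ltnn eqxx.
  move=> /(tab y' z' lt_y' lt_z')[i [lt_i ei en]]; exists i.
  by rewrite nth_rcons lt_i ltnS (ltnW lt_i).
- move=> i; rewrite size_rcons ltnS nth_rcons => le_i; case: ltngtP le_i => // [lt_i|->] _.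
    have := facts i lt_i; case: (nth fact0 H i) => [[z' y'] t'] [[lt_z' lt_y' nz ez] [st sn]].
    split; last first.
      split=> //; apply: stored_in_eq st; last by lia.
      by move=> x lt_x; apply: old; lia.
    split=> //; last by rewrite old //; lia.
    by rewrite row' //; case: ifP.
  have [n0 n1 n2 n3 n4] := new.
  rewrite addn1 in n1; rewrite addn2 in n2; rewrite addn3 in n3.
  rewrite -tailP; split.
    by split=> //; rewrite row' // !eqxx.
  split=> //.
  have widen lp v : stored_in M HB (HB + 5 * size H) lp v ->
      stored_in M' HB (HB + 5 * (size H).+1) lp v.
    by apply: stored_in_eq; [move=> x lt_x; apply: old; lia | lia].
  have lo : HB <= tl by lia.
  have hi : tl + 4 <= HB + 5 * (size H).+1 by lia.
  case: (t) nok => [[]|b|f l r] /=; rewrite n0 n1 ?n2 ?n3; first by [].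
  by move=> [-> sl sr]; split=> //; split=> //; split=> //; apply: widen.
- by rewrite map_rcons rcons_uniq key_new.
Qed.

Definition ok H (st : state) := sat_ok H (regs st) (mem st).

Lemma ok_agree H g g' M : sat_ok H g M -> agree 13 g' g -> sat_ok H g' M.
Proof.
move=> [gP tailP ? ? ? ?] ag; split=> //; last by rewrite ag.
by move=> x xf; rewrite ag ?gP //; move: xf; rewrite /fixed_regs mem_iota; lia.
Qed.

Lemma agree_upd k g r v h : k <= r -> agree k g h -> agree k (upd g r v) h.
Proof. by move=> le_k ag x lt_x; rewrite /upd ltn_eqF ?ag // (leq_trans lt_x). Qed.

Lemma ok_setreg H st x v : 13 <= x -> ok H st -> ok H (setreg st x v).
Proof. by move=> le_x okH; apply: ok_agree okH _; apply: agree_update. Qed.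

Lemma keys_cat H X : keys (H ++ X) = keys H ++ keys X.
Proof. exact: map_cat. Qed.

Lemma keys_catl H X x : x \in keys H -> x \in keys (H ++ X).
Proof. by rewrite keys_cat mem_cat => ->. Qed.

Lemma key_table H g M (z y : nat) : sat_ok H g M -> (z, y) \in keys H ->
  [/\ z < V, y < D & cell_at MG L M (4 + y) z != 0].
Proof.
move=> ok1 /keysP[i lt_i e]; have := sat_facts ok1 lt_i.
case: (nth fact0 H i) e => [[z' y'] t] /= [-> ->] [[p1 p2 p3 _] _].
by split.
Qed.

Lemma key_fact H g M z y : sat_ok H g M -> z < V -> y < D ->
  cell_at MG L M (4 + y) z != 0 -> exists t,
    [/\ (z, y) \in keys H,
        stored_in M HB (HB + 5 * size H) (cell_at MG L M (4 + y) z) t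
      & fact_sound z y t].
Proof.
move=> ok1 lt_z lt_y nz; have [i [lt_i -> e]] := sat_table ok1 lt_y lt_z nz.
have := sat_facts ok1 lt_i; have := mem_keys lt_i.
case: (nth fact0 H i) e => [[z' y'] t] /= [-> ->] mk [_ [st sn]].
by exists t; split.
Qed.

Lemma copy_one_ok H g M src dst y : sat_ok H g M -> g 26 = src -> g 27 = dst ->
  g 21 = y -> y < D -> src < V -> dst < V -> (exists u, slot dst u) ->
  (forall t, (forall u, slot src u -> generates u t) ->
     forall u, slot dst u -> generates u t) ->
  exists X, ok (H ++ X) (pden copy_one (State g M)) /\
    ((src, y) \in keys H -> (dst, y) \in keys (H ++ X)).
Proof.
move=> ok1 g26 g27 g21 lt_y lt_src lt_dst ex_dst gen.
have [gP tailP rowsM tab facts un] := ok1.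
rewrite /copy_one [pden _ _]pden_seq pden_assign peval0_state pevalE.
rewrite eval_fact_row ?g21 // pevalE /= g26.
rewrite -[M _]/(cell_at MG L M (4 + y) src).
set c := cell_at MG L M (4 + y) src.
rewrite pden_seq pden_if peval0_state pevalE /=.
have [c0|nz] := eqVneq c 0.
  exists [::]; rewrite cats0 /= !pden_skip; split; first by apply: ok_agree ok1 _; apply: agree_upd.
  by move=> /(key_table ok1)[_ _]; rewrite -/c c0.
have [t [mem_key st [rep _ gen_src]]] := key_fact ok1 lt_src lt_y nz.
rewrite /= !pden_seq !(pden_assign, peval0_state) !pevalE /= !pden_skip.
set g' := upd _ 25 _.
have ok' : sat_ok H g' M by apply: ok_agree ok1 _; do 6!apply: agree_upd => //.
have nok : node_ok M (HB + 5 * size H) (g' 22) (g' 23) (g' 24) (g' 25) t.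
  rewrite /g' /= addn1 addn2 addn3.
  by case: (t) st => [[]|b|f l r] /= [_ [_ st']] //; case: st' => -> ? ?; split.
have snd : fact_sound dst y t by split=> // u; apply: gen.
have [X [okX kX]] := derive_ok ok' g27 g21 lt_dst lt_y nok snd.
by exists X; split.
Qed.

(** [J] speaks of the facts [X] added since the loop was entered; the frame condition on registers
    lets the body use values loaded before the loop. *)
Lemma sat_for H x (c : pcmd) st (J : seq fact -> nat -> Prop) :
  x \notin iota 0 13 -> all (leq 12) (passigned c) -> ok H st ->
  J [::] 0 ->
  (forall X i st', i < D -> ok (H ++ X) st' -> regs st' x = i -> J X i ->
    (forall z, z \notin x :: passigned c -> regs st' z = regs st z) ->
    exists X', ok (H ++ X ++ X') (pden c st') /\ J (X ++ X') i.+1) ->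
  exists X, ok (H ++ X) (pden (PFor x (EReg 8) c) st) /\ J X D.
Proof.
move=> x13 c12 okH J0 step; rewrite pden_for.
have gP := sat_fixed okH; have [g08 _ _] := g0_regs.
have -> : peval0 st (EReg 8) = D by rewrite -g08 -gP.
have -> : regs st 1 = g0 1 by rewrite gP.
have -> : minn D (g0 1) = D by apply/minn_idPl; apply: leq_trans cap4; apply: leq_addl.
pose I i st' := (exists X, ok (H ++ X) st' /\ J X i) /\
  forall z, z \notin x :: passigned c -> regs st' z = regs st z.
suff [] : I D (iteri D (fun i st' => pden c (setreg st' x i)) st) by [].
apply: iteri_invariant.
  by split=> //; exists [::]; rewrite cats0.
move=> i st' lt_i [[X [okX JX]] fr]; split; last first.
  move=> z; rewrite inE negb_or => /andP[zx zc]; rewrite pden_regs //= updateN //.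
  by apply: fr; rewrite inE negb_or zx.
have ok1 : ok (H ++ X) (setreg st' x i).
  by apply: ok_setreg okX; move: x13; rewrite mem_iota; lia.
have fr1 z : z \notin x :: passigned c -> regs (setreg st' x i) z = regs st z.
  by move=> nz; rewrite /= updateN ?fr //; apply: contraNneq nz => ->; rewrite mem_head.
have [X' [okX' JX']] := step X i _ lt_i ok1 (updateE _ _ _) JX fr1.
by exists (X ++ X').
Qed.

Lemma copy_ok H st src dst : ok H st -> regs st 26 = src -> regs st 27 = dst ->
  src < V -> dst < V -> (exists u, slot dst u) ->
  (forall t, (forall u, slot src u -> generates u t) ->
     forall u, slot dst u -> generates u t) ->
  exists X, ok (H ++ X) (pden copy st) /\
    forall y, (src, y) \in keys H -> (dst, y) \in keys (H ++ X).
Proof.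
move=> okH r26 r27 lt_src lt_dst ex_dst gen.
have [] := @sat_for H 21 copy_one st (fun X i =>
  forall y, y < i -> (src, y) \in keys H -> (dst, y) \in keys (H ++ X)) isT isT okH.
- by [].
- move=> X i st' lt_i okX r21 JX fr.
  case: st' okX r21 fr => g M okX g21 fr.
  have g26 : g 26 = src by rewrite -r26; apply: (fr 26).
  have g27 : g 27 = dst by rewrite -r27; apply: (fr 27).
  have [X' [okX' kX']] := copy_one_ok okX g26 g27 g21 lt_i lt_src lt_dst ex_dst gen.
  exists X'; rewrite catA; split=> // y; rewrite ltnS leq_eqVlt => /predU1P[->|lt_y] ky.
    by apply: kX'; apply: keys_catl.
  by apply: keys_catl; apply: JX.
- move=> X [okX kX]; exists X; split=> // y ky.
  by apply: kX => //; have [] := key_table okH ky.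
Qed.

Lemma input_row H g M x : sat_ok H g M -> x < V -> M x = M0 x.
Proof.
move=> ok1 lt_x; rewrite (sat_rows ok1) ?(rows_input rowsP) //.
by rewrite mulSn; apply: leq_trans lt_x (leq_addr _ _).
Qed.

Lemma token_code0 H g M a u d : sat_ok H g M -> List.In (a, u, d) TK ->
  M a = nth 0 (term_code u) 0 /\ M (a + 1) = nth 0 (term_code u) 1.
Proof.
move=> ok1 tk; have [? ?] := token_range end_rules tk.
have sg := rule_tokens_code rules_seg tk.
have lt2 i : i < 2 -> i < size (term_code u).
  by rewrite size_term_code; have := term_size_gt0 u; lia.
rewrite !(input_row ok1); [|by rewrite /V; lia|by rewrite /V; lia].
by split; [rewrite -[a in M0 a]addn0|]; rewrite sg ?lt2.
Qed.

Lemma combine_one_ok H g M p f l r d y1 y2 y : sat_ok H g M ->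
  List.In (p, Node f l r, d) TK ->
  g 27 = d -> g 29 = p -> g 30 = y1 -> g 31 = cell_at MG L M (4 + y1) p ->
  g 32 = y2 -> g 33 = cell_at MG L M (4 + y2) (p + 1) -> g 21 = y ->
  y1 < D -> y2 < D -> y < D ->
  cell_at MG L M (4 + y1) p != 0 -> cell_at MG L M (4 + y2) (p + 1) != 0 ->
  exists X, ok (H ++ X) (pden combine_one (State g M)) /\
    (node_test S P N Q n (bsym_code f).1 (bsym_code f).2 y1 y2 y ->
     (d, y) \in keys (H ++ X)).
Proof.
move=> ok1 tk g27 g29 g30 g31 g32 g33 g21 lt_y1 lt_y2 lt_y nz1 nz2.
have [gP tailP rowsM tab facts un] := ok1.
have [p0 pL] := token_range end_rules tk.
have lt_pV : p < V by rewrite /V; lia.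
have lt_p1V : p + 1 < V by rewrite /V; lia.
have [ep ep1] : M p = (bsym_code f).1 /\ M (p + 1) = (bsym_code f).2.
  exact: token_code0 ok1 tk.
have tp : peval g M [::] [::] (Ecall5 fn_node_test (EFetch (EReg 29))
     (EFetch (EAdd (EReg 29) (ENum 1))) (EReg 30) (EReg 32) (EReg 21)) =
   node_test S P N Q n (bsym_code f).1 (bsym_code f).2 y1 y2 y.
  rewrite /Ecall5 !pevalE /= g29 g30 g32 g21 ep ep1.
  apply: peval_node_test => //.
  - by have [a b c e h] := g0_params; split; rewrite gP.
  - by have [a b c e h] := g0_cap; split; rewrite gP.
rewrite /combine_one pden_if peval0_state tp nat_of_bool_neq0.
case: ifP => [nt|_]; last first.
  by exists [::]; rewrite cats0 pden_skip.
rewrite /= !pden_seq !(pden_assign, peval0_state) !pevalE /= !pden_skip.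
set g' := upd _ 25 _.
have ok' : sat_ok H g' M by apply: ok_agree ok1 _; do 5!apply: agree_upd => //.
have [t1 [k1 st1 [rep1 _ gen1]]] := key_fact ok1 lt_pV lt_y1 nz1.
have [t2 [k2 st2 [rep2 _ gen2]]] := key_fact ok1 lt_p1V lt_y2 nz2.
have nok : node_ok M (HB + 5 * size H) (g' 22) (g' 23) (g' 24) (g' 25) (Node f t1 t2).
  rewrite /g' /= g29 ep ep1 g31 g33; split=> //.
  by case: (f).
have snd : fact_sound d y (Node f t1 t2).
  have gn : generates (Node f l r) (Node f t1 t2).
    constructor; first by apply: gen1; apply: SlotLeft tk.
    by apply: gen2; apply: SlotRight tk.
  have [ex_d gen] := token_dst_generates end_rules tk gn.
  by split=> //; apply: node_test_sound rep1 rep2 nt.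
have lt_d : d < V.
  have [[u su] _] := token_dst_generates end_rules tk (GenNode f (gen1 _ (SlotLeft tk)) (gen2 _ (SlotRight tk))).
  exact: (slot_lt end_rules su).
have [X [okX kX]] := derive_ok ok' g27 g21 lt_d lt_y nok snd.
by exists X; split.
Qed.

Lemma cell_index H g M z y : sat_ok H g M -> (z, y) \in keys H ->
  cell_at MG L M (4 + y) z = HB + 5 * index (z, y) (keys H).
Proof.
move=> ok1 ky; have [lt_z lt_y nz] := key_table ok1 ky.
have [i [lt_i -> e]] := sat_table ok1 lt_y lt_z nz.
have ei : nth (0, 0) (keys H) i = (z, y) by rewrite (nth_map fact0).
by rewrite -ei index_uniq ?size_map //; apply: sat_uniq ok1.
Qed.

(** Registers 31 and 33 keep record addresses across loops that add facts; these addresses stay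
    valid because a key never gets a second record. *)
Lemma cell_stable H X g g' M M' z y :
  sat_ok H g M -> sat_ok (H ++ X) g' M' -> (z, y) \in keys H ->
  cell_at MG L M' (4 + y) z = cell_at MG L M (4 + y) z.
Proof.
move=> ok1 ok2 ky; rewrite (cell_index ok1 ky) (cell_index ok2); last exact: keys_catl.
by rewrite keys_cat index_cat ky.
Qed.

Lemma combine_right_ok H st p f l r d y1 y2 : ok H st ->
  List.In (p, Node f l r, d) TK ->
  regs st 27 = d -> regs st 29 = p -> regs st 30 = y1 ->
  regs st 31 = cell_at MG L (mem st) (4 + y1) p -> (p, y1) \in keys H ->
  regs st 32 = y2 -> y2 < D ->
  exists X, ok (H ++ X) (pden combine_right st) /\
    forall y, y < D -> (p + 1, y2) \in keys H ->
      node_test S P N Q n (bsym_code f).1 (bsym_code f).2 y1 y2 y ->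
      (d, y) \in keys (H ++ X).
Proof.
case: st => g M /= ok1 tk g27 g29 g30 g31 k1 g32 lt_y2.
have lt_p1V : p + 1 < V by have [] := token_range end_rules tk; rewrite /V; lia.
have [lt_p lt_y1 nz1] := key_table ok1 k1.
rewrite /combine_right pden_seq pden_assign peval0_state pevalE.
rewrite eval_fact_row ?g32 //; last exact: sat_fixed ok1.
rewrite !pevalE /= g29 -[M _]/(cell_at MG L M (4 + y2) (p + 1)).
set c := cell_at MG L M (4 + y2) (p + 1).
have ok2 : ok H (State (upd g 33 c) M) by apply: ok_agree ok1 _; apply: agree_upd.
rewrite pden_if peval0_state pevalE /=.
have [c0|nz] := eqVneq c 0.
  exists [::]; rewrite cats0 pden_skip; split=> // y _ k2.
  by have [_ _] := key_table ok1 k2; rewrite -/c c0.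
have [t [k2 _ _]] := key_fact ok1 lt_p1V lt_y2 nz.
have [] := @sat_for H 21 combine_one (State (upd g 33 c) M) (fun X i =>
  forall y, y < i -> node_test S P N Q n (bsym_code f).1 (bsym_code f).2 y1 y2 y ->
      (d, y) \in keys (H ++ X)) isT isT ok2.
- by [].
- move=> X i [g' M'] lt_i okX r21 JX fr.
  have e1 := cell_stable ok1 okX k1; have e2 := cell_stable ok1 okX k2.
  have h27 : g' 27 = d by rewrite -g27; apply: (fr 27).
  have h29 : g' 29 = p by rewrite -g29; apply: (fr 29).
  have h30 : g' 30 = y1 by rewrite -g30; apply: (fr 30).
  have h31 : g' 31 = cell_at MG L M' (4 + y1) p by rewrite e1 -g31; apply: (fr 31).
  have h32 : g' 32 = y2 by rewrite -g32; apply: (fr 32).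
  have h33 : g' 33 = cell_at MG L M' (4 + y2) (p + 1) by rewrite e2; apply: (fr 33).
  have n1 : cell_at MG L M' (4 + y1) p != 0 by rewrite e1.
  have n2 : cell_at MG L M' (4 + y2) (p + 1) != 0 by rewrite e2.
  have [X' [okX' kX']] := combine_one_ok okX tk h27 h29 h30 h31 h32 h33 r21
    lt_y1 lt_y2 lt_i n1 n2.
  exists X'; rewrite catA; split=> // y; rewrite ltnS leq_eqVlt => /predU1P[->|lt_y] nt.
    exact: kX'.
  by apply: keys_catl; apply: JX.
- move=> X [okX kX]; exists X; split=> // y lt_y _; exact: kX.
Qed.

Lemma combine_left_ok H st p f l r d y1 : ok H st ->
  List.In (p, Node f l r, d) TK ->
  regs st 27 = d -> regs st 29 = p -> regs st 30 = y1 -> y1 < D ->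
  exists X, ok (H ++ X) (pden combine_left st) /\
    forall y2 y, y2 < D -> y < D -> (p, y1) \in keys H -> (p + 1, y2) \in keys H ->
      node_test S P N Q n (bsym_code f).1 (bsym_code f).2 y1 y2 y ->
      (d, y) \in keys (H ++ X).
Proof.
case: st => g M /= ok1 tk g27 g29 g30 lt_y1.
have lt_pV : p < V by have [] := token_range end_rules tk; rewrite /V; lia.
rewrite /combine_left pden_seq pden_assign peval0_state pevalE.
rewrite eval_fact_row ?g30 //; last exact: sat_fixed ok1.
rewrite !pevalE /= g29 -[M _]/(cell_at MG L M (4 + y1) p).
set c := cell_at MG L M (4 + y1) p.
have ok2 : ok H (State (upd g 31 c) M) by apply: ok_agree ok1 _; apply: agree_upd.
rewrite pden_if peval0_state pevalE /=.
have [c0|nz] := eqVneq c 0.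
  exists [::]; rewrite cats0 pden_skip; split=> // y2 y _ _ k1.
  by have [_ _] := key_table ok1 k1; rewrite -/c c0.
have [t [k1 _ _]] := key_fact ok1 lt_pV lt_y1 nz.
have [] := @sat_for H 32 combine_right (State (upd g 31 c) M) (fun X i =>
  forall y2 y, y2 < i -> y < D -> (p + 1, y2) \in keys H ->
      node_test S P N Q n (bsym_code f).1 (bsym_code f).2 y1 y2 y ->
      (d, y) \in keys (H ++ X)) isT isT ok2.
- by [].
- move=> X i [g' M'] lt_i okX r32 JX fr.
  have e1 := cell_stable ok1 okX k1.
  have h27 : g' 27 = d by rewrite -g27; apply: (fr 27).
  have h29 : g' 29 = p by rewrite -g29; apply: (fr 29).
  have h30 : g' 30 = y1 by rewrite -g30; apply: (fr 30).
  have h31 : g' 31 = cell_at MG L M' (4 + y1) p by rewrite e1; apply: (fr 31).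
  have [X' [okX' kX']] := @combine_right_ok _ (State g' M') _ _ _ _ _ y1 i okX tk
    h27 h29 h30 h31 (keys_catl X k1) r32 lt_i.
  exists X'; rewrite catA; split=> // y2 y; rewrite ltnS leq_eqVlt => /predU1P[->|lt_y2] lt_y k2 nt.
    by apply: kX' nt => //; apply: keys_catl.
  by apply: keys_catl; apply: JX nt.
- by move=> X [okX kX]; exists X; split=> // y2 y lt_y2 lt_y _; apply: kX.
Qed.

Lemma combine_ok H st p f l r d : ok H st ->
  List.In (p, Node f l r, d) TK -> regs st 27 = d -> regs st 29 = p ->
  exists X, ok (H ++ X) (pden combine st) /\
    forall y1 y2 y, y < D -> (p, y1) \in keys H -> (p + 1, y2) \in keys H ->
      node_test S P N Q n (bsym_code f).1 (bsym_code f).2 y1 y2 y ->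
      (d, y) \in keys (H ++ X).
Proof.
move=> ok1 tk r27 r29.
have [] := @sat_for H 30 combine_left st (fun X i =>
  forall y1 y2 y, y1 < i -> y < D -> (p, y1) \in keys H -> (p + 1, y2) \in keys H ->
      node_test S P N Q n (bsym_code f).1 (bsym_code f).2 y1 y2 y ->
      (d, y) \in keys (H ++ X)) isT isT ok1.
- by [].
- move=> X i st' lt_i okX r30 JX fr.
  have h27 : regs st' 27 = d by rewrite -r27; apply: fr.
  have h29 : regs st' 29 = p by rewrite -r29; apply: fr.
  have [X' [okX' kX']] := combine_left_ok okX tk h27 h29 r30 lt_i.
  exists X'; rewrite catA; split=> // y1 y2 y.
  rewrite ltnS leq_eqVlt => /predU1P[->|lt_y1] lt_y k1 k2 nt.
    have [_ lt_y2 _] := key_table ok1 k2.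
    by apply: kX' nt => //; apply: keys_catl.
  by apply: keys_catl; apply: JX nt.
- move=> X [okX kX]; exists X; split=> // y1 y2 y lt_y k1 k2; apply: kX => //.
  by have [] := key_table ok1 k1.
Qed.

(** * Closure under the processed facts *)

Definition pending H h : seq nat := [seq x.1.1 | x <- drop h H].

(** [K] holds the keys known before a step and [K'] those known after it; closure proper is the case
    where they are equal. *)
Definition copies_closed (K K' : seq (nat * nat)) z : Prop :=
  (cell_at MG L Mp 2 z != 0 -> forall y, (z, y) \in K ->
     (cell_at MG L Mp 2 z, y) \in K') /\
  (forall X d, List.In (z, Var X, d) TK -> forall y, (z, y) \in K -> (d, y) \in K').

Definition node_closed (K K' : seq (nat * nat)) p (f : bsym q) d : Prop :=
  forall y1 y2 y, y < D -> (p, y1) \in K -> (p + 1, y2) \in K ->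
    node_test S P N Q n (bsym_code f).1 (bsym_code f).2 y1 y2 y -> (d, y) \in K'.

Lemma token_dst_gt0 a u d : List.In (a, u, d) TK -> 0 < d.
Proof.
move=> /rule_tokens_dst[[X /= -> _]|[p [f [l [r [d' [i [[/= -> _]|[/= -> _]]]]]]]]].
- by rewrite ltn_addr.
- by have [] := token_range end_rules i; lia.
- by rewrite addn1.
Qed.

Lemma link_row H g M r x : sat_ok H g M -> r < 4 -> x < V ->
  M (r * V + x) = cell_at MG L Mp r x.
Proof.
move=> ok1 lt_r lt_x; rewrite /cell_at (sat_rows ok1) //.
by apply: (@leq_trans (r.+1 * V)); [rewrite mulSn; lia | rewrite leq_mul2r lt_r orbT].
Qed.

Lemma eval_link_row H g M k x : sat_ok H g M -> k < 4 -> x < nglob -> g x < V ->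
  peval g M [::] [::] (EFetch (Ecell (ENum k) (EReg x))) = cell_at MG L Mp k (g x).
Proof.
move=> ok1 lt_k lt_x lt_gx; rewrite pevalE eval_row //; last first.
- by rewrite pevalE; apply: leq_trans cap4; lia.
- exact: sat_fixed ok1.
by rewrite !pevalE lt_x (link_row ok1).
Qed.

Lemma slot_cases z u : slot z u ->
  [\/ exists p f l r d, List.In (p, Node f l r, d) TK /\ (z = p \/ z = p + 1),
      exists X d, List.In (z, Var X, d) TK | exists X : 'I_nt, z = L + X].
Proof.
case=> [p f l r d tk|p f l r d tk|a X d tk|X].
- by apply: Or31; exists p, f, l, r, d; split; [|left].
- by apply: Or31; exists p, f, l, r, d; split; [|right].
- by apply: Or32; exists X, d.
- by apply: Or33; exists X.
Qed.

Lemma dispatch_ok H st z : ok H st -> regs st 26 = z -> z < L ->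
  (exists u, slot z u) ->
  exists X, [/\ ok (H ++ X) (pden dispatch st),
    (forall X' d, List.In (z, Var X', d) TK ->
       forall y, (z, y) \in keys H -> (d, y) \in keys (H ++ X))
    & forall p f l r d, List.In (p, Node f l r, d) TK -> z = p \/ z = p + 1 ->
        node_closed (keys H) (keys (H ++ X)) p f d].
Proof.
case: st => g M /= ok1 g26 lt_z ex_z; have {}ok1 : sat_ok H g M := ok1.
have lt_zV : z < V by apply: leq_trans lt_z (leq_addr _ _).
have run_to p u d : List.In (p, u, d) TK -> cell_at MG L Mp 1 z = (if z == p then d else 0) ->
    z = p \/ z = p + 1 ->
    pden dispatch (State g M) =
    pden (if nth 0 (term_code u) 0 != 0 then combine else copy)
      (State (upd (upd g 29 p) 27 d) M).
  move=> tk e1 zp; have [p0 pL] := token_range end_rules tk.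
  have lt_pV : p < V by rewrite /V; lia.
  have d0 := token_dst_gt0 tk.
  have ep : pden (PIf (EFetch (Ecell (ENum 1) (EReg 26))) (PAssign 29 (EReg 26))
      (PAssign 29 (ESub (EReg 26) (ENum 1)))) (State g M) = State (upd g 29 p) M.
    rewrite pden_if peval0_state (eval_link_row ok1) //=; last by rewrite g26.
    rewrite g26 e1; have [ez|nz] := eqVneq z p; first by rewrite -lt0n d0 pden_assign peval0_state pevalE /= g26 ez.
    rewrite /= pden_assign peval0_state !pevalE /= g26.
    by case: zp => [ez|->]; [rewrite ez eqxx in nz | rewrite addnK].
  have ok2 : sat_ok H (upd g 29 p) M by apply: ok_agree ok1 _; apply: agree_upd.
  rewrite /dispatch !pden_seq ep pden_assign peval0_state (eval_link_row ok2) //=.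
  rewrite (rows_dst rowsP tk) pden_if peval0_state !pevalE /= pden_skip.
  by have [-> _] := token_code0 ok1 tk; case: ifP.
have node_case p f l r d : List.In (p, Node f l r, d) TK -> z = p \/ z = p + 1 ->
  exists X, [/\ ok (H ++ X) (pden dispatch (State g M)),
    (forall X' d, List.In (z, Var X', d) TK ->
       forall y, (z, y) \in keys H -> (d, y) \in keys (H ++ X))
    & forall p f l r d, List.In (p, Node f l r, d) TK -> z = p \/ z = p + 1 ->
        node_closed (keys H) (keys (H ++ X)) p f d].
  move=> tk zp.
  (* The right slot [p + 1] of a node is not the address of a token, so row 1 is zero there. *)
  have e1 : cell_at MG L Mp 1 z = (if z == p then d else 0).
    case: eqP => [->|nz]; first exact: (rows_dst rowsP tk).
    have {}zp : z = p + 1 by case: zp.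
    apply/eqP; apply: contraT => /(rows_token rowsP lt_zV)[u [d' tk']].
    by rewrite zp in tk'; case: (token_not_succ end_rules tk tk').
  rewrite (run_to p _ d tk e1 zp) /=.
  have -> : (bsym_code f).1 != 0 by case: (f).
  have ok2 : ok H (State (upd (upd g 29 p) 27 d) M).
    by apply: ok_agree ok1 _; do 2!apply: agree_upd => //.
  have [X [okX cl]] := combine_ok ok2 tk (erefl _) (erefl _).
  exists X; split=> //.
    move=> Y d' tk'; case: zp => ez; rewrite ez in tk'.
      by have [] := token_inj end_rules tk tk'.
    by case: (token_not_succ end_rules tk tk').
  move=> p' f' l' r' d' tk' zp'.
  have ep : p' = p.
    case: zp zp' => e2 [e3|e3]; [by rewrite -e2 | | | by lia].
      by rewrite -e2 e3 in tk; case: (token_not_succ end_rules tk' tk).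
    by rewrite -e3 e2 in tk'; case: (token_not_succ end_rules tk tk').
  by rewrite ep in tk' *; have [[-> _ _] ->] := token_inj end_rules tk' tk.
case: ex_z => u /slot_cases[[p [f [l [r [d [tk zp]]]]]]|[Y [d tk]]|[Y ez]]; last by lia.
  exact: node_case tk zp.
have e1 : cell_at MG L Mp 1 z = (if z == z then d else 0).
  by rewrite eqxx; apply: (rows_dst rowsP tk).
rewrite (run_to z _ d tk e1 (or_introl erefl)) /=.
have ok2 : ok H (State (upd (upd g 29 z) 27 d) M).
  by apply: ok_agree ok1 _; do 2!apply: agree_upd => //.
have ex_d : exists u, slot d u.
  have [sl|[X -> _]] := token_dst tk; first by exists (Var Y).
  by exists (Var X); apply: SlotNt.
have lt_d : d < V by case: ex_d => v; apply: (slot_lt end_rules).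
have gen t : (forall v, slot z v -> generates v t) -> forall v, slot d v -> generates v t.
  move=> h; have gt := h _ (SlotVar tk).
  by have [_] := token_dst_generates end_rules tk gt.
have [X [okX kX]] := copy_ok ok2 g26 (erefl _) lt_zV lt_d ex_d gen.
exists X; split=> //.
  by move=> Y' d' tk' y; have [_ ->] := token_inj end_rules tk' tk; apply: kX.
move=> p f l r d' tk' zp; case: zp => ez; rewrite ez in tk.
  by have [] := token_inj end_rules tk tk'.
by case: (token_not_succ end_rules tk' tk).
Qed.

Lemma chain_mem next z0 l z : chain next z0 l -> z \in z0 :: l -> next z != 0 ->
  next z \in l.
Proof.
elim: l z0 => [|a l IH] z0 /=; first by move=> e; rewrite inE => /eqP ->; rewrite e.
move=> [ea ch]; rewrite inE => /predU1P[-> _|zl nz]; first by rewrite ea mem_head.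
by rewrite inE (IH a) ?orbT.
Qed.

Lemma link_target z : z < V -> cell_at MG L Mp 2 z != 0 -> exists X d,
  List.In (cell_at MG L Mp 2 z, Var X, d) TK /\ slot z (Var X).
Proof.
move=> lt_z nz; have [X zX] := rows_link rowsP lt_z nz.
have /mem_InP/In_occurrences[d tk] := chain_mem (rows_chain rowsP X) zX nz.
exists X, d; split=> //; move: zX; rewrite inE => /predU1P[->|]; first exact: SlotNt.
by move=> /mem_InP/In_occurrences[d' tk']; apply: SlotVar tk'.
Qed.

Lemma process_ok H h st : ok H st -> h < size H -> regs st 13 = HB + 5 * h ->
  let z := (nth fact0 H h).1.1 in
  exists X, [/\ ok (H ++ X) (pden process_step st),
    regs (pden process_step st) 13 = HB + 5 * h.+1,
    copies_closed (keys H) (keys (H ++ X)) z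
    & forall p f l r d, List.In (p, Node f l r, d) TK -> z = p \/ z = p + 1 ->
        node_closed (keys H) (keys (H ++ X)) p f d].
Proof.
case: st => g M /= ok1 lt_h g13; have {}ok1 : sat_ok H g M := ok1.
have := sat_facts ok1 lt_h; case: (nth fact0 H h) => [[z y] t] /= [[lt_z lt_y nz ez] [_ [_ ex_z _]]].
have [g08 g09 g010] := g0_regs; have gP := sat_fixed ok1.
set o := cell_at MG L Mp 2 z.
pose g1 := upd (upd (upd g 26 z) 13 (HB + 5 * h.+1)) 27 o.
have ok1' : sat_ok H g1 M by apply: ok_agree ok1 _; do 3!apply: agree_upd => //.
have -> : pden process_step (State g M) =
    pden (PIf (Elt (EReg 26) (EReg 9)) dispatch PSkip)
      (pden (PIf (EReg 27) copy PSkip) (State g1 M)).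
  rewrite /process_step !pden_seq pden_assign peval0_state !pevalE /= g13 ez.
  rewrite pden_assign peval0_state !pevalE /= g13 pden_assign peval0_state.
  rewrite (eval_link_row (H := H)) //=; last by apply: ok_agree ok1 _; do 2!apply: agree_upd => //.
  by rewrite pden_skip /g1 mulnS addnCA addnC.
have [X1 [okX1 cl1 r26 r13]] : exists X1,
    [/\ ok (H ++ X1) (pden (PIf (EReg 27) copy PSkip) (State g1 M)),
     o != 0 -> forall y, (z, y) \in keys H -> (o, y) \in keys (H ++ X1),
     regs (pden (PIf (EReg 27) copy PSkip) (State g1 M)) 26 = z
     & regs (pden (PIf (EReg 27) copy PSkip) (State g1 M)) 13 = HB + 5 * h.+1].
  rewrite pden_if peval0_state pevalE /=; case: eqP => [o0|/eqP nz_o].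
    by exists [::]; rewrite cats0 pden_skip.
  have [X [d [tk sz]]] := link_target lt_z nz_o.
  have so := SlotVar tk.
  have gen t' : (forall u, slot z u -> generates u t') ->
      forall u, slot o u -> generates u t'.
    by move=> h1 u su; rewrite -(slot_inj end_rules so su); apply: h1.
  have [X1 [okX1 kX1]] := copy_ok (st := State g1 M) ok1' (erefl _) (erefl _) lt_z
    (slot_lt end_rules so) (ex_intro _ _ so) gen.
  by exists X1; split=> //; rewrite pden_regs.
set st2 := pden (PIf (EReg 27) copy PSkip) _ in okX1 r26 r13 *.
have e9 : regs st2 9 = L by rewrite (sat_fixed okX1).
have -> : pden (PIf (Elt (EReg 26) (EReg 9)) dispatch PSkip) st2 =
    if z < L then pden dispatch st2 else st2.
  case: st2 r26 e9 {okX1 r13} => g2 M2 /= r26 e9.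
  by rewrite pden_if peval0_state peval_lt !pevalE /= r26 e9 nat_of_bool_neq0.
case: ltnP => [lt_zL|le_L]; last first.
  exists X1; split=> //.
    by split=> // X d /(token_range end_rules); lia.
  by move=> p f l r d /(token_range end_rules) ? [] ?; lia.
have [X2 [okX2 cl2 cl3]] := dispatch_ok okX1 r26 lt_zL ex_z.
exists (X1 ++ X2); rewrite catA; split=> //.
- by rewrite pden_regs.
- split; first by move=> nz_o y' ky; apply: keys_catl; apply: cl1.
  by move=> X d tk y' ky; apply: (cl2 X) => //; apply: keys_catl.
- move=> p f l r d tk zp y1 y2 y' lt_y' k1 k2.
  by apply: (cl3 p f l r d tk zp) => //; apply: keys_catl.
Qed.

Lemma leaf_one_ok H g M a b d y : sat_ok H g M -> List.In (a, Leaf b, d) TK ->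
  g 27 = d -> g 14 = a -> g 21 = y -> y < D ->
  exists X, ok (H ++ X) (pden leaf_one (State g M)) /\
    (leaf_test P N Q n (nsym_code b).1 (nsym_code b).2 y -> (d, y) \in keys (H ++ X)).
Proof.
move=> ok1 tk g27 g14 g21 lt_y; have gP := sat_fixed ok1.
have [ea ea1] := token_code0 ok1 tk; rewrite /= in ea ea1.
have agM : agree L M M0.
  by move=> x lt_x; rewrite (input_row ok1) // (leq_trans lt_x) ?leq_addr.
have tp : peval g M [::] [::] (Ecall3 fn_leaf_test (EFetch (EReg 14))
     (EFetch (EAdd (EReg 14) (ENum 1))) (EReg 21)) =
   leaf_test P N Q n (nsym_code b).1 (nsym_code b).2 y.
  rewrite /Ecall3 !pevalE /= g14 g21 ea ea1.
  apply: (peval_leaf_test (S := S)) => //.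
  - exact: wordsP.
  - by have [? ? ? ? ?] := g0_params; split; rewrite gP.
  - by have [? ? ? ? ?] := g0_cap; split; rewrite gP.
rewrite /leaf_one pden_if peval0_state tp nat_of_bool_neq0.
case: ifP => [lt|_]; last by exists [::]; rewrite cats0 pden_skip.
rewrite /= !pden_seq !(pden_assign, peval0_state) !pevalE /= !pden_skip.
set g' := upd _ 25 _.
have ok' : sat_ok H g' M by apply: ok_agree ok1 _; do 5!apply: agree_upd => //.
have nok : node_ok M (HB + 5 * size H) (g' 22) (g' 23) (g' 24) (g' 25) (Leaf b).
  by rewrite /g' /= g14 ea ea1; case: (b).
have [ex_d gen] := token_dst_generates end_rules tk (GenLeaf MG b).
have snd : fact_sound d y (Leaf b).
  by split=> //; apply: (leaf_testP S P N Q n b y lt).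
have lt_d : d < V by case: ex_d => u su; apply: (slot_lt end_rules su).
have [X [okX kX]] := derive_ok ok' g27 g21 lt_d lt_y nok snd.
by exists X; split.
Qed.

Definition leaves_closed (K : seq (nat * nat)) k : Prop :=
  forall a b d, a < k -> List.In (a, Leaf b, d) TK -> forall y, y < D ->
    leaf_test P N Q n (nsym_code b).1 (nsym_code b).2 y -> (d, y) \in K.

Lemma leaf_ok H st a : ok H st -> regs st 14 = a -> a < L ->
  leaves_closed (keys H) a ->
  exists X, [/\ ok (H ++ X) (pden leaf_step st), regs (pden leaf_step st) 14 = a.+1
    & leaves_closed (keys (H ++ X)) a.+1].
Proof.
case: st => g M /= ok1 g14 lt_a cl; have {}ok1 : sat_ok H g M := ok1.
have lt_aV : a < V by apply: leq_trans lt_a (leq_addr _ _).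
set d := cell_at MG L Mp 1 a.
have okd : sat_ok H (upd g 27 d) M by apply: ok_agree ok1 _; apply: agree_upd.
have aP b d' : List.In (a, Leaf b, d') TK -> d' = d by move=> /(rows_dst rowsP).
suff [X [okX kX r14]] : exists X, let st := pden (PIf (Eand (EReg 27) (Eand (EFetch (EReg 14))
      (Elt (EFetch (EReg 14)) (ENum 4)))) (PFor 21 (EReg 8) leaf_one) PSkip)
      (State (upd g 27 d) M) in
    [/\ ok (H ++ X) st, forall b d', List.In (a, Leaf b, d') TK -> forall y, y < D ->
       leaf_test P N Q n (nsym_code b).1 (nsym_code b).2 y -> (d', y) \in keys (H ++ X)
     & regs st 14 = a].
  exists X; rewrite /leaf_step !pden_seq pden_assign peval0_state.
  rewrite (eval_link_row ok1) ?g14 //= -/d; move: okX r14; set st := pden (PIf _ _ _) _.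
  case: st => g2 M2 okX /= r14.
  rewrite pden_assign peval0_state !pevalE /= pden_skip r14 addn1; split=> //.
    by apply: ok_agree okX _; apply: agree_upd.
  move=> a' b d'; rewrite ltnS leq_eqVlt => /predU1P[->|lt_a'] tk y lt_y lt; first exact: kX tk _ _ lt.
  by apply: keys_catl; apply: (cl a' b d').
rewrite pden_if peval0_state !(pboolE, pevalE) /= g14.
case: ifP => [/and3P[d0 Ma Ma4]|nleaf]; last first.
  exists [::]; rewrite cats0 pden_skip; split=> // b d' tk y lt_y _.
  have [ea _] := token_code0 ok1 tk; move/negP: nleaf; case.
  rewrite -(aP _ _ tk) -lt0n (token_dst_gt0 tk) ea /=.
  by case: (b).
have [u [d' tk]] := rows_token rowsP lt_aV d0.
have [ea _] := token_code0 ok1 tk.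
case: u tk ea => [Y|b|f l r] tk ea; [by rewrite ea in Ma | | by move: Ma4; rewrite ea; case: (f)].
have ed := aP _ _ tk.
have [] := @sat_for H 21 leaf_one (State (upd g 27 d) M) (fun X i =>
  forall y, y < i -> leaf_test P N Q n (nsym_code b).1 (nsym_code b).2 y ->
    (d', y) \in keys (H ++ X)) isT isT okd.
- by [].
- move=> X i [g' M'] lt_i okX r21 JX fr.
  have h27 : g' 27 = d' by rewrite ed; apply: (fr 27).
  have h14 : g' 14 = a by rewrite -g14; apply: (fr 14).
  have [X' [okX' kX']] := leaf_one_ok okX tk h27 h14 r21 lt_i.
  exists X'; rewrite catA; split=> // y; rewrite ltnS leq_eqVlt => /predU1P[->|lt_y] lt.
    exact: kX'.
  by apply: keys_catl; apply: JX.
- move=> X [okX kX]; exists X; split=> //; last by rewrite pden_regs.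
  move=> b' d2 tk' y lt_y; have [[->] ->] := token_inj end_rules tk' tk; exact: kX.
Qed.

(** Keys inject into the numbers below [V * D]; this bounds the rounds of the worklist loop. *)
Lemma size_keys H st : ok H st -> size H <= V * D.
Proof.
move=> okH; pose f (x : nat * nat) := x.2 * V + x.1.
have lt_key x : x \in keys H -> x.1 < V /\ x.2 < D.
  by case: x => z y /(key_table okH)[].
have inj : {in keys H &, injective f}.
  move=> [z y] [z' y'] /lt_key /= [lt_z _] /lt_key /= [lt_z' _]; rewrite /f /= => e.
  have := congr1 (divn^~ V) e; rewrite !divnMDl // !divn_small // !addn0 => ey.
  by move: e; rewrite ey => /addnI ->.
rewrite -(size_map fst H) -(size_map f) -(size_iota 0 (V * D)).
apply: uniq_leq_size; first by rewrite map_inj_in_uniq ?(sat_uniq okH).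
move=> _ /mapP[x /lt_key[lt_z lt_y] ->]; rewrite mem_iota /f /= add0n mulnC.
apply: (@leq_trans (V * x.2.+1)); first by rewrite mulnS addnC ltn_add2r.
by rewrite leq_mul2l lt_y orbT.
Qed.

Definition leaf_inv k (st : state) : Prop := exists H,
  [/\ ok H st, regs st 13 = HB, regs st 14 <= L,
      leaves_closed (keys H) (regs st 14) & k = L - regs st 14].

Lemma run_leaves st s0 : simulates st s0 -> ok [::] s0 -> regs s0 13 = HB ->
  regs s0 14 = 0 ->
  run (While (guard 9 14) (pcompile nglob leaf_step)) st
    (L * (pcbound (g0 1) leaf_step + 4) + 4)
    (fun st' => exists s' H, [/\ simulates st' s', ok H s', regs s' 13 = HB,
       leaves_closed (keys H) L & regs s' 0 = regs s0 0]).
Proof.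
move=> sim ok0 r13 r14.
have I0 : leaf_inv L s0 /\ regs s0 0 = regs s0 0.
  by split=> //; exists [::]; rewrite r14 subn0.
have [_ g09 _] := g0_regs.
have e9 H s1 : ok H s1 -> regs s1 9 = L by move=> okH; rewrite (sat_fixed okH).
apply: (run_weaken (run_loop (J := fun k s1 => leaf_inv k s1 /\ regs s1 0 = regs s0 0)
  (B := g0 1) (n := L) sim I0 (leqnn _) _ _ _ _ _)) => //.
- by move=> k s1 [[H [okH _ _ _ _]] _]; rewrite (sat_fixed okH).
- move=> k s1 [[H [okH r13' le14 cl ->]] r0]; rewrite (e9 _ _ okH) => lt14.
  have [X [okX r14' clX]] := leaf_ok okH erefl lt14 cl.
  exists (L - (regs s1 14).+1); first by lia.
  split; last by rewrite -r0 pden_regs.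
  by exists (H ++ X); rewrite r14'; split=> //; rewrite pden_regs.
- move=> st' [k [s' [sim' [[H [okH r13' le14 cl _]] r0]]]].
  rewrite (e9 _ _ okH) => ge14; exists s', H; split=> //.
  by have <- : regs s' 14 = L by lia.
Qed.

(** Closure is tracked per slot and not per fact, because processing one fact handles all the facts
    of its slot known so far. A slot with a waiting fact is excused, and so is a node with such a
    child slot. *)
Definition settled H h : Prop :=
  (forall z, z < V -> z \in pending H h \/ copies_closed (keys H) (keys H) z) /\
  (forall p f l r d, List.In (p, Node f l r, d) TK ->
     [\/ p \in pending H h, p + 1 \in pending H h
       | node_closed (keys H) (keys H) p f d]).

(** Facts added after rank [h] are themselves waiting, so a slot without waiting facts has gained
    none. *)
Lemma mem_pending H X h z y : z \notin pending (H ++ X) h -> h <= size H ->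
  (z, y) \in keys (H ++ X) -> (z, y) \in keys H.
Proof.
rewrite /pending drop_cat => npend le_h; rewrite keys_cat mem_cat => /orP[//|/keysP[i lt_i e]].
case/negP: npend; case: ltnP => _; rewrite ?map_cat ?mem_cat.
  apply/orP; right; rewrite -[z]/((z, y).1) -e -(nth_map fact0 0 (fun x => x.1.1)) //.
  by rewrite mem_nth ?size_map.
have -> : h - size H = 0 by lia.
rewrite drop0 -[z]/((z, y).1) -e -(nth_map fact0 0 (fun x => x.1.1)) //.
by rewrite mem_nth ?size_map.
Qed.

Lemma pending0 H z y : (z, y) \in keys H -> z \in pending H 0.
Proof.
move=> /keysP[i lt_i e]; rewrite /pending drop0 -[z]/((z, y).1) -e.
by rewrite -(nth_map fact0 0 (fun x => x.1.1)) // mem_nth ?size_map.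
Qed.

Lemma pending_step H X h z : h < size H -> z != (nth fact0 H h).1.1 ->
  z \notin pending (H ++ X) h.+1 -> z \notin pending H h.
Proof.
move=> lt_h nz; apply: contraNN; rewrite /pending (drop_nth fact0) //= inE (negbTE nz) /=.
rewrite drop_cat; case: ltnP => [_|le_h]; first by rewrite map_cat mem_cat => ->.
by rewrite drop_oversize.
Qed.

Lemma settled_step H X h : h < size H -> settled H h ->
  copies_closed (keys H) (keys (H ++ X)) (nth fact0 H h).1.1 ->
  (forall p f l r d, List.In (p, Node f l r, d) TK ->
     (nth fact0 H h).1.1 = p \/ (nth fact0 H h).1.1 = p + 1 ->
     node_closed (keys H) (keys (H ++ X)) p f d) ->
  settled (H ++ X) h.+1.
Proof.
set z0 := (nth fact0 H h).1.1 => lt_h [cop nod] cop0 nod0; split.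
  move=> z lt_z; case: (boolP (z \in pending (H ++ X) h.+1)) => [|np]; [by left|right].
  have old y : (z, y) \in keys (H ++ X) -> (z, y) \in keys H by apply: mem_pending np lt_h.
  have [ez|nz] := eqVneq z z0.
    rewrite -ez in cop0; case: cop0 => c1 c2; split; first by move=> n0 y /old /c1; apply.
    by move=> Y d tk y /old; apply: c2 tk y.
  have := pending_step lt_h nz np; case: (cop z lt_z) => [-> //|[c1 c2] _]; split.
    by move=> n0 y /old /(c1 n0) ky; apply: keys_catl.
  by move=> Y d tk y /old ky; apply: keys_catl; apply: c2 tk y ky.
move=> p f l r d tk.
case: (boolP (p \in pending (H ++ X) h.+1)) => [|np]; first by constructor 1.
case: (boolP (p + 1 \in pending (H ++ X) h.+1)) => [|np1]; first by constructor 2.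
constructor 3 => y1 y2 y lt_y /(mem_pending np lt_h) k1 /(mem_pending np1 lt_h) k2.
have [ep|nep] := eqVneq p z0; first by apply: (nod0 p f l r d tk) => //; left.
have [ep1|nep1] := eqVneq (p + 1) z0; first by apply: (nod0 p f l r d tk) => //; right.
have q1 := pending_step lt_h nep np; have q2 := pending_step lt_h nep1 np1.
case: (nod p f l r d tk) => [k|k|cl nt]; [by rewrite k in q1|by rewrite k in q2|].
by apply: keys_catl; apply: cl nt.
Qed.

Definition saturate_inv k (st : state) : Prop := exists H h,
  [/\ ok H st, regs st 13 = HB + 5 * h /\ h <= size H, leaves_closed (keys H) L,
      settled H h & k = V * D - h].

Lemma run_saturate st s0 H0 : simulates st s0 -> ok H0 s0 -> regs s0 13 = HB ->
  leaves_closed (keys H0) L ->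
  run (While (guard 12 13) (pcompile nglob process_step)) st
    (V * D * (pcbound (g0 1) process_step + 4) + 4)
    (fun st' => exists s' H, [/\ simulates st' s', ok H s',
       leaves_closed (keys H) L, settled H (size H) & regs s' 0 = regs s0 0]).
Proof.
move=> sim ok0 r13 cl0.
(* At the start every fact is waiting, so a slot outside [pending H0 0] has no fact and is closed
   vacuously. *)
have I0 : saturate_inv (V * D) s0 /\ regs s0 0 = regs s0 0.
  split=> //; exists H0, 0; rewrite muln0 addn0 subn0; split=> //.
  split.
    move=> z lt_z; case: (boolP (z \in pending H0 0)) => [|np]; [by left|right].
    split; first by move=> _ y /pending0 k; rewrite k in np.
    by move=> Y d _ y /pending0 k; rewrite k in np.
  move=> p f l r d tk; case: (boolP (p \in pending H0 0)) => [|np]; first by constructor 1.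
  by constructor 3 => y1 y2 y _ /pending0 k; rewrite k in np.
apply: (run_weaken (run_loop (J := fun k s1 => saturate_inv k s1 /\ regs s1 0 = regs s0 0)
  (B := g0 1) (n := V * D) sim I0 (leqnn _) _ _ _ _ _)) => //.
- by move=> k s1 [[H [h [okH _ _ _ _]]] _]; rewrite (sat_fixed okH).
- move=> k s1 [[H [h [okH [r13' le_h] cl se ->]]] r0].
  rewrite r13' (sat_tail okH) => lt_h'; have {lt_h'}lt_h : h < size H by lia.
  have [X [okX r13X cop nod]] := process_ok okH lt_h r13'.
  have le_VD := size_keys okX; rewrite size_cat in le_VD.
  exists (V * D - h.+1); first by lia.
  split; last by rewrite -r0 pden_regs.
  exists (H ++ X), h.+1; split=> //.
  + by split=> //; rewrite size_cat; lia.
  + by move=> a b d lt_a tk y lt_y lt; apply: keys_catl; apply: (cl a b d).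
  + exact: settled_step.
- move=> st' [k [s' [sim' [[H [h [okH [r13' le_h] cl se _]]] r0]]]].
  rewrite r13' (sat_tail okH) => ge_h; exists s', H; split=> //.
  by have <- : h = size H by lia.
Qed.

Lemma chain_keys H z l y : settled H (size H) -> (z, y) \in keys H -> z < V ->
  chain (cell_at MG L Mp 2) z l -> (forall a, a \in l -> 0 < a < V) ->
  forall a, a \in l -> (a, y) \in keys H.
Proof.
move=> [cop _]; elim: l z => [|b l IH] z kz lt_z //= [eb ch] lP a.
have /andP[b0 lt_b] := lP b (mem_head _ _).
have kb : (b, y) \in keys H.
  have [|[c1 _]] := cop z lt_z; first by rewrite /pending drop_size.
  by have := c1 _ y kz; rewrite eb; apply; rewrite -lt0n.
rewrite inE => /predU1P[-> //|]; apply: (IH b) => // c cl; apply: lP.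
by rewrite inE cl orbT.
Qed.

(** Induction on the generation of [t]. For a nonterminal, the fact reaches its slot through the
    rule used, travels along the chain to the occurrence [a], and is copied from there to [d]. *)
Lemma saturated_complete H u t a d y :
  leaves_closed (keys H) L -> settled H (size H) ->
  generates u t -> List.In (a, u, d) TK -> y < D -> represents S P N Q n y t ->
  (d, y) \in keys H.
Proof.
move=> lc se g; elim: g a d y => {u t} [b|f l r tl tr _ IHl _ IHr|X u t Xu _ IH] a d y tk lt_y rep.
- have [_ aL] := token_range end_rules tk.
  apply: (lc a b d) => //; first by lia.
  by apply/(leaf_testP S P N Q n b y).
- have [y1 [y2 [lt1 lt2 rep1 rep2 nt]]] := node_test_complete Qq rep.
  have [tk1 tk2] := rule_tokens_children tk.
  have k1 := IHl _ _ _ tk1 lt1 rep1; have k2 := IHr _ _ _ tk2 lt2 rep2.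
  have [_ nod] := se; rewrite /pending drop_size in nod.
  by case: (nod _ _ _ _ _ tk) => // cl; apply: cl nt.
- have [a' tk'] := rule_tokens_root L start Xu.
  have k := IH _ _ _ tk' lt_y rep.
  have lt_X : L + X < V by rewrite /V ltn_add2l.
  have aocc : a \in occurrences X TK by apply/mem_InP/In_occurrences; exists d.
  have ka : (a, y) \in keys H.
    apply: (chain_keys se k lt_X (rows_chain rowsP X)) aocc => c.
    move=> /mem_InP/In_occurrences[e /(token_range end_rules)]; rewrite /V; lia.
  have lt_a : a < V by have := token_range end_rules tk; rewrite /V; lia.
  have [cop _] := se; have [|[_ c2]] := cop a lt_a; first by rewrite /pending drop_size.
  exact: (c2 X d tk).
Qed.

(** * Reading off the answer *)

Hypothesis start_code : M0 (g0 11 + 1) = rtg_start MG.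
Hypothesis start_lt : g0 11 + 1 < L.
Hypothesis le_n : forall u, u \in P ++ N -> size u <= n.
Hypothesis Qn : Q = q \/ Q = 0 /\ n = 0.

Lemma accept_ok H st : ok H st -> regs st 0 = 0 ->
  mem (pden accept st) = mem st /\
  if regs (pden accept st) 0 == 0 then
    forall y, (L + rtg_start MG, y) \in keys H -> ~~ accept_test S P N Q n y
  else exists y, [/\ (L + rtg_start MG, y) \in keys H, accept_test S P N Q n y
    & regs (pden accept st) 0 = cell_at MG L (mem st) (4 + y) (L + rtg_start MG)].
Proof.
move=> okH r0; set z := L + rtg_start MG.
have gP := sat_fixed okH; have [g08 g09 _] := g0_regs.
have lt_z : z < V by rewrite ltn_add2l.
pose I i (st' : state) := [/\ mem st' = mem st,
  (forall x, x != 0 -> x != 21 -> regs st' x = regs st x) &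
  if regs st' 0 == 0 then
    forall y, y < i -> (z, y) \in keys H -> ~~ accept_test S P N Q n y
  else exists y, [/\ (z, y) \in keys H, accept_test S P N Q n y
    & regs st' 0 = cell_at MG L (mem st) (4 + y) z]].
have [eM _] : I D (pden accept st).
  rewrite /accept pden_for.
  have -> : peval0 st (EReg 8) = D by rewrite -g08 -gP.
  have -> : regs st 1 = g0 1 by rewrite gP.
  have -> : minn D (g0 1) = D by apply/minn_idPl; apply: leq_trans cap4; apply: leq_addl.
  apply: iteri_invariant; first by split=> //; rewrite r0.
  move=> y [g M] lt_y [/= eM fr res]; subst M.
  pose g' := upd g 21 y.
  have ok' : sat_ok H g' (mem st).
    have [? ? ? ? ? ?] := okH; split=> //; last by rewrite /g' /= fr.
    move=> x xf; rewrite -gP // /g' /upd; case: eqP xf => [-> //|/eqP nx xf].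
    by rewrite fr //; apply: contraTneq xf => ->.
  have -> : setreg (State g (mem st)) 21 y = State g' (mem st) by [].
  have fr' x : x != 0 -> x != 21 -> g' x = regs st x.
    by move=> x0 x21; rewrite /g' /upd (negbTE x21) fr.
  have ez : peval g' (mem st) [::] [::]
      (EAdd (EReg 9) (EFetch (EAdd (EReg 11) (ENum 1)))) = z.
    have e9 : g' 9 = L by rewrite fr' // gP.
    have e11 : g' 11 = g0 11 by rewrite fr' // gP.
    rewrite !pevalE (_ : 9 < nglob) // (_ : 11 < nglob) // e9 e11.
    rewrite (input_row okH) ?start_code //.
    by apply: leq_trans start_lt (leq_addr _ _).
  set zexp := EAdd (EReg 9) _ in ez.
  have ec : peval g' (mem st) [::] [::] (EFetch (Ecell (EAdd (ENum 4) (EReg 21)) zexp)) =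
      cell_at MG L (mem st) (4 + y) z.
    rewrite pevalE eval_fact_row //; last exact: sat_fixed ok'.
    by rewrite ez.
  have eacc : peval g' (mem st) [::] [::] (Ecall1 fn_accept_test (EReg 21)) =
      accept_test S P N Q n y.
    rewrite /Ecall1 !pevalE (_ : 21 < nglob) // [g' 21]/=.
    have g'P x : x \in fixed_regs -> g' x = g0 x by apply: (sat_fixed ok').
    apply: peval_accept_test => //.
    - apply: wordsP => // x lt_x; rewrite (input_row okH) // (leq_trans lt_x) ?leq_addr //.
    - by have [? ? ? ? ?] := g0_params; split; rewrite g'P.
    - by have [? ? ? ? ?] := g0_cap; split; rewrite g'P.
  have estep : pden (accept_one (EReg 21)) (State g' (mem st)) =
      if (cell_at MG L (mem st) (4 + y) z != 0) && accept_test S P N Q n y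
      then State (upd g' 0 (cell_at MG L (mem st) (4 + y) z)) (mem st)
      else State g' (mem st).
    rewrite /accept_one -/zexp pden_if peval0_state ec.
    case: eqP => _; rewrite ?pden_skip // pden_if peval0_state eacc nat_of_bool_neq0 /=.
    by case: ifP; rewrite ?pden_skip // pden_assign peval0_state ec.
  rewrite estep; case: ifP => [/andP[nz acc]|nacc].
    split=> //=; first by move=> x x0 x21; rewrite (negbTE x0) fr'.
    rewrite (negbTE nz); exists y; split=> //.
    by have [t []] := key_fact okH lt_z lt_y nz.
  split=> //; move: res; rewrite {1 2}/regs -/(g' 0); rewrite /g' /=.
  case: eqP => // _ res y'; rewrite ltnS leq_eqVlt => /predU1P[->|/res //] ky.
  by have [_ _ nz] := key_table okH ky; rewrite nz /= in nacc; rewrite nacc.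
case: eqP => // _ res; split=> // y ky.
by have [_ lt_y _] := key_table okH ky; apply: res.
Qed.

Lemma accept_correct H st : ok H st -> regs st 0 = 0 ->
  leaves_closed (keys H) L -> settled H (size H) ->
  (forall t, rtg_lang MG t -> exists G, decode S t = Some G) ->
  (forall t G, rtg_lang MG t -> decode S t = Some G -> productive G) ->
  correct_output S P N MG (pden accept st).
Proof.
move=> okH r0 lc se dec prod.
have sound_t y t : accept_test S P N Q n y -> y < D -> represents S P N Q n y t ->
    rtg_lang MG t -> solution S P N MG t.
  move=> acc lt_y rep lt; split=> //; have [G dG] := dec t lt.
  have pG := prod t G lt dG; exists G => //.
  case: Qn => [eQ|[eQ en]].
    apply: ((accepts_separates dG pG le_n).1 ((@accept_testP q s S P N Q n Qq t le_n eQ).1 _)).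
    by exists y.
  (* All words are empty here: the single state accepts just when [P] is empty, and a productive
     grammar derives no word of [N]. *)
  have y0 : y = 0.
    by move: lt_y; rewrite /D /nstates /nbits eQ !muln0 expn0; lia.
  rewrite y0 (accept_test0 S P N n t eQ) in acc.
  split=> w wi; first by rewrite (eqP acc) in wi.
  move=> /(productive_nonempty pG); have := le_n (u := w).
  by rewrite mem_cat wi orbT en leqn0 => /(_ isT) /eqP ->.
have complete_t t : solution S P N MG t -> exists y,
    [/\ y < D, represents S P N Q n y t & accept_test S P N Q n y].
  move=> [lt [G dG sep]]; have pG := prod t G lt dG.
  case: Qn => [eQ|[eQ en]].
    have [y lt_y [rep acc]] := (@accept_testP q s S P N Q n Qq t le_n eQ).2
      ((accepts_separates dG pG le_n).2 sep).
    by exists y.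
  exists 0; split; [by rewrite expn_gt0 | exact: represents0 |].
  rewrite (accept_test0 S P N n t eQ); apply/eqP; case eP: (P) => [//|w P'].
  have wP : w \in P by rewrite eP mem_head.
  have := productive_nonempty pG (sep.1 w wP); have := le_n (u := w).
  by rewrite mem_cat wP en leqn0 => /(_ isT) /eqP ->.
have [eM res] := accept_ok okH r0; rewrite /correct_output; move: res.
case: eqP => [_ none t sol|_ [y [ky acc ->]]].
  have [y [lt_y rep acc]] := complete_t t sol.
  have gt := (rtg_langP MG t).1 sol.1; inversion gt as [| |X u t' Xu gu]; subst.
  have [a tk] := rule_tokens_root L start Xu.
  have := saturated_complete lc se gu tk lt_y rep.
  by move=> /none; rewrite acc.
have [lt_z lt_y nz] := key_table okH ky.
have [t [_ st_t [rep _ gen]]] := key_fact okH lt_z lt_y nz.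
exists t; first by rewrite eM; apply: stored_in_stored st_t.
apply: (sound_t y) => //; apply/rtg_langP; apply: gen; exact: SlotNt.
Qed.
End Saturation.

(** * The program and its running time *)

Definition assigns (l : seq (nat * pexp)) : cmd :=
  foldr (fun xe => Seq (pcompile nglob (PAssign xe.1 xe.2))) Skip l.

Fixpoint abound B (l : seq (nat * pexp)) : nat :=
  if l is (_, e) :: l' then pbound B e + 2 + abound B l' else 1.

(** The cap in register 1 grows during [setup], whereas [abound] is used once, with the final
    cap. *)
Lemma pbound_mono B B' e : B <= B' -> pbound B e <= pbound B' e.
Proof. by move=> le_B; elim: e => //= *; rewrite ?leq_add ?leq_mul ?leq_add. Qed.

Lemma run_assigns_nil B st (Q : state -> Prop) : Q st -> run (assigns [::]) st (abound B [::]) Q.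
Proof. by move=> Qst; exists 1, st; split=> //; apply: ExecSkip. Qed.

Lemma run_assigns_cons B x e v l st g M (Q : state -> Prop) :
  simulates st (State g M) -> x < nglob -> g 1 <= B -> peval g M [::] [::] e = v ->
  (forall st', simulates st' (State (upd g x v) M) ->
     run (assigns l) st' (abound B l) Q) ->
  run (assigns ((x, e) :: l)) st (abound B ((x, e) :: l)) Q.
Proof.
move=> sim lt_x capB <- next; apply: run_seq (run_passign e sim lt_x) next _.
by rewrite leq_add2r leq_add2r; apply: pbound_mono.
Qed.

Definition Emul := Ecall2 fn_mul.
Definition Esucc e := EAdd e (ENum 1).

(* Registers: 1 cap, 2 size of P, 3 address of N, 4 number of words, 5 maximal
   length, 6 number of nonterminals (0 when all words are empty), 7 axiom, 8
   number of states, 11 address of the meta-grammar.  Register 1 increases along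
   the way, as each loop is capped by its current value. *)
Definition setup : seq (nat * pexp) :=
  [:: (1, EFetch (ENum 3)); (2, EFetch (ENum 3));
      (3, EFold (EReg 2) (ENum 4) fn_wpos_step);
      (4, EAdd (EReg 2) (EFetch (EReg 3))); (1, EReg 4);
      (11, EFold (EFetch (EReg 3)) (Esucc (EReg 3)) fn_wpos_step);
      (5, EFold (EReg 4) (ENum 0)
        (EAdd (EVar 0) (ESub (EFetch (Ecall1 fn_wpos (EVar 1))) (EVar 0))));
      (6, EIf (EReg 5) (EFetch (ENum 0)) (ENum 0)); (7, EFetch (ENum 2));
      (1, Esucc (EAdd (EReg 4) (EReg 5)));
      (8, Emul (Esucc (EReg 5)) (Emul (Esucc (EReg 5)) (Emul (EReg 4)
        (EAdd (EReg 6) (EReg 6)))));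
      (1, EAdd (EReg 1) (EReg 8)); (8, Ecall1 fn_pow2 (EReg 8));
      (1, EAdd (EAdd (EReg 1) (EReg 8)) (EAdd (EReg 6) (ENum 10)));
      (14, EAdd (EReg 11) (ENum 3)); (15, EFetch (EAdd (EReg 11) (ENum 2)))].

Definition setup_links : seq (nat * pexp) :=
  [:: (9, EReg 14); (10, EAdd (EReg 9) (EFetch (EReg 11)));
      (12, Emul (EAdd (ENum 4) (EReg 8)) (EReg 10)); (13, EReg 12);
      (14, EAdd (EReg 11) (ENum 3)); (15, EFetch (EAdd (EReg 11) (ENum 2)));
      (16, ENum 0); (17, ENum 0)].

Definition setup_leaves : seq (nat * pexp) := [:: (14, ENum 0)].

(* Register 39 is never assigned and stays 0. *)
Definition separation_program : cmd :=
  Seq (assigns setup)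
 (Seq (While (guard 15 39) (pcompile nglob scan_step))
 (Seq (assigns setup_links)
 (Seq (While (guard 15 39) (pcompile nglob link_step))
 (Seq (assigns setup_leaves)
 (Seq (While (guard 9 14) (pcompile nglob leaf_step))
 (Seq (While (guard 12 13) (pcompile nglob process_step))
      (pcompile nglob accept))))))).

(** * Reading the words of the instance *)

Section Words.
Context {s : nat}.
Implicit Types W : seq (seq 'I_s).

Definition words_body W := flatten [seq word_code w | w <- W].

Lemma words_step_iter g M env W a j : seg M a (words_body W) -> j <= size W ->
  iteri j (fun i acc => peval g M [:: acc, i & env] [::] fn_wpos_step) a =
  a + size (words_body (take j W)).
Proof.
move=> sg; elim: j => [_|j IH lt_j]; first by rewrite take0 addn0.
rewrite /= IH ?(ltnW lt_j) // /fn_wpos_step !pevalE /=.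
have eW : W = take j W ++ nth [::] W j :: drop j.+1 W by rewrite -drop_nth // cat_take_drop.
have eb : words_body (take j.+1 W) = words_body (take j W) ++ word_code (nth [::] W j).
  by rewrite (take_nth [::]) // /words_body map_rcons flatten_rcons.
have [_ /seg_cat[/seg_cons[-> _] _]] : seg M a (words_body (take j W)) /\
    seg M (a + size (words_body (take j W)))
      (word_code (nth [::] W j) ++ words_body (drop j.+1 W)).
  by apply/seg_cat; move: sg; rewrite {1}eW /words_body map_cat flatten_cat.
by rewrite eb size_cat /= size_map addn1 addnA.
Qed.

Lemma word_seg M W a j : seg M a (words_body W) -> j < size W ->
  seg M (a + size (words_body (take j W))) (word_code (nth [::] W j)).
Proof.
move=> sg lt_j.
have eW : W = take j W ++ nth [::] W j :: drop j.+1 W by rewrite -drop_nth // cat_take_drop.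
by move: sg; rewrite {1}eW /words_body map_cat flatten_cat => /seg_cat[_ /seg_cat[]].
Qed.

Lemma words_readyP (P N : seq (seq 'I_s)) g M a :
  g 2 = size P -> g 3 = a -> size P <= g 1 -> size N <= g 1 ->
  seg M 4 (words_body P) -> seg M (a + 1) (words_body N) -> words_ready P N g M.
Proof.
move=> g2 g3 P1 N1 sgP sgN W m w lt_w.
suff : seg M (peval g M [:: w] [::] fn_wpos) (word_code (word W w)).
  move=> /seg_cons[e sg] /=; split=> // i lt_i.
  by rewrite addn1 sg ?size_map.
rewrite /fn_wpos -lock peval_if peval_sub !pevalE /= g2 subn_eq0 -ltnNge /word /W nth_cat.
case: ltnP => [lt_wP|le_w].
  rewrite peval_fold !pevalE /= (minn_idPl _); last by lia.
  by rewrite (words_step_iter _ _ sgP) ?(ltnW lt_wP) //; apply: word_seg.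
have lt_wN : w - size P < size N.
  by rewrite ltn_subLR // -size_cat.
rewrite peval_fold !pevalE /= g2 g3 (minn_idPl _); last by lia.
by rewrite (words_step_iter _ _ sgN) ?(ltnW lt_wN) //; apply: word_seg.
Qed.

(** With truncated subtraction, [acc + (x - acc)] is the maximum of [acc] and [x]. *)
Lemma max_length_iter (P N : seq (seq 'I_s)) g M k : words_ready P N g M ->
  k <= size (P ++ N) ->
  iteri k (fun i acc => peval g M [:: acc; i] [::]
    (EAdd (EVar 0) (ESub (EFetch (Ecall1 fn_wpos (EVar 1))) (EVar 0)))) 0 =
  \max_(w <- take k (P ++ N)) size w.
Proof.
move=> wr; elim: k => [_|k IH lt_k]; first by rewrite take0 big_nil.
rewrite /= IH ?(ltnW lt_k) // /Ecall1 !pevalE /= (wr k lt_k).1.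
by rewrite (take_nth [::]) // -cats1 big_cat big_seq1 /= maxnE.
Qed.

Lemma size_words_body W n : (forall w, w \in W -> size w <= n) ->
  size (words_body W) <= size W * n.+1.
Proof.
elim: W => //= w W IH le_n; rewrite /words_body /= size_cat size_map mulSn -addSn.
apply: leq_add; first by apply: le_n; apply: mem_head.
by apply: IH => v vW; apply: le_n; rewrite inE vW orbT.
Qed.
End Words.

Section Main.
Context {q s : nat} (S : 'I_q) (P N : seq (seq 'I_s)) (MG : rtg q s).
Notation nt := (rtg_nt MG).
Let m := size (P ++ N).
Let n := max_length P N.
Let Q := if 0 < n then q else 0.
Let nb := nbits P N Q n.
Let D := nstates P N Q n.
Let M0 := nth 0 (instance_code S P N MG).
Let aN := 4 + size (words_body P).
Let aG := aN + 1 + size (words_body N).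
Let start := aG + 3.
Let L := size (instance_code S P N MG).
Let V := L + nt.
Let HB := (4 + D) * V.

(* Bounds all loop counts, including the row indices up to [4 + D]. *)
Definition cap := m + n + 1 + nb + D + (Q + 10).

Ltac assign_reg sim val :=
  apply: (run_assigns_cons (v := val) sim);
    [by [] | first [by [] | by rewrite /=; lia | by rewrite /cap /=; lia] | |
     let st := fresh "st" in clear sim; intros st sim].

Lemma instance_codeE : instance_code S P N MG =
  [:: q; s; val S; size P] ++ words_body P ++ [:: size N] ++ words_body N ++
  [:: nt; val (rtg_start MG); size (rtg_rules MG)] ++ rules_code (rtg_rules MG).
Proof. by []. Qed.

Lemma size_instance : start + size (rules_code (rtg_rules MG)) = L.
Proof. by rewrite /L instance_codeE !size_cat /= /start /aG /aN; lia. Qed.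

Lemma instance_segs : [/\ seg M0 0 [:: q; s; val S; size P], seg M0 4 (words_body P),
  seg M0 aN [:: size N], seg M0 (aN + 1) (words_body N)
  & seg M0 aG [:: nt; val (rtg_start MG); size (rtg_rules MG)] /\
    seg M0 start (rules_code (rtg_rules MG))].
Proof.
have : seg M0 0 (instance_code S P N MG) by move=> i.
rewrite instance_codeE => /seg_cat[s1 /seg_cat[s2 /seg_cat[s3 /seg_cat[s4 /seg_cat[s5 s6]]]]].
by split.
Qed.

Lemma instance_end x : L <= x -> M0 x = 0.
Proof. exact: nth_default. Qed.

Lemma max_lengthP u : u \in P ++ N -> size u <= n.
Proof. by move=> uW; rewrite /n /max_length (leq_bigmax_seq _ uW). Qed.

Lemma run_setup st g : simulates st (State g M0) -> g 1 = 0 -> [/\ g 0 = 0, g 16 = 0 & g 39 = 0] ->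
  run (assigns setup) st (abound cap setup) (fun st' => exists g',
    [/\ simulates st' (State g' M0), [/\ g' 0 = 0, g' 16 = 0 & g' 39 = 0], g' 1 = cap,
        [/\ params_ready S P N Q n g', g' 3 = aN, g' 8 = D & g' 11 = aG] &
        g' 14 = start /\ g' 15 = size (rtg_rules MG)]).
Proof.
move=> sim g1 [g00 g16 g39]; have [s1 s2 s3 s4 [s5 s6]] := instance_segs.
have c0 : M0 0 = q by rewrite (s1 0).
have c2 : M0 2 = S by rewrite (s1 2).
have c3 : M0 3 = size P by rewrite (s1 3).
have cN : M0 aN = size N by rewrite -[aN]addn0 (s3 0).
have c5 : M0 (aG + 2) = size (rtg_rules MG) by rewrite (s5 2).
have em : m = size P + size N by rewrite /m size_cat.
have [cP cm] : size P <= cap /\ m <= cap by rewrite /cap; lia.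
assign_reg sim (size P); first by rewrite !pevalE.
assign_reg sim (size P); first by rewrite !pevalE.
assign_reg sim aN; first by rewrite peval_fold !pevalE /= minnn (words_step_iter _ _ s2) // take_size.
assign_reg sim m; first by rewrite !pevalE /= cN em.
assign_reg sim m; first by rewrite !pevalE.
assign_reg sim aG.
  rewrite peval_fold /Esucc !pevalE /= cN (minn_idPl _); last by lia.
  by rewrite (words_step_iter _ _ s4) // take_size.
assign_reg sim n.
  rewrite peval_fold !pevalE /= minnn (@max_length_iter _ P N) ?take_size //.
  by apply: (words_readyP (a := aN)) => //=; lia.
assign_reg sim Q; first by rewrite !pevalE /= c0 /Q lt0n; case: eqP.
assign_reg sim (val S); first by rewrite !pevalE.
assign_reg sim (m + n + 1); first by rewrite /Esucc !pevalE.
assign_reg sim nb.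
  rewrite /Emul /Esucc /Ecall2 !pevalE /= !peval_mul ?addn1 //=; lia.
assign_reg sim (m + n + 1 + nb); first by rewrite !pevalE.
assign_reg sim D; first by rewrite /Ecall1 !pevalE /= peval_pow2 //=; lia.
assign_reg sim cap; first by rewrite !pevalE.
assign_reg sim start; first by rewrite !pevalE.
assign_reg sim (size (rtg_rules MG)); first by rewrite !pevalE.
apply: run_assigns_nil; eexists; split; first exact: sim.
- by rewrite /= g00 g16 g39.
- by [].
- by split=> //; split.
- by [].
Qed.

Definition program_bound B len V' D' :=
  abound B setup + ((len * (pcbound B scan_step + 4) + 4) +
  (abound B setup_links + ((len * (pcbound B link_step + 4) + 4) +
  (abound B setup_leaves + ((len * (pcbound B leaf_step + 4) + 4) +
  ((V' * D' * (pcbound B process_step + 4) + 4) + pcbound B accept)))))).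

Lemma program_correct :
  (forall t, rtg_lang MG t -> exists G, decode S t = Some G) ->
  (forall t G, rtg_lang MG t -> decode S t = Some G -> productive G) ->
  run separation_program (initial_state (instance_code S P N MG))
    (program_bound cap L V D) (correct_output S P N MG).
Proof.
move=> dec prod; have [s1 s2 s3 s4 [s5 s6]] := instance_segs.
have start0 : 0 < start by rewrite /start addn3.
have L_start : start <= L by rewrite -size_instance leq_addr.
have L0 : 0 < L by apply: leq_trans start0 L_start.
have cap4 : 4 + D <= cap by rewrite /cap; lia.
have D0 : 0 < D by rewrite /D /nstates expn_gt0.
have Qq : Q = 0 \/ Q = q by rewrite /Q; case: ifP; auto.
have Qn : Q = q \/ Q = 0 /\ n = 0 by rewrite /Q; case: posnP; auto.
have fixed_mem x : 0 < x < 12 -> x \in fixed_regs by rewrite /fixed_regs mem_iota.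
have sim0 : simulates (initial_state (instance_code S P N MG)) (State (fun _ => 0) M0) by [].
rewrite /separation_program /program_bound.
apply: run_seq (run_setup sim0 _ _) _ (leqnn _) => //.
move=> {sim0}st [g [sim [g00 g16 g39] g1 [par g3 g8 g11] [g14 g15]]].
have sgR : seg M0 (regs (State g M0) 14) (rules_code (rtg_rules MG)) by rewrite /= g14.
apply: run_seq (run_scan sim g1 g39 erefl sgR _ g15 g16) _ (leqnn _).
  by rewrite /= g14 size_instance.
move=> {sim}st2 [[h M] [sim eM h14 hP]]; rewrite /= in eM hP; rewrite eM in sim.
have hg x : x \notin [:: 14; 15; 16] -> h x = g x by apply: hP.
apply: (run_seq (Q1 := fun st' => exists h', [/\ simulates st' (State h' M0),
    forall x, x \notin [:: 9; 10; 12; 13; 14; 15; 16; 17] -> h' x = g x,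
    [/\ h' 9 = L, h' 10 = V, h' 12 = HB & h' 13 = HB] &
    [/\ h' 14 = start, h' 15 = size (rtg_rules MG), h' 16 = 0 & h' 17 = 0]])) _ _ (leqnn _).
  have h1 : h 1 = cap by rewrite hg.
  have h11 : h 11 = aG by rewrite hg.
  have h8 : h 8 = D by rewrite hg.
  have rG : [/\ M0 aG = nt & M0 (aG + 2) = size (rtg_rules MG)].
    by rewrite -{1}[aG]addn0 (s5 0) // (s5 2).
  case: rG => rG0 rG2.
  assign_reg sim L; first by rewrite pevalE.
  assign_reg sim V; first by rewrite !pevalE /= h11 rG0.
  assign_reg sim HB; first by rewrite /Emul /Ecall2 !pevalE /= h8 peval_mul //= h1.
  assign_reg sim HB; first by rewrite !pevalE.
  assign_reg sim start; first by rewrite !pevalE /= h11.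
  assign_reg sim (size (rtg_rules MG)); first by rewrite !pevalE /= h11.
  assign_reg sim 0; first by rewrite !pevalE.
  assign_reg sim 0; first by rewrite !pevalE.
  apply: run_assigns_nil; eexists; split; first exact: sim; try by [].
  move=> x; rewrite !inE !negb_or /= => /and5P[/negbTE-> /negbTE-> /negbTE-> /negbTE->].
  move=> /and4P[/negbTE e14 /negbTE e15 /negbTE e16 /negbTE->]; rewrite e14 e15 e16.
  by apply: hg; rewrite !inE e14 e15 e16.
move=> {h M hP h14 hg sim st2 eM}st2 [h [sim hg [h9 h10 h12 h13] [h14 h15 h16 h17]]].
have h39 : h 39 = 0 by rewrite hg.
have h1 : h 1 = cap by rewrite hg.
apply: run_seq (run_link sim h1 h39 erefl instance_end h9 h10 _ start0 h14 s6
  size_instance h15 h16 h17) _ (leqnn _); first by lia.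
move=> {sim}st3 [[f Mp] [sim okM fP]]; rewrite /= in okM fP.
have fh x : x \notin [:: 14; 15; 16; 17; 18] -> f x = h x by apply: fP.
have fg x : 0 < x < 9 \/ x = 11 \/ x = 0 -> f x = g x.
  by move=> xP; rewrite fh ?hg // !inE; lia.
apply: (run_seq (Q1 := fun st' => simulates st' (State (upd f 14 0) Mp))) _ _ (leqnn _).
  apply: (run_assigns_cons (v := 0) sim) => //; first by rewrite /= fg ?g1 //; lia.
  by move=> st4 sim4; apply: run_assigns_nil.
move=> {sim}st4 sim; set g0 := upd f 14 0 in sim.
have g0g x : 0 < x < 9 \/ x = 11 \/ x = 0 -> g0 x = g x.
  by move=> xP; rewrite /g0 /upd ifF ?fg //; lia.
have g01 : g0 1 = cap by rewrite g0g //; lia.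
have regsP : [/\ g0 8 = D, g0 9 = L & g0 10 = V].
  by split; rewrite /g0 /= fh ?h9 ?h10 ?hg.
have par0 : params_ready S P N Q n g0.
  by case: par => *; split; rewrite g0g //; lia.
have cap0 : cap_ready P N Q n g0.
  by split; rewrite g01 /cap -/m -/nb -/D; lia.
have cap40 : 4 + D <= g0 1 by rewrite g01.
have words g' M' : (forall x, x \in fixed_regs -> g' x = g0 x) -> agree L M' M0 ->
    words_ready P N g' M'.
  move=> gP ag; have em : m = size P + size N by rewrite /m size_cat.
  have g'P x : 0 < x < 9 -> g' x = g x.
    by move=> xP; rewrite gP ?fixed_mem ?g0g //; lia.
  have [g2 _ _ _ _] := par.
  apply: (words_readyP (a := aN)); rewrite ?g'P ?g1 //; try by rewrite /cap; lia.
    by apply: seg_agree ag _ s2; rewrite -size_instance /start /aG /aN; lia.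
  by apply: seg_agree ag _ s4; rewrite -size_instance /start /aG /aN; lia.
have ok0 : ok S P N Q n MG Mp L start g0 [::] (State g0 Mp).
  split=> //=; first by rewrite /g0 /= fh ?h12 // muln0 addn0.
  move=> y z _ _; rewrite /cell_at (rows_zero okM) //.
  by rewrite mulnDl -addnA leq_addr.
have r13 : g0 13 = HB by rewrite /g0 /= fh.
(* The remaining loop lemmas express their bounds by the cap as held in register 1. *)
rewrite -{1 2 3}g01.
apply: run_seq (run_leaves size_instance s6 okM regsP par0 cap0 cap40 words Qq L0
  sim ok0 r13 erefl) _ (leqnn _).
move=> {sim}st5 [s' [H [sim okH r13' cl r0]]].
apply: run_seq (run_saturate size_instance s6 okM regsP par0 cap0 cap40 Qq L0
  sim okH r13' cl) _ (leqnn _).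
move=> {sim}st6 [s'' [H' [sim okH' cl' se r0']]].
have r00 : regs s'' 0 = 0 by rewrite r0' r0 /= g0g ?g00; lia.
have -> : g0 1 = regs s'' 1 by rewrite (sat_fixed okH').
apply: run_weaken (run_pcompile (c := accept) _ (leqnn _) sim) _ _ => // st7 [[ag em] _].
have st_code : M0 (g0 11 + 1) = rtg_start MG by rewrite g0g ?g11 ?(s5 1) //; lia.
have st_lt : g0 11 + 1 < L by rewrite g0g ?g11; move: L_start; rewrite /start; lia.
have := accept_correct size_instance okM regsP par0 cap0 cap40 words Qq L0 st_code
  st_lt max_lengthP Qn okH' r00 cl' se dec prod.
by rewrite /correct_output ag // em.
Qed.

(** For [n > 0], using [n.+1 <= 2 * n] twice and doubling [Q] for the two halves of a state gives
    the factor 8; the other summands are linear in [k] and absorbed by [2 ^ 5]. For [n = 0] only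
    [2 ^ 5] is left: without repetitions, [P] and [N] contain at most the empty word each, so
    [m <= 2], and [Q = 0]. *)
Lemma cap_bound : uniq P -> uniq N -> cap <= 2 ^ (8 * ((size P + size N) * n ^ 2 * q) + 5).
Proof.
move=> uP uN; have em : m = size P + size N by rewrite /m size_cat.
rewrite -em; set k := m * n ^ 2 * q.
case: (posnP n) => [n0|n_gt0].
  have nil u : u \in P ++ N -> u \in [:: [::]].
    by move=> /max_lengthP; rewrite n0; case: u.
  have P1 : size P <= 1.
    by apply: (uniq_leq_size (s2 := [:: [::]]) uP) => u uP'; apply: nil; rewrite mem_cat uP'.
  have N1 : size N <= 1.
    by apply: (uniq_leq_size (s2 := [:: [::]]) uN) => u uN'; apply: nil; rewrite mem_cat uN' orbT.
  have Q0 : Q = 0 by rewrite /Q n0.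
  have nb0 : nb = 0 by rewrite /nb Q0 /nbits !muln0.
  have D1 : D = 1 by rewrite /D /nstates -/nb nb0.
  apply: (@leq_trans (2 ^ 5)); last by rewrite leq_pexp2l // leq_addl.
  by rewrite /cap n0 nb0 D1 Q0 em; lia.
have q_gt0 : 0 < q by case: (q) S => [[]|].
have m_gt0 : 0 < m.
  rewrite lt0n /m size_eq0; apply/negP => /eqP e.
  by move: n_gt0; rewrite /n /max_length e big_nil.
have eQ : Q = q by rewrite /Q n_gt0.
have n2 : 0 < n ^ 2 by rewrite expn_gt0 n_gt0.
have le_nb : nb <= 8 * k.
  apply: (@leq_trans ((2 * n) * ((2 * n) * (m * (q + q))))); last by rewrite /k; nia.
  by rewrite /nb /nbits eQ; apply: leq_mul; [lia|apply: leq_mul; lia].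
have le_D : D <= 2 ^ (8 * k) by rewrite /D /nstates leq_pexp2l.
have le_m : m <= k by rewrite /k -mulnA leq_pmulr // muln_gt0 n2.
have le_q : q <= k by rewrite /k leq_pmull // muln_gt0 m_gt0.
have le_n : n <= k.
  apply: (@leq_trans (n ^ 2)); first by rewrite -mulnn leq_pmulr.
  by rewrite /k mulnAC leq_pmull // muln_gt0 m_gt0.
have lt_k : 8 * k < 2 ^ (8 * k) by apply: ltn_expl.
rewrite expnD /cap eQ; lia.
Qed.

Lemma size_rules_code g (rs : seq ('I_g * term q s 'I_g)) :
  size (flatten [seq val r.1 :: term_code r.2 | r <- rs]) <=
  2 * sumn [seq (term_size r.2).+1 | r <- rs].
Proof. by elim: rs => //= r rs IH; rewrite size_cat size_term_code; lia. Qed.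

(** The input has eight header cells, at most [m * n.+1] cells of words, and rules that together
    with [nt] take at most twice the size of the meta-grammar; [cap ^ 2] bounds each of the first
    two. *)
Lemma heap_bound : V <= 3 * cap ^ 2 * rtg_size MG.
Proof.
have mn : m * n.+1 <= cap ^ 2.
  by rewrite -mulnn; apply: leq_mul; rewrite /cap; lia.
have le_max W : {subset W <= P ++ N} -> size (words_body W) <= size W * n.+1.
  by move=> sW; apply: size_words_body => w /sW; apply: max_lengthP.
have sP : size (words_body P) <= size P * n.+1.
  by apply: le_max => w wP; rewrite mem_cat wP.
have sN : size (words_body N) <= size N * n.+1.
  by apply: le_max => w wN; rewrite mem_cat wN orbT.
have cap2 : 8 <= cap ^ 2.
  by apply: (@leq_trans (10 ^ 2)) => //; rewrite leq_exp2r // /cap; lia.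
have nt0 : 0 < nt by case: (nt) (rtg_start MG) => [[]|].
have sz := size_rules_code (rtg_rules MG); rewrite -/(rules_code _) in sz.
have size0 : 0 < rtg_size MG by rewrite /rtg_size; lia.
apply: (@leq_trans (2 * cap ^ 2 + 2 * rtg_size MG)); last by nia.
rewrite /V -size_instance /start /aG /aN /rtg_size.
by move: mn; rewrite /m size_cat mulnDl; lia.
Qed.
End Main.


Lemma abound_poly l : poly_bounded (abound^~ l).
Proof.
elim: l => [|[x e] l IH] /=; first exact: poly_bounded_const.
by repeat first [ assumption | exact: poly_bounded_const | exact: pbound_poly
  | apply: poly_bounded_add ].
Qed.

(** Every uncapped loop runs at most [V] or [V * D] times with [D <= B], so a single factor [V] can
    be taken out and the rest is a polynomial in [B]. *)
Lemma program_bound_poly : exists a e, forall B L V D,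
  0 < B -> 0 < V -> L <= V -> D <= B -> program_bound B L V D <= a * B ^ e * V.
Proof.
pose f B := (abound B setup + (pcbound B scan_step + 8)) +
  (abound B setup_links + (pcbound B link_step + 8)) +
  (abound B setup_leaves + (pcbound B leaf_step + 8)) +
  (B * (pcbound B process_step + 4) + (4 + pcbound B accept)).
have [a [e fP]] : poly_bounded f.
  rewrite /f; repeat first [ exact: poly_bounded_const | exact: poly_bounded_id
    | exact: abound_poly | exact: pcbound_poly
    | apply: poly_bounded_add | apply: poly_bounded_mul ].
exists a, e => B L V D B0 V0 le_L le_D.
apply: (@leq_trans (f B * V)); last by rewrite leq_mul2r fP ?orbT.
rewrite /program_bound /f.
move: (abound B setup) (pcbound B scan_step) (abound B setup_links) (pcbound B link_step)
  (abound B setup_leaves) (pcbound B leaf_step) (pcbound B process_step) (pcbound B accept).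
move=> x1 y1 x2 y2 x3 y3 z t; have scale x : x <= x * V by rewrite leq_pmulr.
have loop x : L * (x + 4) + 4 <= (x + 8) * V.
  apply: (@leq_trans (V * (x + 4) + 4 * V)); last by lia.
  by rewrite leq_add ?leq_mul2r ?le_L ?orbT // scale.
have work : V * D * (z + 4) <= B * (z + 4) * V.
  by rewrite -mulnA mulnC leq_mul2r leq_mul2r le_D !orbT.
move: (scale x1) (scale x2) (scale x3) (scale (4 + t)).
by move: (loop y1) (loop y2) (loop y3) work; lia.
Qed.

Local Open Scope ring_scope.
Lemma horner_affine_nat (a b k : nat) : (a%:P * 'X + b%:P).[k] = (a * k + b)%N.
Proof. by rewrite !hornerE. Qed.
Local Close Scope ring_scope.

Theorem theorem7p1 :
  exists (c : cmd) (p : {poly nat}) (C : nat),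
  forall (q s : nat) (S : 'I_q) (P N : seq (seq 'I_s)) (MG : rtg q s),
    uniq P -> uniq N ->
    (forall t, rtg_lang MG t -> exists G, decode S t = Some G) ->
    (forall t G, rtg_lang MG t -> decode S t = Some G -> productive G) ->
    let m := size P + size N in
    let n := max_length P N in
    let k := m * n ^ 2 * q in
    exists (t : nat) (st : state),
      [/\ exec c (initial_state (instance_code S P N MG)) t st,
          t <= C * 2 ^ (p.[k])%R * rtg_size MG
        & correct_output S P N MG st].
Proof.
have [a [e bound]] := program_bound_poly.
(* The time is at most [a * B ^ e * V], where [V <= 3 * B ^ 2 * rtg_size MG] and
   [B <= 2 ^ (8 * k + 5)]; hence the exponent [(8 * k + 5) * (e + 2)] and the constant [3 * a]. *)
exists separation_program, ((8 * (e + 2))%:P * 'X + (5 * (e + 2))%:P)%R, (3 * a).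
move=> q s S P N MG uP uN dec prod m n k; rewrite horner_affine_nat.
have [t [st [ex le_t out]]] := program_correct P N dec prod; exists t, st; split=> //.
apply: leq_trans le_t _; apply: leq_trans (bound _ _ _ _ _ _ _ _) _.
- by rewrite /cap; lia.
- by case: (rtg_nt MG) (rtg_start MG) => [[]|g _] //; rewrite addnS.
- exact: leq_addr.
- by rewrite /cap; lia.
have cap_k := cap_bound S MG uP uN; rewrite -/m -/n -/k in cap_k.
have le_V := heap_bound S P N MG; set B := cap _ _ in cap_k le_V *.
apply: (@leq_trans (3 * a * B ^ (e + 2) * rtg_size MG)).
  apply: leq_trans (leq_mul (leqnn _) le_V) _.
  by rewrite expnD; lia.
rewrite leq_mul2r leq_mul2l; apply/orP; right; apply/orP; right.
rewrite -[X in 2 ^ X](_ : (8 * k + 5) * (e + 2) = _); last by lia.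
by rewrite expnM leq_exp2r ?cap_k // addn2.
Qed.
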